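(* Let $\mu,\lambda\in(0,1)$, let $S^2$ be a $(0,\infty)$-valued $\mathbb F$-adapted process, and let $K=(K_t)_{t\in\mathbb T}$ be given by $$K_t(\omega)=\big\{x\in\mathbb R^2:\ x^1+S^2_t(\omega)\big[(1-\mu)x^2\mathbf 1_{x^2\ge0}+(1+\lambda)x^2\mathbf 1_{x^2<0}\big]\ge0\big\}.$$ Assume that $A^s(K)$ is closed in measure and that $A_T(0;K)\cap L^0(\mathbb R^2_+;\mathcal F)=\{0\}$. Then for every $\vartheta\in L^0(\mathbb R^2;\mathbb F)$ such that $\vartheta^1$ and $\vartheta^2$ are uniformly bounded from below, $$\inf\{x^1\in\mathbb R:\ (x^1,0)\in\Gamma(\vartheta;K)\}=\sup_{X\in\mathcal X}\ \sup_{(\chi,\mathbb Q)\in\mathcal P(X;K,\mathbb P)}\mathbb E^{\mathbb Q}\Big[\sum_{t\in\mathbb T}X_t\big(\vartheta^1_t+\chi_t\vartheta^2_tS^2_t\big)\Big].$$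
   Context: Setting: $\mathbb T=\{0,\dots,T\}$ with an integer $T\ge1$; $(\Omega,\mathcal F,\mathbb P)$ is a complete probability space with filtration $\mathbb F=(\mathcal F_t)_{t\in\mathbb T}$, $\mathcal F_T=\mathcal F$, $\mathcal F_0$ trivial. Relations between random variables are understood $\mathbb P$-a.s. There are two assets: a non-risky one with price $S^1\equiv1$ and a risky one with price $S^2$. $L^0(E;\mathbb F)$ (resp. $L^0(E;\mathcal F)$) is the set of $\mathbb F$-adapted processes indexed by $\mathbb T$ (resp. $\mathcal F$-measurable random variables) with values in $E$. $\mathcal A(K)=\{\xi\in L^0(\mathbb R^2;\mathbb F):\xi_t\in -K_t\ \forall t\in\mathbb T\}$; $V^{x,\xi}_t=x+\sum_{s=0}^t\xi_s$ for $x\in\mathbb R^2$; $A(x;K)=\{V^{x,\xi}:\xi\in\mathcal A(K)\}$; $A_T(x;K)=\{V_T:V\in A(x;K)\}$; $A^s(x;K)=\{\vartheta\in L^0(\mathbb R^2;\mathbb F): \exists V\in A(x;K)\text{ with }V_t-\vartheta_t\in K_t\ \forall t\in\mathbb T\}$; $A^s(K)=A^s(0;K)$; $\Gamma(\vartheta;K)=\{x\in\mathbb R^2:\vartheta\in A^s(x;K)\}$. A subset $B\subset L^0(\mathbb R^2;\mathbb F)$ is closed in measure if: $v^n\in B$ and $\lim_n\mathbb P[\sum_{t\in\mathbb T}\|v^n_t-v_t\|>\varepsilon]=0$ for all $\varepsilon>0$ imply $v\in B$. A randomized stopping time is a nonnegative $\mathbb F$-adapted process $X=(X_t)_{t\in\mathbb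 T}$ with $\sum_{t\in\mathbb T}X_t=1$; $\mathcal X$ is the set of all of them. For $X\in\mathcal X$, $\mathcal P(X;K,\mathbb P)$ is the set of pairs $(\chi,\mathbb Q)$ where $\chi$ is an $\mathbb F$-adapted process with $1-\mu\le\chi_t\le1+\lambda$ for all $t\in\mathbb T$, and $\mathbb Q$ is a probability measure equivalent to $\mathbb P$ such that for all $t\in\mathbb T$ $$S^2_t(1-\mu)X^+_t\le\mathbb E^{\mathbb Q}\Big[\sum_{t\le s\le T}X_s\chi_sS^2_s\,\Big|\,\mathcal F_t\Big]\le X^+_tS^2_t(1+\lambda),\qquad X^+_t:=\mathbb E^{\mathbb Q}\Big[\sum_{t\le s\le T}X_s\,\Big|\,\mathcal F_t\Big].$$ Conventions: $\inf\emptyset=+\infty$, $\sup\emptyset=-\infty$. *)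

(* Defs.v *)
From HB Require Import structures.
From mathcomp Require Import all_boot all_order all_algebra.
From mathcomp Require Import all_classical all_reals all_analysis.
From mathcomp Require Import measurable_realfun.

Set Implicit Arguments.
Unset Strict Implicit.
Unset Printing Implicit Defensive.

Import Order.TTheory GRing.Theory Num.Theory.
Import numFieldNormedType.Exports.

Local Open Scope classical_set_scope.
Local Open Scope ring_scope.

(* The time set {0, ..., T} is 'I_T.+1.  Random variables are functions, not
   classes modulo null sets, so every relation between them (including
   membership in a random or fixed set) is stated almost surely. *)
Definition process (T : nat) (Omega E : Type) := 'I_T.+1 -> Omega -> E.

Definition enorm (R : realType) (x : R * R) : R :=
  Num.sqrt (x.1 ^+ 2 + x.2 ^+ 2).

Section TransactionCosts.
Context (d : measure_display) (Omega : measurableType d) (R : realType).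
Context (P : probability Omega R) (T : nat).

Definition is_filtration (F : 'I_T.+1 -> set (set Omega)) : Prop :=
  [/\ forall t, sigma_algebra setT (F t),
      forall t, F t `<=` measurable &
      forall s t : 'I_T.+1, (s <= t)%N -> F s `<=` F t].

(* For a sigma-algebra G, the measurable sets of g_sigma_algebraType G are
   exactly the elements of G. *)
Definition measurable_wrt (dE : measure_display) (E : measurableType dE)
    (G : set (set Omega)) (f : Omega -> E) : Prop :=
  measurable_fun setT (f : g_sigma_algebraType G -> E).

Definition L0 (dE : measure_display) (E : measurableType dE)
    (G : set (set Omega)) (B : set E) : set (Omega -> E) :=
  [set f | measurable_wrt G f /\ {ae P, forall w, B (f w)}].

Definition L0_adapted (dE : measure_display) (E : measurableType dE)
    (F : 'I_T.+1 -> set (set Omega)) (B : set E) : set (process T Omega E) :=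
  [set xi | forall t, L0 (F t) B (xi t)].

(* Since processes are not identified modulo null sets, the limit v' has to be
   taken in L^0(R^2; F) rather than among arbitrary functions. *)
Definition closed_in_measure (F : 'I_T.+1 -> set (set Omega))
    (B : set (process T Omega (R * R)%type)) : Prop :=
  forall (v : nat -> process T Omega (R * R)%type)
         (v' : process T Omega (R * R)%type),
    (forall n, B (v n)) ->
    L0_adapted F setT v' ->
    (forall e : R, 0 < e ->
       P [set w | e < \sum_(t < T.+1) enorm (v n t w - v' t w)]
         @[n --> \oo] --> 0%E) ->
    B v'.

Section Portfolios.
Context (F : 'I_T.+1 -> set (set Omega)).
Context (K : 'I_T.+1 -> Omega -> set (R * R)%type).

Definition admissible : set (process T Omega (R * R)%type) :=
  [set xi : process T Omega (R * R)%type | L0_adapted F setT xi /\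
            forall t, {ae P, forall w, K t w (- xi t w)}].

Definition portfolio (x : R * R) (xi : process T Omega (R * R)%type) :
    process T Omega (R * R)%type :=
  fun t w => x + \sum_(s < T.+1 | (s <= t)%N) xi s w.

Definition attainable (x : R * R) : set (process T Omega (R * R)%type) :=
  [set portfolio x xi | xi in admissible].

Definition terminal_attainable (x : R * R) : set (Omega -> R * R) :=
  [set V ord_max | V in attainable x].

Definition superhedgeable (x : R * R) : set (process T Omega (R * R)%type) :=
  [set theta : process T Omega (R * R)%type | L0_adapted F setT theta /\
     exists2 V, attainable x V &
       forall t, {ae P, forall w, K t w (V t w - theta t w)}].

Definition hedging_set (theta : process T Omega (R * R)%type) :
    set (R * R)%type :=
  [set x | superhedgeable x theta].

End Portfolios.

(* Z is a version of the conditional expectation of Y given G under Q.  It is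
   applied below to a.s. nonnegative Y only, for which the defining identity
   makes sense (and determines Z a.s.) even when Y is not integrable; this is
   why Z takes extended real values. *)
Definition is_cond_expectation (Q : probability Omega R)
    (G : set (set Omega)) (Y : Omega -> R) (Z : Omega -> \bar R) : Prop :=
  measurable_wrt G Z /\
  forall A, G A -> (\int[Q]_(w in A) Z w = \int[Q]_(w in A) (Y w)%:E)%E.

Definition randomized_stopping_times (F : 'I_T.+1 -> set (set Omega)) :
    set (process T Omega R) :=
  [set X : process T Omega R | L0_adapted F [set r : R | 0 <= r] X /\
           {ae P, forall w, \sum_(t < T.+1) X t w = 1}].

Definition bid_ask_cone (mu lambda : R) (S2 : process T Omega R) :
    'I_T.+1 -> Omega -> set (R * R)%type :=
  fun t w => [set x |
    0 <= x.1 + S2 t w * ((1 - mu) * x.2 * (0 <= x.2)%R%:R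
                         + (1 + lambda) * x.2 * (x.2 < 0)%R%:R)].

(* P(X; K, P) depends on K only through mu, lambda and S2.  The inequalities are
   required for some versions Y, Xp of the conditional expectations, hence hold
   for all of them; Xp is X^+_t. *)
Definition price_systems (F : 'I_T.+1 -> set (set Omega)) (mu lambda : R)
    (S2 : process T Omega R) (X : process T Omega R) :
    set (process T Omega R * probability Omega R)%type :=
  [set cQ : process T Omega R * probability Omega R |
    let: (chi, Q) := cQ in
    [/\ L0_adapted F [set r : R | 1 - mu <= r <= 1 + lambda] chi,
        Q `<< P, P `<< Q &
        forall t : 'I_T.+1, exists Y Xp : Omega -> \bar R,
          [/\ is_cond_expectation Q (F t)
                (fun w => \sum_(s < T.+1 | (t <= s)%N) X s w * chi s w * S2 s w)
                Y,
              is_cond_expectation Q (F t)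
                (fun w => \sum_(s < T.+1 | (t <= s)%N) X s w) Xp &
              {ae P, forall w,
                ((S2 t w * (1 - mu))%:E * Xp w <= Y w)%E /\
                (Y w <= Xp w * (S2 t w * (1 + lambda))%:E)%E}]]].

End TransactionCosts.

(* Main.v *)
(* A dual process (Z1, Z2) is a pair of nonnegative adapted processes such that
   the conditional expectations of the sums of Z2_s over s >= t, as well as Z2_t
   itself, lie between (1 - mu) S_t and (1 + lambda) S_t times the corresponding
   quantities for Z1.  With Z1_T > 0 and E[sum Z1] = 1, let
   N_t = E[Z1_t + ... + Z1_T | F_t]; the multiplicative decomposition
   N_t = D_t X+_t with a martingale D and a predictable X+ decreasing from 1 gives
   dQ = D_T dP, X_t = Z1_t / D_t and chi_t = Z2_t / (Z1_t S_t), and then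
   E_Q[sum X (theta1 + chi theta2 S)] = E[sum (Z1 theta1 + Z2 theta2)].

   If theta cannot be hedged from (x, 0), then q = theta - (x, 0) is outside the
   closed cone A^s.  Weighting by m = 1 + |theta1| + |theta2| makes q bounded, hence
   square integrable, and its L2 projection on the cone yields a dual process with
   E[sum (Z1 q1 + Z2 q2)] > 0.  Adding a small multiple of a dual process with
   Z1_T > 0, obtained from the absence of arbitrage by exhaustion, keeps this sign;
   normalizing gives a pair (chi, Q) with value at least x.

   Conversely, summation by parts turns the stopped value of a hedging portfolio
   into x + sum_t (xi1_t Y1_t + xi2_t Y2_t), with Y1_t the sum of X_s and Y2_t the
   sum of X_s chi_s S_s over s >= t; each term has nonpositive conditional
   expectation, and the lower bound on theta controls the integrability. *)

Require Import Defs.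
From HB Require Import structures.
From mathcomp Require Import all_boot all_order all_algebra.
From mathcomp Require Import all_classical all_reals all_analysis.
From mathcomp Require Import measurable_realfun.
From mathcomp Require Import ring lra.

Set Implicit Arguments.
Unset Strict Implicit.
Unset Printing Implicit Defensive.

Import Order.TTheory GRing.Theory Num.Theory.
Import numFieldNormedType.Exports.

Local Open Scope classical_set_scope.
Local Open Scope ring_scope.

(** * Conditional expectations *)

(** Two obstacles shape the proof. Positivity holds only almost surely, while an integral without
    integrability is safe only for a nonnegative integrand. Hence processes are replaced by
    everywhere nonnegative versions [Num.max _ 0], and a conditional inequality at time t is stated
    as a family of integral inequalities over the sets of F_t, later extended to nonnegative
    F_t-measurable weights.

    Moreover neither S2, nor theta, nor the strategies are integrable. Test strategies are therefore
    scaled by 1 / (1 + S_t) and the factor is removed afterwards; the weight m also forces Z1 theta1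
    and Z2 theta2 to be integrable; strategies are localized to sets on which they are bounded.

    Dual processes are tested in two ways: a position held until T yields the bid-ask inequality for
    the tail sums, a position consumed at once yields the one for Z2_t against Z1_t, which places
    chi in [1 - mu, 1 + lambda]. Strict positivity of Z1_T makes N and X+ positive, so that the
    density D_T is positive and Q is equivalent to P. Closedness in measure enters through a.s.
    convergent sequences, so the minimizing sequence is chosen to converge fast. *)

Section SubSigmaAlgebra.
Context (d : measure_display) (Omega : measurableType d) (R : realType).
Variable G : set (set Omega).
Hypothesis sG : sigma_algebra setT G.
Hypothesis GM : G `<=` measurable.

Lemma measurable_sigma_subalgebra (A : set Omega) :
  G A -> measurable (A : set (g_sigma_algebraType G)).
Proof. exact: sub_sigma_algebra. Qed.

Lemma measurable_wrt_preimage (dE : measure_display) (E : measurableType dE)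
    (f : Omega -> E) (B : set E) :
  measurable_wrt G f -> measurable B -> G (f @^-1` B).
Proof.
move=> mf mB; rewrite -(measurable_g_measurableTypeE sG) -[X in measurable X]setTI.
exact: mf.
Qed.

Lemma measurable_wrtW (dE : measure_display) (E : measurableType dE)
    (f : Omega -> E) :
  measurable_wrt G f -> measurable_fun setT f.
Proof.
by move=> mf _ B mB; rewrite setTI; exact/GM/measurable_wrt_preimage.
Qed.

Import HBNNSimple.

(** This replaces taking out an F_t-measurable factor from a conditional expectation. On the level
    sets of a simple approximation of [g], which belong to [G], the weight is constant; monotone
    convergence does the rest. Two measures are allowed because integrals under Q are later compared
    with integrals under P. *)
Lemma ge0_le_integral_weight (m1 m2 : {measure set Omega -> \bar R})
    (f h : Omega -> \bar R) (D : set Omega) (g : Omega -> \bar R) :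
  measurable_fun setT f -> measurable_fun setT h ->
  (forall w, 0 <= f w)%E -> (forall w, 0 <= h w)%E ->
  (forall A, G A -> \int[m1]_(w in A) f w <= \int[m2]_(w in A) h w)%E ->
  G D -> measurable_wrt G g -> (forall w, 0 <= g w)%E ->
  (\int[m1]_(w in D) (g w * f w) <= \int[m2]_(w in D) (g w * h w))%E.
Proof.
move=> mf mh f0 h0 fh GD mg g0.
have GI A B : G A -> G B -> G (A `&` B).
  by rewrite -(measurable_g_measurableTypeE sG); exact: measurableI.
have mD := GM GD.
pose s := nnsfun_approx (D:=setT) measurableT mg.
have sG' n : measurable_wrt G (s n : Omega -> R) by exact: measurable_funP.
have mst n : measurable_fun setT (s n : Omega -> R) by exact: measurable_wrtW.
have sGP n y : G (s n @^-1` [set y]).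
  by apply: measurable_wrt_preimage (sG' n) _; exact: measurable_set1.
have ind0 n y w : 0 <= y * \1_(s n @^-1` [set y]) w.
  rewrite indicE; have [|_] := boolP (w \in _); last by rewrite mulr0.
  by rewrite inE /= => <-; rewrite mulr1.
have key n : (\int[m1]_(w in D) ((s n w)%:E * f w)
              <= \int[m2]_(w in D) ((s n w)%:E * h w))%E.
  have E (m : {measure set Omega -> \bar R}) (k : Omega -> \bar R) :
     measurable_fun setT k -> (forall w, 0 <= k w)%E ->
     (\int[m]_(w in D) ((s n w)%:E * k w) = \sum_(y \in range (s n))
       (y%:E * \int[m]_(w in D `&` (s n @^-1` [set y])) k w))%E.
    move=> mk k0.
    transitivity (\int[m]_(w in D) (\sum_(y \in range (s n))
        (fun w => (y * \1_(s n @^-1` [set y]) w)%:E * k w) w))%E.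
      apply: eq_integral => w _.
      rewrite (fimfunE (s n) w) fsbig_finite//= -sumEFin ge0_sume_distrl.
        by rewrite fsbig_finite.
      by move=> y _; rewrite lee_fin.
    rewrite ge0_integral_fsum//.
    - apply: eq_fsbigr => y yr.
      have y0 : (0 <= y)%R by move: yr; rewrite inE => -[v _ <-].
      have my : measurable (s n @^-1` [set y] : set Omega).
        by exact: GM.
      transitivity (\int[m]_(w in D) (y%:E * (k \_ (s n @^-1` [set y])) w))%E.
        apply: eq_integral => w _; rewrite patchE indicE.
        by case: ifP => _ /=; rewrite ?mulr1 ?mulr0 ?mule0 ?mul0e.
      rewrite ge0_integralZl//.
      - by rewrite -integral_mkcondr.
      - apply: measurable_funTS; apply: (iffLR (measurable_restrictT _ my)).
        exact: measurable_funTS.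
      - by move=> w _; rewrite patchE; case: ifP.
    - move=> y; apply: emeasurable_funM; last exact: measurable_funTS.
      apply/measurable_EFinP/measurable_funTS/measurable_funM => //.
      by apply: measurable_indic; exact: GM.
    - by move=> y w _; rewrite mule_ge0// lee_fin.
  rewrite !E//; apply: lee_fsum => // y yr.
  have y0 : (0 <= y)%R by move: yr => [v _ <-].
  apply: lee_wpmul2l; rewrite ?lee_fin//; by apply: fh; exact: GI.
have C (m : {measure set Omega -> \bar R}) (k : Omega -> \bar R) :
     measurable_fun setT k -> (forall w, 0 <= k w)%E ->
   (\int[m]_(w in D) ((s n w)%:E * k w) @[n --> \oo] -->
    \int[m]_(w in D) (g w * k w))%E.
  move=> mk k0.
  have -> : (\int[m]_(w in D) (g w * k w) =
     \int[m]_(w in D) limn (fun n => (s n w)%:E * k w))%E.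
    apply: eq_integral => w _; apply/esym/cvg_lim => //.
    have sg : ((s n w)%:E @[n --> \oo] --> g w)%E.
      exact: (cvg_nnsfun_approx measurableT mg).
    (* Both [g w] and [k w] may be infinite, so the cases in which the limit would be a product of 0
       and infinity are handled apart. Where [g w] vanishes, so do the approximations below it. *)
    have [->|k_neq0] := eqVneq (k w) 0%E.
      under eq_fun do rewrite mule0.
      by rewrite mule0; exact: cvg_cst.
    have [gw0|gw_neq0] := eqVneq (g w) 0%E.
      have s0 n : s n w = 0.
        apply/eqP; rewrite eq_le; apply/andP; split; last by [].
        rewrite -lee_fin; apply: (@le_trans _ _ (g w)); last by rewrite gw0.
        rewrite /s nnsfun_approxE; exact: le_approx.
      under eq_fun do rewrite s0 mul0e.
      by rewrite gw0 mul0e; exact: cvg_cst.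
    apply: cvgeM => //; last exact: cvg_cst.
    rewrite mule_defE (negbTE k_neq0) orbF; apply/nandP; left; exact: gw_neq0.
  apply: (@cvg_monotone_convergence _ _ _ m D mD
    (fun n w => ((s n w)%:E * k w)%E)).
  - move=> n; apply: emeasurable_funM; last exact: measurable_funTS.
    by apply/measurable_EFinP/measurable_funTS.
  - by move=> n w _; rewrite mule_ge0// lee_fin.
  - move=> w _ a b ab; apply: lee_wpmul2r => //; rewrite lee_fin.
    by move/lefP : (nd_nnsfun_approx measurableT mg ab) => /(_ w).
rewrite -(cvg_lim _ (C m1 f mf f0))// -(cvg_lim _ (C m2 h mh h0))//.
apply: lee_lim; [exact: cvgP (C m1 f mf f0)|exact: cvgP (C m2 h mh h0)|].
by apply: nearW => n; exact: key.
Qed.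

Lemma ge0_eq_integral_weight (m1 m2 : {measure set Omega -> \bar R})
    (f h : Omega -> \bar R) (D : set Omega) (g : Omega -> \bar R) :
  measurable_fun setT f -> measurable_fun setT h ->
  (forall w, 0 <= f w)%E -> (forall w, 0 <= h w)%E ->
  (forall A, G A -> \int[m1]_(w in A) f w = \int[m2]_(w in A) h w)%E ->
  G D -> measurable_wrt G g -> (forall w, 0 <= g w)%E ->
  (\int[m1]_(w in D) (g w * f w) = \int[m2]_(w in D) (g w * h w))%E.
Proof.
move=> mf mh f0 h0 fh GD mg g0; apply/eqP; rewrite eq_le; apply/andP; split.
  by apply: ge0_le_integral_weight => // A GA; rewrite fh.
by apply: ge0_le_integral_weight => // A GA; rewrite fh.
Qed.

(** The identity is a measurable map from Omega to Omega equipped with [G]. Pushing forward along it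
    both P and the charge with density [f] gives an absolutely continuous charge on the smaller
    sigma-algebra, whose Radon-Nikodym derivative is [G]-measurable by construction. *)
Lemma cond_expectation_exists (P : probability Omega R) (f : Omega -> R) :
  P.-integrable setT (EFin \o f) ->
  exists Z : Omega -> R, [/\ measurable_wrt G Z, P.-integrable setT (EFin \o Z) &
    forall A, G A ->
      \int[P]_(w in A) (Z w)%:E = \int[P]_(w in A) (f w)%:E]%E.
Proof.
move=> intf.
pose T' : measurableType _ := g_sigma_algebraType G.
have mid : measurable_fun setT (id : Omega -> T').
  move=> _ B mB; rewrite setTI; apply: GM.
  have : (measurable : set (set (g_sigma_algebraType G))) B := mB.
  by rewrite (measurable_g_measurableTypeE sG).
pose mid' := isMeasurableFun.Build _ _ _ _ _ mid.
pose X : {mfun Omega >-> T'} := HB.pack (id : Omega -> T') mid'.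
pose Q : probability T' R := distribution P X.
pose nu1 : {charge set T' -> \bar R} := pushforward (induced_charge intf) X.
pose nu0 := nu1 mid.
have nuQ : nu0 `<< Q.
  apply: dominates_pushforward => //.
  apply/null_content_dominatesP => A mA PA; rewrite /induced_charge.
  apply: null_set_integral => //.
  by apply: measurable_funTS; exact: measurable_int intf.
pose Z := fun w => fine (Radon_Nikodym nu0 Q w).
have ZE : EFin \o Z = Radon_Nikodym nu0 Q.
  by apply/funext => w /=; rewrite fineK//; exact: Radon_Nikodym_fin_num.
have iZ : Q.-integrable setT (EFin \o Z).
  by rewrite ZE; exact: Radon_Nikodym_integrable.
have mZ : measurable_fun setT (EFin \o Z : T' -> \bar R) by exact: measurable_int iZ.
have iPZ : P.-integrable setT (EFin \o Z).
  apply/integrableP; split.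
    by apply: (@measurable_wrtW _ _ (EFin \o Z)).
  have /integrableP[_] := iZ.
  rewrite /Q /distribution ge0_integral_pushforward//.
  by apply: measurableT_comp => //; exact: measurable_funTS.
exists Z; split => //; first exact/measurable_EFinP.
move=> A GA.
have mA : measurable (A : set T') by exact: measurable_sigma_subalgebra.
have := Radon_Nikodym_integral nuQ mA.
rewrite -ZE /Q /distribution integral_pushforward//; last first.
  by apply: (integrableS measurableT) => //; exact: GM.
Qed.

End SubSigmaAlgebra.

Lemma density_probability (d : measure_display) (Omega : measurableType d)
    (R : realType) (P : probability Omega R) (D : Omega -> R) :
  measurable_fun setT D -> (forall w, 0 <= D w) ->
  (\int[P]_w (D w)%:E = 1)%E ->
  exists Q : probability Omega R,
    forall A, measurable A -> Q A = (\int[P]_(w in A) (D w)%:E)%E.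
Proof.
move=> mD D0 D1.
pose q A := (\int[P]_(w in A) (D w)%:E)%E.
have q0 : q set0 = 0%E by exact: integral_set0.
have q_ge0 A : (0 <= q A)%E by apply: integral_ge0 => w _; rewrite lee_fin.
have qS : semi_sigma_additive q.
  apply: semi_sigma_additive_nng_induced; first exact/measurable_EFinP.
  by move=> w; rewrite lee_fin.
pose q1 := isMeasure.Build _ _ _ q q0 q_ge0 qS.
pose m : {measure set Omega -> \bar R} := HB.pack q q1.
pose q2 := Measure_isProbability.Build _ _ _ m D1.
pose Q : probability Omega R := HB.pack q q1 q2.
by exists Q.
Qed.

(** * Projection in L2 onto a closed cone of families of random variables *)

Section RealIntegrals.
Context (d : measure_display) (Omega : measurableType d) (R : realType).
Variables (m : {measure set Omega -> \bar R}) (D : set Omega).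
Hypothesis mD : measurable D.
Implicit Types f g : Omega -> R.

Lemma ge0_integralDr f g :
  measurable_fun setT f -> measurable_fun setT g ->
  (forall w, 0 <= f w) -> (forall w, 0 <= g w) ->
  (\int[m]_(w in D) (f w + g w)%:E =
   \int[m]_(w in D) (f w)%:E + \int[m]_(w in D) (g w)%:E)%E.
Proof.
move=> mf mg f0 g0; under eq_integral do rewrite EFinD.
by rewrite ge0_integralD//; first [exact/measurable_EFinP/measurable_funTS
  | by move=> w _; rewrite lee_fin].
Qed.

Lemma ge0_integralZlr c f : 0 <= c -> measurable_fun setT f ->
  (forall w, 0 <= f w) ->
  (\int[m]_(w in D) (c * f w)%:E = c%:E * \int[m]_(w in D) (f w)%:E)%E.
Proof.
move=> c0 mf f0; under eq_integral do rewrite EFinM.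
by rewrite ge0_integralZl//; first [exact/measurable_EFinP/measurable_funTS
  | by move=> w _; rewrite lee_fin].
Qed.

Lemma ge0_integral_sumr (I : finType) (Q : pred I) (f : I -> Omega -> R) :
  (forall i, measurable_fun setT (f i)) -> (forall i w, 0 <= f i w) ->
  (\int[m]_(w in D) (\sum_(i | Q i) f i w)%:E =
   \sum_(i | Q i) \int[m]_(w in D) (f i w)%:E)%E.
Proof.
move=> mf f0; rewrite -big_filter.
transitivity (\int[m]_(w in D)
    (\sum_(i <- [seq i <- index_enum I | Q i]) (f i w)%:E))%E.
  by apply: eq_integral => w _; rewrite -sumEFin big_filter.
by rewrite ge0_integral_sum//; first [move=> i; exact/measurable_EFinP/measurable_funTS
  | by move=> i w _; rewrite lee_fin].
Qed.

Lemma ae_ge0_le_integralr f g :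
  measurable_fun setT f -> measurable_fun setT g ->
  (forall w, 0 <= f w) -> (forall w, 0 <= g w) ->
  {ae m, forall w, D w -> f w <= g w} ->
  (\int[m]_(w in D) (f w)%:E <= \int[m]_(w in D) (g w)%:E)%E.
Proof.
move=> mf mg f0 g0 fg; apply: ae_ge0_le_integral => //;
  first [by move=> w _; rewrite lee_fin | exact/measurable_EFinP/measurable_funTS
        | by apply: filterS fg => w h Dw; rewrite lee_fin h].
Qed.

Lemma ge0_integrabler f : measurable_fun setT f -> (forall w, 0 <= f w) ->
  (\int[m]_(w in D) (f w)%:E < +oo)%E -> m.-integrable D (EFin \o f).
Proof.
move=> mf f0 fy; apply/integrableP; split.
  exact/measurable_EFinP/measurable_funTS.
by under eq_integral do rewrite /= ger0_norm//.
Qed.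

End RealIntegrals.

Lemma geometric_half_series_lty (R : realType) (c : R) :
  (\sum_(n <oo) (c * 2^-1 ^+ n)%:E < +oo)%E.
Proof.
have : (fun n => (\sum_(0 <= k < n) (c * 2^-1 ^+ k)%:E)%E) @ \oo -->
    (c * (1 - 2^-1)^-1 : R)%:E.
  under eq_fun do rewrite sumEFin.
  apply: cvg_EFin; first by apply: nearW.
  apply: cvg_geometric_series.
  by rewrite ger0_norm ?invr_ge0// invf_lt1// ltr1n.
by move/cvg_lim => ->//; rewrite ltry.
Qed.

(** The sum of the absolute increments has finite expectation, hence is finite a.s., and the
    telescoping series converges absolutely. The factor 5 is the one met in [L2_minimizer]. *)
Lemma ae_cvg_summable_increments (d : measure_display) (Omega : measurableType d)
    (R : realType) (P : probability Omega R) (y : nat -> Omega -> R) :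
  (forall n, measurable_fun setT (y n)) ->
  (forall n, \int[P]_w `|y n.+1 w - y n w|%:E <= (5 * 2^-1 ^+ n)%:E)%E ->
  {ae P, forall w, cvgn (fun n => y n w)}.
Proof.
move=> my yle.
pose a n w := (`|y n.+1 w - y n w|%:E)%E.
have ma n : measurable_fun setT (a n).
  apply/measurable_EFinP; apply: measurableT_comp => //.
  exact: measurable_funB.
have a0 n w : (0 <= a n w)%E by rewrite lee_fin.
have sfin : (\int[P]_w (\sum_(n <oo) a n w) < +oo)%E.
  rewrite integral_nneseries//.
  apply: (@le_lt_trans _ _ (\sum_(n <oo) (5 * 2^-1 ^+ n)%:E)%E).
    apply: lee_nneseries => [n _ _|n _]; last exact: yle.
    by apply: integral_ge0 => w _.
  exact: geometric_half_series_lty.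
have ms : measurable_fun setT (fun w => (\sum_(n <oo) a n w)%E).
  exact: ge0_emeasurable_sum.
have : P.-integrable setT (fun w => (\sum_(n <oo) a n w)%E).
  apply/integrableP; split => //.
  by under eq_integral do rewrite gee0_abs ?nneseries_ge0//.
move/integrable_ae => /(_ measurableT).
apply: filterS => w /(_ Logic.I) fin.
have cs : cvgn (series (telescope (fun n => y n w))).
  apply: normed_cvg.
  apply: nondecreasing_is_cvgn.
    by apply: nondecreasing_series => k _ _; exact: normr_ge0.
  exists (fine (\sum_(n <oo) a n w)%E) => _ [n _ <-].
  rewrite -lee_fin fineK//; apply: le_trans (nneseries_lim_ge n _) => //.
  by rewrite sumEFin.
rewrite (_ : (fun n => y n w) = (fun n => y 0 w + series (telescope (fun n => y n w)) n)).
  by apply: is_cvgD => //; exact: is_cvg_cst.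
by apply/funext => n; exact: eq_sum_telescope.
Qed.

Section L2Projection.
Context (d : measure_display) (Omega : measurableType d) (R : realType).
Variables (P : probability Omega R) (I : finType) (G : I -> set (set Omega)).
Hypothesis sG : forall i, sigma_algebra setT (G i).
Hypothesis GM : forall i, G i `<=` measurable.
Variable B : set (I -> Omega -> R).

Definition family_adapted (u : I -> Omega -> R) :=
  forall i, measurable_wrt (G i) (u i).

Definition dotp (u v : I -> Omega -> R) w := \sum_i u i w * v i w.

(** The squared L2 norm is kept extended real valued: elements of [B] need not be square
    integrable. *)
Let N u := (\int[P]_w (dotp u u w)%:E)%E.

Hypothesis B_adapted : forall u, B u -> family_adapted u.
Hypothesis B0 : B (fun _ _ => 0).
Hypothesis BD : forall u v, B u -> B v -> B (fun i w => u i w + v i w).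
Hypothesis BZ : forall c u, 0 <= c -> B u -> B (fun i w => c * u i w).
Hypothesis B_closed : forall (u_ : nat -> I -> Omega -> R) u,
  (forall n, B (u_ n)) -> family_adapted u ->
  {ae P, forall w, forall i, u_ n i w @[n --> \oo] --> u i w} -> B u.

Lemma measurable_family u i : family_adapted u -> measurable_fun setT (u i).
Proof. by move=> /(_ i); exact: measurable_wrtW. Qed.

Lemma measurable_dotp u v : family_adapted u -> family_adapted v ->
  measurable_fun setT (dotp u v).
Proof.
move=> mu mv; apply: measurable_sum => i.
by apply: measurable_funM; exact: measurable_family.
Qed.

Lemma dotp_ge0 u w : 0 <= dotp u u w.
Proof. by apply: sumr_ge0 => i _; exact: sqr_ge0. Qed.

Lemma sqr_le_dotp u i w : u i w ^+ 2 <= dotp u u w.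
Proof.
rewrite /dotp (bigD1 i)//= expr2 lerDl.
by apply: sumr_ge0 => j _; exact: sqr_ge0.
Qed.

Lemma family_adaptedB u v : family_adapted u -> family_adapted v ->
  family_adapted (fun i w => u i w - v i w).
Proof. by move=> mu mv i; apply: measurable_funB; [exact: mu|exact: mv]. Qed.

Lemma family_adaptedD u v : family_adapted u -> family_adapted v ->
  family_adapted (fun i w => u i w + v i w).
Proof. by move=> mu mv i; apply: measurable_funD; [exact: mu|exact: mv]. Qed.

Lemma family_adaptedZ c u : family_adapted u ->
  family_adapted (fun i w => c * u i w).
Proof. by move=> mu i; apply: measurable_funM => //; exact: mu. Qed.

Let sub (u v : I -> Omega -> R) i w := u i w - v i w.

Lemma L2_parallelogram q u v : family_adapted q -> family_adapted u ->
  family_adapted v ->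
  (N (sub u v) + 4%:E * N (sub q (fun i w => (2^-1 * (u i w + v i w))%R)) =
   2%:E * N (sub q u) + 2%:E * N (sub q v))%E.
Proof.
move=> mq mu mv.
have muv := family_adaptedB mu mv.
have mh : family_adapted (sub q (fun i w => 2^-1 * (u i w + v i w))).
  by apply: family_adaptedB => //; apply: family_adaptedZ; exact: family_adaptedD.
have mqu := family_adaptedB mq mu.
have mqv := family_adaptedB mq mv.
rewrite /N -!ge0_integralZlr//; try exact: measurable_dotp; try exact: dotp_ge0.
rewrite -!ge0_integralDr//; first last.
- by move=> w; rewrite mulr_ge0// dotp_ge0.
- by move=> w; rewrite dotp_ge0.
- by apply: measurable_funM => //; exact: measurable_dotp.
- by exact: measurable_dotp.
- by move=> w; rewrite mulr_ge0// dotp_ge0.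
- by move=> w; rewrite mulr_ge0// dotp_ge0.
- by apply: measurable_funM => //; exact: measurable_dotp.
- by apply: measurable_funM => //; exact: measurable_dotp.
apply: eq_integral => w _; congr EFin.
rewrite /dotp !mulr_sumr -!big_split /=; apply: eq_bigr => i _.
by rewrite /sub; field.
Qed.

(** The parallelogram identity, with the midpoint in [B], bounds the increments of a minimizing
    sequence. The sequence is fast enough to converge a.s., closedness puts the limit in [B], and
    Fatou's lemma shows that it attains the infimum. *)
Lemma L2_minimizer q : family_adapted q -> (N q < +oo)%E ->
  exists y, [/\ B y, (N (sub q y) < +oo)%E &
    forall v, B v -> (N (sub q y) <= N (sub q v))%E].
Proof.
move=> mq Nq.
have N_ge0 u : (0 <= N u)%E.
  by apply: integral_ge0 => w _; rewrite lee_fin dotp_ge0.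
pose dl := ereal_inf [set N (sub q v) | v in B].
have dl_ge0 : (0 <= dl)%E by apply: le_ereal_inf_tmp => _ [v _ <-].
have dl_le v : B v -> (dl <= N (sub q v))%E.
  by move=> Bv; apply: ereal_inf_lbound; exists v.
have dl_fin : dl \is a fin_num.
  rewrite ge0_fin_numE//; apply: le_lt_trans (dl_le _ B0) _.
  rewrite [X in N X](_ : _ = q)//.
  by apply/funext => i; apply/funext => w; rewrite /sub subr0.
(* With errors 4^-n the squared L2 norm of the n-th increment is at most 4 times 4^-n, which makes
   the L1 norms a convergent geometric series. *)
pose ep n : R := 4^-1 ^+ n.
have ep_gt0 n : 0 < ep n by rewrite exprn_gt0.
have ex n : exists v, B v /\ (N (sub q v) <= dl + (ep n)%:E)%E.
  have [_ [v Bv <-] lev] := lb_ereal_inf_adherent (ep_gt0 n) dl_fin.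
  by exists v; split => //; exact: ltW.
have [y yP] := choice ex.
have By n : B (y n) := (yP n).1.
have Ny n : (N (sub q (y n)) <= dl + (ep n)%:E)%E := (yP n).2.
have my n : family_adapted (y n) := B_adapted (By n).
have Ndiff n : (N (sub (y n.+1) (y n)) <= (4 * ep n)%:E)%E.
  have par := L2_parallelogram mq (my n.+1) (my n).
  have Bm : B (fun i w => 2^-1 * (y n.+1 i w + y n i w)).
    by apply: BZ => //; exact: BD.
  have fN k : N (sub q (y k)) \is a fin_num.
    rewrite ge0_fin_numE//; apply: le_lt_trans (Ny k) _.
    by rewrite -(fineK dl_fin) -EFinD ltry.
  have epS : ep n.+1 <= ep n.
    by rewrite /ep exprS ler_piMl ?exprn_ge0// invf_le1// ler1n.
  move: par (Ny n.+1) (Ny n) (dl_le _ Bm).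
  rewrite -(fineK dl_fin) -(fineK (fN n.+1)) -(fineK (fN n)).
  case: (N (sub (y n.+1) (y n))) => [c| |]; case: (N _) => [e| |] //.
  - by rewrite -!EFinM -!EFinD !lee_fin => -[] ? ? ? ?; lra.
  - by rewrite gt0_muley ?lte_fin.
  - by rewrite gt0_muley ?lte_fin.
have incr i n : (\int[P]_w `|y n.+1 i w - y n i w|%:E <= (5 * 2^-1 ^+ n)%:E)%E.
  (* From L2 to L1 through |r| <= 2^-n + 2^n r^2: the integral of the right side is at most 2^-n +
     2^n (4 4^-n) = 5 2^-n. *)
  pose h w := 2^-1 ^+ n + 2 ^+ n * dotp (sub (y n.+1) (y n)) (sub (y n.+1) (y n)) w.
  have ms := family_adaptedB (my n.+1) (my n).
  apply: (@le_trans _ _ (\int[P]_w (h w)%:E)%E).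
    apply: ge0_le_integral => //.
    - apply/measurable_EFinP; apply: measurableT_comp => //.
      exact: measurable_family ms.
    - apply/measurable_EFinP; apply: measurable_funD => //.
      by apply: measurable_funM => //; exact: measurable_dotp.
    - move=> w _; rewrite lee_fin /h.
      have := sqr_le_dotp (sub (y n.+1) (y n)) i w.
      rewrite -(real_normK (num_real _)) /sub; move: (dotp _ _ _) => D.
      move: (normr_ge0 (y n.+1 i w - y n i w)); move: `|_| => x x0 xD.
      have t0 : 0 < (2 ^+ n : R) by rewrite exprn_gt0.
      rewrite exprVn; apply: (@le_trans _ _ ((2 ^+ n)^-1 + 2 ^+ n * x ^+ 2)).
        rewrite -subr_ge0 (_ : _ - _ = (2 ^+ n) * ((x - (2 ^+ n)^-1 / 2) ^+ 2 + 3 / 4 * (2 ^+ n)^-1 ^+ 2)).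
          rewrite mulr_ge0 ?(ltW t0)// addr_ge0 ?sqr_ge0// mulr_ge0// ?sqr_ge0//.
        by field; rewrite gt_eqF.
      by rewrite lerD2l ler_pM2l.
  rewrite ge0_integralDr//; first last.
  - by move=> w; rewrite mulr_ge0 ?exprn_ge0// dotp_ge0.
  - by apply: measurable_funM => //; exact: measurable_dotp.
  rewrite ge0_integralZlr ?exprn_ge0//; first last.
  - exact: dotp_ge0.
  - exact: measurable_dotp.
  rewrite integral_cst// [X in (_ * X + _)%E](_ : _ = 1%E) ?mule1; last exact: probability_setT.
  apply: (@le_trans _ _ ((2^-1 ^+ n)%:E + (2 ^+ n)%:E * (4 * ep n)%:E)%E).
    by rewrite leeD2l// lee_wpmul2l// ?lee_fin ?exprn_ge0//; exact: Ndiff.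
  rewrite -EFinM -EFinD lee_fin /ep !exprVn.
  have -> : (4 : R) ^+ n = 2 ^+ n * 2 ^+ n by rewrite -exprMn -natrM.
  rewrite le_eqVlt; apply/orP; left; apply/eqP; field => //.
(* An upper limit is defined and [G i]-measurable everywhere, and it agrees with the limit wherever
   the sequence converges. *)
pose z i w := fine (limn_esup (fun n => (y n i w)%:E)).
have mz : family_adapted z.
  move=> i; apply: measurableT_comp => //; apply: measurable_fun_limn_esup => n.
  by apply/measurable_EFinP; exact: my.
have yz : {ae P, forall w, forall i, y n i w @[n --> \oo] --> z i w}.
  apply: filter_forall => i.
  have := ae_cvg_summable_increments (fun n => measurable_family i (my n)) (incr i).
  apply: filterS => w /cvg_ex[/= l yl].
  have yl' : (y n i w)%:E @[n --> \oo] --> l%:E by exact: cvg_EFin (nearW _ _) yl.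
  by rewrite /z (cvg_limn_einf_sup yl').2.
have Bz : B z by exact: B_closed yz.
have Nz : (N (sub q z) <= dl)%E.
  pose f n w := (dotp (sub q (y n)) (sub q (y n)) w)%:E.
  have mf n : measurable_fun setT (f n).
    by apply/measurable_EFinP/measurable_dotp; exact: family_adaptedB.
  have f0 n w : (0 <= f n w)%E by rewrite lee_fin dotp_ge0.
  have dlE : limn_einf (fun n => \int[P]_w f n w)%E = dl.
    apply: (cvg_limn_einf_sup _).1.
    apply: (@squeeze_cvge _ _ _ _ (cst dl) _ (fun n => dl + (ep n)%:E)%E).
    - by apply: nearW => n; rewrite Ny andbT dl_le.
    - exact: cvg_cst.
    - rewrite -[X in _ --> X]adde0; apply: cvgeD; [by rewrite fin_num_adde_defl|exact: cvg_cst|].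
      apply: cvg_EFin; first by apply: nearW.
      rewrite /ep; apply: cvg_expr.
      by rewrite ger0_norm ?invr_ge0// invf_lt1// ltr1n.
  have mz' : family_adapted (sub q z) by exact: family_adaptedB.
  have einfE : (fun w => limn_einf (f^~ w)) =
      (fun w => - limn_esup (fun n => - f n w))%E.
    by apply/funext => w; rewrite -limn_einfN; congr limn_einf;
       apply/funext => n; rewrite -[LHS]oppeK.
  rewrite -dlE; apply: le_trans (fatou P measurableT mf _) => //.
  apply: ae_ge0_le_integral => //.
  - by move=> w _; rewrite lee_fin dotp_ge0.
  - exact/measurable_EFinP/measurable_dotp.
  - move=> w _; rewrite limn_einf_lim; apply: lime_ge; first exact: is_cvg_einfs.
    by apply: nearW => n; apply: le_ereal_inf_tmp => _ [k _ <-]; exact: f0.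
  - rewrite einfE; apply: measurableT_comp => //.
    apply: measurable_fun_limn_esup => n; exact: measurableT_comp.
  - apply: filterS yz => w yz _.
    have : f n w @[n --> \oo] --> (dotp (sub q z) (sub q z) w)%:E.
      apply: cvg_EFin; first by apply: nearW.
      rewrite /dotp; apply: cvg_big => [|i _]; first exact: add_continuous.
      by apply: cvgM; (apply: cvgB; [exact: cvg_cst|exact: yz]).
    by move/cvg_limn_einf_sup => [-> _].
exists z; split => //; first by rewrite (le_lt_trans Nz)// -ge0_fin_numE.
by move=> v Bv; exact: le_trans (dl_le _ Bv).
Qed.

Lemma integrable_dotp u v : family_adapted u -> family_adapted v ->
  (N u < +oo)%E -> (N v < +oo)%E -> P.-integrable setT (EFin \o dotp u v).
Proof.
move=> mu mv Nu Nv.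
have iuv : P.-integrable setT (EFin \o (fun w => dotp u u w + dotp v v w)).
  apply: ge0_integrabler => //.
  - by apply: measurable_funD; exact: measurable_dotp.
  - by move=> w; rewrite addr_ge0// dotp_ge0.
  - rewrite ge0_integralDr//; first last.
    + exact: dotp_ge0.
    + exact: dotp_ge0.
    + exact: measurable_dotp.
    + exact: measurable_dotp.
    by rewrite lte_add_pinfty.
apply: le_integrable iuv => //.
  exact/measurable_EFinP/measurable_dotp.
move=> w _; rewrite lee_fin [leRHS]ger0_norm ?addr_ge0 ?dotp_ge0//.
apply: le_trans (ler_norm_sum _ _ _) _.
rewrite /dotp -big_split /=; apply: ler_sum => i _.
rewrite ler_norml; apply/andP; split; rewrite -subr_ge0.
  rewrite (_ : _ - _ = 2^-1 * ((u i w + v i w) ^+ 2 + u i w ^+ 2 + v i w ^+ 2)).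
    by rewrite mulr_ge0// !addr_ge0// sqr_ge0.
  by field.
rewrite (_ : _ - _ = 2^-1 * ((u i w - v i w) ^+ 2 + u i w ^+ 2 + v i w ^+ 2)).
  by rewrite mulr_ge0// !addr_ge0// sqr_ge0.
by field.
Qed.

Lemma L2_norm_expand u v (t : R) : family_adapted u -> family_adapted v ->
  (N u < +oo)%E -> (N v < +oo)%E ->
  N (fun i w => u i w + t * v i w) =
  (fine (N u) + 2 * t * fine (\int[P]_w (dotp u v w)%:E)%E
   + t ^+ 2 * fine (N v))%:E.
Proof.
move=> mu mv Nu Nv.
have iuu := integrable_dotp mu mu Nu Nu.
have iuv := integrable_dotp mu mv Nu Nv.
have ivv := integrable_dotp mv mv Nv Nv.
transitivity (\int[P]_w ((dotp u u w)%:E + ((2 * t)%:E * (dotp u v w)%:E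
   + (t ^+ 2)%:E * (dotp v v w)%:E)))%E.
  apply: eq_integral => w _; rewrite -!EFinM -!EFinD; congr EFin.
  rewrite /dotp !mulr_sumr -!big_split /=; apply: eq_bigr => i _; ring.
rewrite integralD//; last first.
  by apply: integrableD => //; exact: integrableZl.
rewrite integralD//; [|exact: integrableZl|exact: integrableZl].
rewrite !integralZl// -(fineK (integrable_fin_num measurableT iuu)).
rewrite -(fineK (integrable_fin_num measurableT iuv)).
rewrite -(fineK (integrable_fin_num measurableT ivv)).
by rewrite -!EFinM -!EFinD addrA.
Qed.

(** Let y be the point of [B] nearest to q and Z = q - y. Moving to y + t v shows that Z pairs
    nonpositively with v; moving to (1 - t) y shows that it pairs nonnegatively with y. Hence the
    pairing of Z with q is at least the squared norm of Z, which is positive because q is outside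
    [B]. *)
Theorem L2_separation q : family_adapted q -> (N q < +oo)%E -> ~ B q ->
  exists Z, [/\ family_adapted Z, (N Z < +oo)%E,
    forall v, B v -> (N v < +oo)%E -> (\int[P]_w (dotp Z v w)%:E <= 0)%E &
    (0 < \int[P]_w (dotp Z q w)%:E)%E].
Proof.
move=> mq Nq nBq; have [y [By Nqy ymin]] := L2_minimizer mq Nq.
have my := B_adapted By.
pose Z := sub q y.
have mZ : family_adapted Z by exact: family_adaptedB.
have N_ge0 u : (0 <= N u)%E.
  by apply: integral_ge0 => w _; rewrite lee_fin dotp_ge0.
(* First-order condition at a minimum: a negative linear term would dominate the quadratic one for
   small t. *)
have small (a b : R) : (forall t, 0 < t <= 1 -> 0 <= 2 * t * a + t ^+ 2 * b) ->
    0 <= b -> 0 <= a.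
  move=> h b0; rewrite leNgt; apply/negP => a0.
  (* For this t one has t b <= - a, so 2 a + t b <= a < 0. *)
  pose t := - a / (b - a).
  have ba : 0 < b - a by lra.
  have t01 : 0 < t <= 1.
    by rewrite /t divr_gt0//= ?oppr_gt0// ler_pdivrMr// mul1r; lra.
  have /andP[t0 _] := t01.
  have := h t t01.
  rewrite (_ : _ + _ = t * (2 * a + t * b)); last by ring.
  rewrite pmulr_rge0//.
  have : t * b <= - a.
    rewrite /t mulrAC ler_pdivrMr//; nra.
  lra.
have step v : B v -> (N v < +oo)%E -> (\int[P]_w (dotp Z v w)%:E <= 0)%E.
  move=> Bv Nv; have mv := B_adapted Bv.
  have iZv := integrable_dotp mZ mv Nqy Nv.
  rewrite -(fineK (integrable_fin_num measurableT iZv)) lee_fin -oppr_ge0.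
  apply: (small _ (fine (N v))); last exact: fine_ge0.
  move=> t /andP[t0 t1].
  have Bt : B (fun i w => y i w + t * v i w).
    by apply: BD => //; apply: BZ => //; exact: ltW.
  have := ymin _ Bt.
  rewrite [N (sub q (fun i w => y i w + t * v i w))](_ : _ = N (fun i w => Z i w + (- t) * v i w)).
    rewrite L2_norm_expand// -[N _ in X in (X <= _)%E -> _]fineK ?ge0_fin_numE// lee_fin.
    rewrite -/Z; lra.
  congr N; apply/funext => i; apply/funext => w; rewrite /Z /sub; ring.
have Ny : (N y < +oo)%E.
  have -> : y = (fun i w => q i w + (-1) * Z i w).
    by apply/funext => i; apply/funext => w; rewrite /Z /sub; ring.
  by rewrite L2_norm_expand// ltry.
have iZy := integrable_dotp mZ my Nqy Ny.
have stepy : (0 <= \int[P]_w (dotp Z y w)%:E)%E.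
  rewrite -(fineK (integrable_fin_num measurableT iZy)) lee_fin.
  apply: (small _ (fine (N y))); last exact: fine_ge0.
  move=> t /andP[t0 t1].
  have Bt : B (fun i w => (1 - t) * y i w) by apply: BZ => //; lra.
  have := ymin _ Bt.
  rewrite [N (sub q (fun i w => (1 - t) * y i w))](_ : _ = N (fun i w => Z i w + t * y i w)).
    rewrite L2_norm_expand// -[N _ in X in (X <= _)%E -> _]fineK ?ge0_fin_numE// lee_fin.
    rewrite -/Z; lra.
  congr N; apply/funext => i; apply/funext => w; rewrite /Z /sub; ring.
have NZ : (0 < N Z)%E.
  rewrite lt0e N_ge0 andbT; apply/eqP => NZ0; apply: nBq.
  (* If Z has norm zero then q = y a.s., and the constant sequence y converges a.s. to q. *)
  apply: (B_closed (u_ := fun _ => y)) => //.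
  have : ae_eq P setT (EFin \o dotp Z Z) (cst 0%E).
    apply/(ae_eq_integral_abs P measurableT).
      exact/measurable_EFinP/measurable_dotp.
    rewrite -NZ0; apply: eq_integral => w _.
    by rewrite /= ger0_norm// dotp_ge0.
  apply: filterS => w /(_ Logic.I) [ZZ0] i.
  have -> : q i w = y i w; last exact: cvg_cst.
  have := sqr_le_dotp Z i w; rewrite ZZ0 => Zi.
  have /eqP : Z i w ^+ 2 == 0 by rewrite eq_le Zi sqr_ge0.
  by move/eqP; rewrite sqrf_eq0 /Z /sub subr_eq0 => /eqP.
exists Z; split => //.
have -> : (\int[P]_w (dotp Z q w)%:E = N Z + \int[P]_w (dotp Z y w)%:E)%E.
  rewrite -integralD//; last exact: integrable_dotp.
  apply: eq_integral => w _; rewrite -EFinD; congr EFin.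
  by rewrite /dotp -big_split /=; apply: eq_bigr => i _; rewrite /Z /sub; ring.
by rewrite lte_paddr.
Qed.

End L2Projection.

(** * Weak duality *)

Lemma dominated_ae (d : measure_display) (Omega : measurableType d)
    (R : realType) (Q P : {measure set Omega -> \bar R}) (A : set Omega) :
  Q `<< P -> {ae P, forall w, A w} -> {ae Q, forall w, A w}.
Proof.
move=> /null_content_dominatesP QP [N [mN PN sN]].
by exists N; split => //; exact: QP.
Qed.

Section WeakDuality.
Context (d : measure_display) (Omega : measurableType d) (R : realType).
Variables (Q : probability Omega R) (T : nat).
Variable F : 'I_T.+1 -> set (set Omega).
Hypothesis Ffiltration : is_filtration F.
Variables (a b S Y1 Y2 : process T Omega R) (mu lambda x : R).
Variables (G : Omega -> R).

Let sF t : sigma_algebra setT (F t). Proof. by case: Ffiltration. Qed.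
Let FM t : F t `<=` measurable. Proof. by case: Ffiltration. Qed.
Let FF (s t : 'I_T.+1) : (s <= t)%N -> F s `<=` F t.
Proof. by case: Ffiltration => _ _ h /h. Qed.

Hypothesis ma : forall t, measurable_wrt (F t) (a t).
Hypothesis mb : forall t, measurable_wrt (F t) (b t).
Hypothesis mS : forall t, measurable_wrt (F t) (S t).
Hypothesis S_ge0 : forall t w, 0 <= S t w.
Hypothesis mY1 : forall t, measurable_fun setT (Y1 t).
Hypothesis mY2 : forall t, measurable_fun setT (Y2 t).
Hypothesis Y1_ge0 : forall t w, 0 <= Y1 t w.
Hypothesis Y2_ge0 : forall t w, 0 <= Y2 t w.
Hypothesis mu_le1 : mu <= 1.
Hypothesis lambda_ge0 : 0 <= 1 + lambda.
Hypothesis Y1_fin : forall t, (\int[Q]_w (Y1 t w)%:E < +oo)%E.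
Hypothesis Y2_fin : forall t, (\int[Q]_w (Y2 t w)%:E < +oo)%E.
Hypothesis bid : forall t A, F t A ->
  (\int[Q]_(w in A) (S t w * (1 - mu) * Y1 t w)%:E
    <= \int[Q]_(w in A) (Y2 t w)%:E)%E.
Hypothesis ask : forall t A, F t A ->
  (\int[Q]_(w in A) (Y2 t w)%:E
    <= \int[Q]_(w in A) (S t w * (1 + lambda) * Y1 t w)%:E)%E.
Hypothesis self_financing : forall t, {ae Q, forall w,
  a t w + S t w * (1 - mu) * b t w <= 0 /\
  a t w + S t w * (1 + lambda) * b t w <= 0}.
(* G makes wealth bounded from below by an integrable variable. *)
Hypothesis mG : measurable_fun setT G.
Hypothesis G_ge0 : forall w, 0 <= G w.

Let pos (f : Omega -> R) w := Num.max (f w) 0.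
Let neg (f : Omega -> R) w := Num.max (- f w) 0.

Let mpos (f : Omega -> R) (H : set (set Omega)) : measurable_wrt H f ->
  measurable_wrt H (pos f).
Proof. by move=> mf; exact: measurable_maxr. Qed.

Let mneg (f : Omega -> R) (H : set (set Omega)) : measurable_wrt H f ->
  measurable_wrt H (neg f).
Proof. by move=> mf; apply: measurable_maxr => //; exact: measurable_funN. Qed.

Let pos_ge0 f w : 0 <= pos f w. Proof. by rewrite le_max lexx orbT. Qed.
Let neg_ge0 f w : 0 <= neg f w. Proof. by rewrite le_max lexx orbT. Qed.
Let pos_neg f w : f w = pos f w - neg f w.
Proof. by rewrite /pos /neg; case: (leP (f w) 0) => ?; case: (leP (- f w) 0) => ?; lra. Qed.

(** The increment [a t * Y1 t + b t * Y2 t] is [cost t - gain t]; the two parts are never subtracted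
    under an integral. *)
Let cost t w := pos (a t) w * Y1 t w + pos (b t) w * Y2 t w.
Let gain t w := neg (a t) w * Y1 t w + neg (b t) w * Y2 t w.

Let mcost t : measurable_fun setT (cost t).
Proof.
by apply: measurable_funD; apply: measurable_funM => //;
   apply: (measurable_wrtW (sF t) (@FM t)); exact: mpos.
Qed.

Let mgain t : measurable_fun setT (gain t).
Proof.
by apply: measurable_funD; apply: measurable_funM => //;
   apply: (measurable_wrtW (sF t) (@FM t)); exact: mneg.
Qed.

Let cost_ge0 t w : 0 <= cost t w.
Proof. by rewrite addr_ge0// mulr_ge0. Qed.

Let gain_ge0 t w : 0 <= gain t w.
Proof. by rewrite addr_ge0// mulr_ge0. Qed.

Let weight t (D : set Omega) (f h g : Omega -> R) :
  F t D -> measurable_fun setT f -> measurable_fun setT h ->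
  (forall w, 0 <= f w) -> (forall w, 0 <= h w) ->
  (forall A, F t A -> \int[Q]_(w in A) (f w)%:E <= \int[Q]_(w in A) (h w)%:E)%E ->
  measurable_wrt (F t) g -> (forall w, 0 <= g w) ->
  (\int[Q]_(w in D) (g w * f w)%:E <= \int[Q]_(w in D) (g w * h w)%:E)%E.
Proof.
move=> FD mf mh f0 h0 fh mg g0.
under eq_integral do rewrite EFinM.
under [leRHS]eq_integral do rewrite EFinM.
apply: (ge0_le_integral_weight (sF t) (@FM t)) => //;
  first [exact/measurable_EFinP | by move=> w; rewrite lee_fin].
Qed.

(** Given F_t, [Y2 t] is worth at most (1 + lambda) S_t [Y1 t], used where stock is bought, and at
    least (1 - mu) S_t [Y1 t], used where it is sold. After both replacements the inequality is the
    self-financing condition multiplied by [Y1 t], and it holds pointwise a.s. *)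
Lemma expected_cost_le_gain t D : F t D ->
  (\int[Q]_(w in D) (cost t w)%:E <= \int[Q]_(w in D) (gain t w)%:E)%E.
Proof.
move=> FD; have mD := FM FD.
have W (f : Omega -> R) : measurable_wrt (F t) f -> measurable_fun setT f.
  exact: (measurable_wrtW (sF t) (@FM t)).
have mpa := W _ (mpos (@ma t)); have mna := W _ (mneg (@ma t)).
have mpb := W _ (mpos (@mb t)); have mnb := W _ (mneg (@mb t)).
have mSt := W _ (@mS t).
have mu0 : 0 <= 1 - mu by rewrite subr_ge0.
rewrite /cost /gain !ge0_integralDr//; first last.
- by move=> w; rewrite mulr_ge0.
- by move=> w; rewrite mulr_ge0.
- exact: measurable_funM.
- exact: measurable_funM.
- by move=> w; rewrite mulr_ge0.
- by move=> w; rewrite mulr_ge0.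
- exact: measurable_funM.
- exact: measurable_funM.
have m1 : measurable_fun setT (fun w => S t w * (1 - mu) * Y1 t w).
  by apply: measurable_funM => //; exact: measurable_funM.
have m2 : measurable_fun setT (fun w => S t w * (1 + lambda) * Y1 t w).
  by apply: measurable_funM => //; exact: measurable_funM.
have p1 w : 0 <= S t w * (1 - mu) * Y1 t w by rewrite !mulr_ge0.
have p2 w : 0 <= S t w * (1 + lambda) * Y1 t w by rewrite !mulr_ge0.
have h1 := weight FD m1 (@mY2 t) p1 (Y2_ge0 t) (@bid t) (mneg (@mb t)) (neg_ge0 (b t)).
have h2 := weight FD (@mY2 t) m2 (Y2_ge0 t) p2 (@ask t) (mpos (@mb t)) (pos_ge0 (b t)).
apply: le_trans (leeD2l _ h2) _; apply: le_trans _ (leeD2l _ h1).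
rewrite -!ge0_integralDr//; first last.
- by move=> w; rewrite mulr_ge0.
- by move=> w; rewrite mulr_ge0.
- exact: measurable_funM.
- exact: measurable_funM.
- by move=> w; rewrite mulr_ge0.
- by move=> w; rewrite mulr_ge0.
- exact: measurable_funM.
- exact: measurable_funM.
apply: ae_ge0_le_integralr => //.
- by apply: measurable_funD; exact: measurable_funM.
- by apply: measurable_funD; exact: measurable_funM.
- by move=> w; rewrite addr_ge0// mulr_ge0.
- by move=> w; rewrite addr_ge0// mulr_ge0.
apply: filterS (self_financing t) => w [sf1 sf2] _.
rewrite !mulrA -!mulrDl; apply: ler_wpM2r => //.
move: sf1 sf2; rewrite (pos_neg (a t) w).
have [b0|/ltW b0] := leP 0 (b t w).
  have -> : pos (b t) w = b t w by rewrite /pos max_l.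
  have -> : neg (b t) w = 0 by rewrite /neg max_r// oppr_le0.
  by move: (pos _ _) (neg _ _) => u v _ ?; lra.
have -> : pos (b t) w = 0 by rewrite /pos max_r.
have -> : neg (b t) w = - b t w by rewrite /neg max_l// oppr_ge0.
by move: (pos _ _) (neg _ _) => u v ? _; lra.
Qed.

Let W w := x + \sum_(t < T.+1) (a t w * Y1 t w + b t w * Y2 t w).
Let U w := Num.max (W w + G w) 0.
Hypothesis W_bounded_below : {ae Q, forall w, 0 <= W w + G w}.

(** The wealth accumulated strictly before k is [Wp k - Wm k]; the initial capital x is split into
    its positive and negative parts as well. *)
Let Wp (k : nat) w := Num.max x 0 + \sum_(s < T.+1 | (s < k)%N) cost s w.
Let Wm (k : nat) w := Num.max (- x) 0 + \sum_(s < T.+1 | (s < k)%N) gain s w.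

Let Wm_ge0 k w : 0 <= Wm k w.
Proof. by rewrite addr_ge0 ?le_max ?lexx ?orbT// sumr_ge0. Qed.

Let Wp_ge0 k w : 0 <= Wp k w.
Proof. by rewrite addr_ge0 ?le_max ?lexx ?orbT// sumr_ge0. Qed.

Let mW : measurable_fun setT W.
Proof.
apply: measurable_funD => //; apply: measurable_sum => t.
by apply: measurable_funD; apply: measurable_funM => //;
   apply: (measurable_wrtW (sF t) (@FM t)); [exact: ma|exact: mb].
Qed.

Let mU : measurable_fun setT U.
Proof. by apply: measurable_maxr => //; exact: measurable_funD. Qed.

Let mWp k : measurable_fun setT (Wp k).
Proof.
apply: measurable_funD => //; under eq_fun do rewrite -big_filter.
by apply: measurable_sum => t; exact: mcost.
Qed.

Let mWm k : measurable_fun setT (Wm k).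
Proof.
apply: measurable_funD => //; under eq_fun do rewrite -big_filter.
by apply: measurable_sum => t; exact: mgain.
Qed.

(** The induction starts at k = T + 1, after the last date, where no F_k exists and the inequality
    holds pointwise, hence on any measurable set. For k <= T, [inord k] is the date k. *)
Let observable (k : nat) A := if (k <= T)%N then F (inord k) A else measurable A.

Let big_ltS (t : 'I_T.+1) (f : 'I_T.+1 -> R) :
  \sum_(s < T.+1 | (s < t.+1)%N) f s = \sum_(s < T.+1 | (s < t)%N) f s + f t.
Proof.
rewrite (bigD1 t)//= addrC; congr (_ + _); apply: eq_bigl => s.
by rewrite ltnS [RHS]ltn_neqAle andbC.
Qed.

(* [a t] and [b t] are unbounded, so that [cost t] need not be integrable:
   moving negative parts to the other side keeps every integral meaningful, and
   the backward induction is run on the sets of F_t where both are bounded. *)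
Lemma supermartingale_bound n k A : (k + n = T.+1)%N -> observable k A ->
  (\int[Q]_(w in A) (U w + Wm k w)%:E <= \int[Q]_(w in A) (Wp k w + G w)%:E)%E.
Proof.
elim: n k A => [|n IH] k A kn okA.
  rewrite addn0 in kn; rewrite {k}kn /observable ltnn in okA *.
  apply: ae_ge0_le_integralr => //.
  - exact: measurable_funD.
  - exact: measurable_funD.
  - by move=> w; rewrite addr_ge0// le_max lexx orbT.
  - by move=> w; rewrite addr_ge0.
  apply: filterS W_bounded_below => w Wge _.
  have lastE (f : 'I_T.+1 -> R) :
      \sum_(s < T.+1 | (s < T.+1)%N) f s = \sum_(s < T.+1) f s.
    by apply: eq_bigl => s; rewrite ltn_ord.
  rewrite /U max_l// /W /Wp /Wm !lastE.
  have -> : \sum_(t < T.+1) (a t w * Y1 t w + b t w * Y2 t w) =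
      \sum_(t < T.+1) cost t w - \sum_(t < T.+1) gain t w.
    rewrite -sumrB; apply: eq_bigr => t _.
    by rewrite {1}(pos_neg (a t) w) {1}(pos_neg (b t) w) /cost /gain; ring.
  have : x = Num.max x 0 - Num.max (- x) 0 by exact: (pos_neg (fun=> x) w).
  by move: (Num.max x 0) (Num.max (- x) 0) => u v ->; lra.
have kT : (k <= T)%N by rewrite -ltnS -kn addnS ltnS leq_addr.
move: okA; rewrite /observable kT.
set t : 'I_T.+1 := inord k => FA.
have tk : t = k :> nat by rewrite inordK.
pose B (m : nat) := [set w | `|a t w| <= m%:R] `&` [set w | `|b t w| <= m%:R].
have FI A1 A2 : F t A1 -> F t A2 -> F t (A1 `&` A2).
  by rewrite -(measurable_g_measurableTypeE (sF t)); exact: measurableI.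
have FB m : F t (B m).
  have h (f : Omega -> R) : measurable_wrt (F t) f -> F t [set w | `|f w| <= m%:R].
    move=> mf; have := @measurable_wrt_preimage _ _ _ (sF t) _ _ (fun w => `|f w|) `]-oo, m%:R]%classic.
    rewrite (_ : _ @^-1` _ = [set w | `|f w| <= m%:R]); last first.
      by apply/seteqP; split => w /=; rewrite in_itv.
    by apply => //; apply: measurableT_comp.
  by apply: FI; apply: h; [exact: ma|exact: mb].
have step m : (\int[Q]_(w in A `&` B m) (U w + Wm k w)%:E
    <= \int[Q]_(w in A `&` B m) (Wp k w + G w)%:E)%E.
  have FD : F t (A `&` B m) by exact: FI.
  have mD := FM FD.
  have okD : observable k.+1 (A `&` B m).
    rewrite /observable; case: ifP => // kT'.
    by apply: FF FD; rewrite tk inordK.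
  have := IH k.+1 (A `&` B m); rewrite addSnnS => /(_ kn okD).
  have -> : Wm k.+1 = (fun w => Wm k w + gain t w).
    by apply/funext => w; rewrite /Wm -tk big_ltS addrA.
  have -> : Wp k.+1 = (fun w => Wp k w + cost t w).
    by apply/funext => w; rewrite /Wp -tk big_ltS addrA.
  under eq_integral do rewrite addrA.
  under [in X in (_ <= X)%E]eq_integral do rewrite addrAC.
  rewrite ge0_integralDr//; first last.
  - by move=> w; rewrite addr_ge0// le_max lexx orbT.
  - exact: measurable_funD.
  rewrite [X in (_ <= X)%E -> _]ge0_integralDr//; first last.
  - by move=> w; rewrite addr_ge0.
  - exact: measurable_funD.
  move=> le1; have le2 := expected_cost_le_gain FD.
  (* On [B m] the gain is at most m (Y1_t + Y2_t), which is integrable. Its integral can thus be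
     cancelled from both sides. *)
  have gain_fin : (\int[Q]_(w in A `&` B m) (gain t w)%:E)%E \is a fin_num.
    rewrite ge0_fin_numE; last by apply: integral_ge0 => w _; rewrite lee_fin.
    apply: (@le_lt_trans _ _ (\int[Q]_(w in A `&` B m) (m%:R * (Y1 t w + Y2 t w))%:E)%E).
      apply: ae_ge0_le_integralr => //.
      - by apply: measurable_funM => //; apply: measurable_funD.
      - by move=> w; rewrite mulr_ge0// addr_ge0.
      apply: aeW => w [_ [/= am bm]]; rewrite mulrDr; apply: lerD; apply: ler_wpM2r => //.
      - by rewrite ge_max ler0n andbT (le_trans _ am)// -normrN ler_norm.
      - by rewrite ge_max ler0n andbT (le_trans _ bm)// -normrN ler_norm.
    apply: (@le_lt_trans _ _ (\int[Q]_w (m%:R * (Y1 t w + Y2 t w))%:E)%E).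
      apply: ge0_subset_integral => //.
      - apply/measurable_EFinP/measurable_funM => //; exact: measurable_funD.
      - by move=> w _; rewrite lee_fin mulr_ge0// addr_ge0.
    rewrite ge0_integralZlr//; last 2 first.
    - exact: measurable_funD.
    - by move=> w; rewrite addr_ge0.
    rewrite ge0_integralDr// lte_mul_pinfty ?lee_fin// lte_add_pinfty//.
  rewrite -(leeD2rE _ _ gain_fin).
  by apply: le_trans le1 _; exact: leeD2l.
have ndB : nondecreasing_seq (fun m => A `&` B m).
  move=> m1 m2 m12; rewrite subsetEset; apply: setIS => w [/= am bm].
  by split; [apply: le_trans am _|apply: le_trans bm _]; rewrite ler_nat.
have mAB m : measurable (A `&` B m) by apply: (FM (t := t)); exact: FI.
have AE : A = \bigcup_m (A `&` B m).
  apply/seteqP; split => [w Aw|w [m _ []//]].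
  have M : `|a t w| + `|b t w| <= (Num.trunc (`|a t w| + `|b t w|)).+1%:R.
    by rewrite ltW// truncnS_gt.
  exists (Num.trunc (`|a t w| + `|b t w|)).+1 => //; split => //; split => /=.
    by apply: le_trans M; rewrite lerDl.
  by apply: le_trans M; rewrite lerDr.
have cvB (f : Omega -> R) : measurable_fun setT f -> (forall w, 0 <= f w) ->
   (\int[Q]_(w in A `&` B m) (f w)%:E @[m --> \oo] --> \int[Q]_(w in A) (f w)%:E)%E.
  move=> mf f0; rewrite {2}AE; apply: ge0_nondecreasing_set_cvg_integral => //.
  - by move=> m; exact/measurable_EFinP/measurable_funTS.
  - by move=> m w _; rewrite lee_fin.
have m1 : measurable_fun setT (fun w => U w + Wm k w) by exact: measurable_funD.
have m2 : measurable_fun setT (fun w => Wp k w + G w) by exact: measurable_funD.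
have p1 w : 0 <= U w + Wm k w by rewrite addr_ge0// le_max lexx orbT.
have p2 w : 0 <= Wp k w + G w by rewrite addr_ge0.
have l1 := cvB _ m1 p1; have l2 := cvB _ m2 p2.
rewrite -(cvg_lim _ l1)// -(cvg_lim _ l2)//.
by apply: lee_lim; [exact: cvgP l1|exact: cvgP l2|exact: nearW].
Qed.

Lemma expected_terminal_wealth_le :
  (\int[Q]_w (U w)%:E <= x%:E + \int[Q]_w (G w)%:E)%E.
Proof.
have obs : observable 0 setT.
  rewrite /observable /= -(measurable_g_measurableTypeE (sF _)); exact: measurableT.
have := supermartingale_bound (add0n _) obs.
have -> : Wm 0 = cst (Num.max (- x) 0).
  by apply/funext => w; rewrite /Wm big_pred0// addr0.
have -> : Wp 0 = cst (Num.max x 0).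
  by apply/funext => w; rewrite /Wp big_pred0// addr0.
rewrite !ge0_integralDr//; try by move=> w; rewrite ?/U /= le_max lexx orbT.
have cstE (r : R) : (\int[Q]_w (cst r w)%:E = r%:E)%E.
  rewrite -[LHS]/(\int[Q]_w (cst r%:E w))%E.
  by rewrite integral_cst// [X in (_ * X)%E](_ : _ = 1%E) ?mule1//; exact: probability_setT.
rewrite !cstE.
have xE : x = Num.max x 0 - Num.max (- x) 0.
  exact: (pos_neg (fun=> x) point).
move=> h; rewrite [X in (X%:E + _)%E]xE EFinB addeAC leeBrDr//.
Qed.

End WeakDuality.

(** * Linear description of the bid-ask cone *)

Section BidAsk.
Context (d : measure_display) (Omega : measurableType d) (R : realType) (T : nat).
Implicit Types (mu lambda : R) (S : process T Omega R).

(** The bid price is at most the ask price, so the liquidation value is the smaller of the two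
    linear valuations. All later cone computations use this intersection of half-planes. *)
Lemma bid_ask_coneP mu lambda S t w (y : R * R) :
  - mu <= lambda -> 0 <= S t w ->
  bid_ask_cone mu lambda S t w y <->
    0 <= y.1 + S t w * (1 - mu) * y.2 /\ 0 <= y.1 + S t w * (1 + lambda) * y.2.
Proof.
move=> ml S0; rewrite /bid_ask_cone /=; move: (S t w) S0 => s S0.
have d0 : 0 <= s * (lambda + mu) by rewrite mulr_ge0//; lra.
have [y0|y0] := leP 0 y.2.
  rewrite mulr1 mulr0 addr0.
  have := mulr_ge0 d0 y0; split => [h|[h _]]; last by lra.
  by split; lra.
rewrite mulr1 mulr0 add0r.
have : s * (lambda + mu) * y.2 <= 0 by rewrite mulr_ge0_le0// ltW.
split => [h|[_ h]]; last by lra.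
by split; lra.
Qed.

(** Valuing at a price between bid and ask is never below the liquidation value. *)
Lemma bid_ask_cone_dual mu lambda S t w (y : R * R) chi :
  0 <= S t w -> 1 - mu <= chi <= 1 + lambda ->
  bid_ask_cone mu lambda S t w y -> 0 <= y.1 + chi * S t w * y.2.
Proof.
move=> S0 /andP[c1 c2] /(bid_ask_coneP _ _)[|//|h1 h2]; first by lra.
have [y0|/ltW y0] := leP 0 y.2.
  have : 0 <= S t w * y.2 * (chi - (1 - mu)) by rewrite !mulr_ge0//; lra.
  lra.
have : S t w * y.2 * (1 + lambda - chi) <= 0.
  by rewrite mulr_le0_ge0//; [rewrite mulr_ge0_le0|lra].
lra.
Qed.

End BidAsk.

(** * Versions of conditional expectations; trivial sigma-algebras *)

Section Versions.
Context (d : measure_display) (Omega : measurableType d) (R : realType).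
Variables (Q : probability Omega R) (G : set (set Omega)).
Hypothesis sG : sigma_algebra setT G.
Hypothesis GM : G `<=` measurable.

(** On the set where Z is negative, which belongs to [G], the integral of Z is nonnegative, so Z
    vanishes there a.s. and the set is null. Z may take infinite values. *)
Lemma cond_expectation_ge0 (f : Omega -> R) (Z : Omega -> \bar R) :
  {ae Q, forall w, 0 <= f w} -> measurable_fun setT f ->
  is_cond_expectation Q G f Z -> {ae Q, forall w, (0 <= Z w)%E}.
Proof.
move=> f0 mf [mZ ZE].
pose A := [set w | (Z w < 0)%E].
have GA : G A.
  rewrite (_ : A = Z @^-1` `]-oo, 0%E[%classic); last first.
    by apply/seteqP; split => w /=; rewrite in_itv.
  by apply: (measurable_wrt_preimage sG mZ); exact: emeasurable_itv.
have mA := GM GA.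
have mZ' : measurable_fun setT Z := measurable_wrtW sG GM mZ.
have le0 : (0 <= \int[Q]_(w in A) Z w)%E.
  rewrite ZE//.
  rewrite (_ : (\int[Q]_(w in A) (f w)%:E = \int[Q]_(w in A) (Num.max (f w) 0)%:E)%E).
    by apply: integral_ge0 => w _; rewrite lee_fin le_max lexx orbT.
  apply: ae_eq_integral => //.
  - exact/measurable_EFinP/measurable_funTS.
  - by apply/measurable_EFinP/measurable_funTS/measurable_maxr.
  - by apply: filterS f0 => w f0 _; rewrite max_l.
have absA : (\int[Q]_(w in A) Z w = - \int[Q]_(w in A) `|Z w|)%E.
  rewrite -integral_ge0N//; apply: eq_integral => w.
  by rewrite inE => /lte0_abs ->; rewrite oppeK.
have abs0 : (\int[Q]_(w in A) `|Z w| = 0)%E.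
  by apply/eqP; rewrite eq_le integral_ge0// andbT -oppe_ge0 -absA.
have := (ae_eq_integral_abs Q mA (measurable_funTS mZ')).1 abs0.
apply: filterS => w; rewrite /A /= => h; rewrite leNgt; apply/negP => Zw.
by move: (Zw); rewrite h//= ltxx.
Qed.

(** The sets where f is at most n have probability 0 or 1 and exhaust Omega, so they cannot all be
    null. Applied to the initial stock price. *)
Lemma trivial_sigma_algebra_bounded (f : Omega -> R) :
  (forall A, G A -> Q A = 0%E \/ Q A = 1%E) -> measurable_wrt G f ->
  exists C : R, {ae Q, forall w, f w <= C}.
Proof.
move=> G01 mf; apply: contrapT => nC.
pose A (n : nat) := [set w | f w <= n%:R].
have GA n : G (A n).
  rewrite (_ : A n = f @^-1` `]-oo, n%:R]%classic); last first.
    by apply/seteqP; split => w /=; rewrite in_itv.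
  by apply: (measurable_wrt_preimage sG mf); exact: measurable_itv.
have A0 n : Q (A n) = 0%E.
  have [//|A1] := G01 _ (GA n); exfalso; apply: nC; exists n%:R.
  exists (~` A n); split; [exact/measurableC/GM|  |by []].
  by rewrite probability_setC ?A1 ?subee//; exact: GM.
have : Q.-negligible (\bigcup_n A n).
  by apply: negligible_bigcup => n; exists (A n); split; [exact: GM|exact: A0|].
have -> : \bigcup_n A n = setT.
  apply/seteqP; split => // w _; exists (Num.trunc (f w)).+1 => //.
  by rewrite /A /= ltW// truncnS_gt.
move=> /(measure_negligible measurableT) Q0.
have /eqP : (1 = 0 :> \bar R)%E by rewrite -[LHS](probability_setT Q); exact: Q0.
by rewrite onee_eq0.
Qed.

End Versions.

(** * Values of dual pairs are at most hedging prices *)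

Section EasyInequality.
Context (d : measure_display) (Omega : measurableType d) (R : realType).
Variables (P : probability Omega R) (T : nat).
Variable F : 'I_T.+1 -> set (set Omega).
Hypothesis Ffiltration : is_filtration F.
Hypothesis F_0 : forall A, F ord0 A -> P A = 0%E \/ P A = 1%E.
Variables (mu lambda : R) (S2 : process T Omega R).
Hypotheses (mu01 : 0 < mu < 1) (lambda01 : 0 < lambda < 1).
Hypothesis S2_adapted_pos : L0_adapted P F [set r : R | 0 < r] S2.

Let sF t : sigma_algebra setT (F t). Proof. by case: Ffiltration. Qed.
Let FM t : F t `<=` measurable. Proof. by case: Ffiltration. Qed.

Lemma measurable_sum_cond (I : finType) (p : pred I) (f : I -> Omega -> R) :
  (forall i, measurable_fun setT (f i)) ->
  measurable_fun setT (fun w => \sum_(i | p i) f i w).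
Proof.
by move=> mf; under eq_fun do rewrite -big_filter; exact: measurable_sum.
Qed.

(** The bridge from the conditional bid-ask inequalities of a price system to the integral
    inequalities [bid] and [ask] of the weak duality section, for the versions truncated at 0. The
    factor built from S_t is taken into the integrals by [ge0_eq_integral_weight]. *)
Lemma price_system_bid_ask (X chi : process T Omega R) (Q : probability Omega R)
    (S X' chi' : process T Omega R) t (A : set Omega) :
  randomized_stopping_times P F X ->
  price_systems P F mu lambda S2 X (chi, Q) ->
  S = (fun t w => Num.max (S2 t w) 0) ->
  X' = (fun t w => Num.max (X t w) 0) ->
  chi' = (fun t w => Num.max (chi t w) 0) ->
  F t A ->
  ((\int[Q]_(w in A) (S t w * (1 - mu)
      * (\sum_(s < T.+1 | (t <= s)%N) X' s w))%:E
    <= \int[Q]_(w in A) (\sum_(s < T.+1 | (t <= s)%N)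
         X' s w * chi' s w * S s w)%:E)%E) /\
  ((\int[Q]_(w in A) (\sum_(s < T.+1 | (t <= s)%N)
         X' s w * chi' s w * S s w)%:E
    <= \int[Q]_(w in A) (S t w * (1 + lambda)
      * (\sum_(s < T.+1 | (t <= s)%N) X' s w))%:E)%E).
Proof.
move=> [aX _] [achi QP _ /(_ t)[Y [Xp [cY cXp bounds]]]] -> -> -> FA.
have mA := FM FA.
have W s (f : Omega -> R) : measurable_wrt (F s) f -> measurable_fun setT f.
  exact: (measurable_wrtW (sF s) (@FM s)).
have mX s : measurable_fun setT (X s) by apply: (W s); case: (aX s).
have mchi s : measurable_fun setT (chi s) by apply: (W s); case: (achi s).
have mS s : measurable_fun setT (S2 s) by apply: (W s); case: (S2_adapted_pos s).
have aeX : {ae Q, forall w, forall s, 0 <= X s w}.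
  by apply: filter_forall => s; apply: (dominated_ae QP); case: (aX s).
have aechi : {ae Q, forall w, forall s, 1 - mu <= chi s w <= 1 + lambda}.
  by apply: filter_forall => s; apply: (dominated_ae QP); case: (achi s).
have aeS : {ae Q, forall w, forall s, 0 < S2 s w}.
  by apply: filter_forall => s; apply: (dominated_ae QP); case: (S2_adapted_pos s).
have mm (f : Omega -> R) : measurable_fun setT f ->
   measurable_fun setT (fun w => Num.max (f w) 0).
  by move=> mf; exact: measurable_maxr.
have m0 (r : R) : 0 <= Num.max r 0 by rewrite le_max lexx orbT.
pose f1 w := \sum_(s < T.+1 | (t <= s)%N) X s w.
pose f2 w := \sum_(s < T.+1 | (t <= s)%N) X s w * chi s w * S2 s w.
set Y1 := fun w => \sum_(s < T.+1 | (t <= s)%N) Num.max (X s w) 0.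
set Y2 := fun w => \sum_(s < T.+1 | (t <= s)%N) (Num.max (X s w) 0 *
   Num.max (chi s w) 0 * Num.max (S2 s w) 0).
have mf1 : measurable_fun setT f1 by exact: measurable_sum_cond.
have mf2 : measurable_fun setT f2.
  by apply: measurable_sum_cond => s; apply: measurable_funM => //;
     exact: measurable_funM.
have mY1 : measurable_fun setT Y1 by apply: measurable_sum_cond => s; exact: mm.
have mY2 : measurable_fun setT Y2.
  by apply: measurable_sum_cond => s; apply: measurable_funM; [apply: measurable_funM|];
    exact: mm.
have Y1_ge0 w : 0 <= Y1 w by apply: sumr_ge0.
have Y2_ge0 w : 0 <= Y2 w by apply: sumr_ge0 => s _; rewrite !mulr_ge0.
have e1 : {ae Q, forall w, f1 w = Y1 w}.
  by apply: filterS aeX => w h; apply: eq_bigr => s _; rewrite max_l.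
have e2 : {ae Q, forall w, f2 w = Y2 w}.
  apply: filterS3 aeX aechi aeS => w h1 h2 h3; apply: eq_bigr => s _.
  rewrite !max_l//; first exact: ltW.
  have /andP[c1 _] := h2 s; apply: le_trans c1; case/andP: mu01 => _ ?; lra.
(* A version of the conditional expectation, truncated at 0, has the same integrals over sets of F_t
   as the everywhere nonnegative [Z]. *)
have key (f Z : Omega -> R) (V : Omega -> \bar R) : measurable_fun setT f ->
    measurable_fun setT Z -> (forall w, 0 <= Z w) ->
    {ae Q, forall w, f w = Z w} -> is_cond_expectation Q (F t) f V ->
    {ae Q, forall w, (0 <= V w)%E} /\
    (forall A, F t A -> \int[Q]_(w in A) (Z w)%:E = \int[Q]_(w in A) maxe (V w) 0)%E.
  move=> mf mZ Z0 fZ cV.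
  have V0 : {ae Q, forall w, (0 <= V w)%E}.
    apply: (cond_expectation_ge0 (sF t) (@FM t) _ mf cV).
    by apply: filterS fZ => w ->.
  split=> // B FB; have mB := FM FB; have [mV VE] := cV.
  have mV' := measurable_wrtW (sF t) (@FM t) mV.
  transitivity (\int[Q]_(w in B) V w)%E.
    rewrite VE//; apply: ae_eq_integral => //.
    - exact/measurable_EFinP/measurable_funTS.
    - exact/measurable_EFinP/measurable_funTS.
    - by apply: filterS fZ => w ->.
  apply: ae_eq_integral => //; first exact: measurable_funTS.
  - by apply/measurable_funTS/measurable_maxe.
  - by apply: filterS V0 => w h _; apply/esym/max_idPl.
have [Xp0 Xp1] := key _ _ _ mf1 mY1 Y1_ge0 e1 cXp.
have [Y0 YE] := key _ _ _ mf2 mY2 Y2_ge0 e2 cY.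
have mwXp : measurable_wrt (F t) (fun w => maxe (Xp w) 0).
  by apply: measurable_maxe => //; case: cXp.
have mwY : measurable_wrt (F t) (fun w => maxe (Y w) 0).
  by apply: measurable_maxe => //; case: cY.
have mXp' := measurable_wrtW (sF t) (@FM t) mwXp.
have mY' := measurable_wrtW (sF t) (@FM t) mwY.
have me0 (r : \bar R) : (0 <= maxe r 0)%E by rewrite le_max lexx orbT.
have weight (c : R) : 0 <= c ->
    (\int[Q]_(w in A) (Num.max (S2 t w) 0 * c * Y1 w)%:E =
     \int[Q]_(w in A) ((Num.max (S2 t w) 0 * c)%:E * maxe (Xp w) 0))%E.
  move=> c0; under eq_integral do rewrite EFinM.
  apply: (ge0_eq_integral_weight (sF t) (@FM t)) => //.
  - exact/measurable_EFinP.
  - apply/measurable_EFinP/measurable_funM => //; apply: measurable_maxr => //.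
    by case: (S2_adapted_pos t).
  - by move=> w; rewrite lee_fin mulr_ge0.
have mSc (c : R) : measurable_fun A (fun w => (Num.max (S2 t w) 0 * c)%:E * maxe (Xp w) 0)%E.
  apply: emeasurable_funM; last exact: measurable_funTS.
  by apply/measurable_EFinP/measurable_funTS/measurable_funM => //; exact: mm.
case/andP: mu01 => mu0 mu1; case/andP: lambda01 => la0 la1.
have aeb := dominated_ae QP bounds.
rewrite !weight ?YE//; [|by lra|by lra]; split.
- apply: ae_ge0_le_integral => //.
  + by move=> w _; rewrite mule_ge0// lee_fin mulr_ge0//; lra.
  + exact: measurable_funTS.
  + have h : {ae Q, forall w, [/\ (0 <= Xp w)%E, (0 <= Y w)%E & forall s, 0 < S2 s w]}.
      by apply: filterS3 Xp0 Y0 aeS => w.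
    by apply: filterS2 h aeb => w [x0 y0 s0] [b1 b2] _;
      rewrite !max_l// ltW.
- apply: ae_ge0_le_integral => //.
  + exact: measurable_funTS.
  + by move=> w _; rewrite mule_ge0// lee_fin mulr_ge0//; lra.
  + have h : {ae Q, forall w, [/\ (0 <= Xp w)%E, (0 <= Y w)%E & forall s, 0 < S2 s w]}.
      by apply: filterS3 Xp0 Y0 aeS => w.
    by apply: filterS2 h aeb => w [x0 y0 s0] [b1 b2] _;
      rewrite (max_l y0) (max_l x0) (max_l (ltW (s0 t))) muleC.
Qed.

(** The double sum over t <= s is read in the other order; the initial capital keeps its value since
    the weights X sum to 1. *)
Lemma portfolio_pairing (x : R) (xi : process T Omega (R * R)%type)
    (X q : 'I_T.+1 -> R) w :
  \sum_(t < T.+1) X t = 1 ->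
  x + \sum_(t < T.+1)
    ((xi t w).1 * (\sum_(s < T.+1 | (t <= s)%N) X s)
     + (xi t w).2 * (\sum_(s < T.+1 | (t <= s)%N) X s * q s)) =
  \sum_(s < T.+1) X s * ((portfolio (x, 0) xi s w).1
                         + q s * (portfolio (x, 0) xi s w).2).
Proof.
move=> X1.
have p1 s : (portfolio (x, 0) xi s w).1 = x + \sum_(t < T.+1 | (t <= s)%N) (xi t w).1.
  rewrite /portfolio /=; congr (_ + _).
  exact: (big_morph (fun y : R * R => y.1) (fun y z => erefl) erefl).
have p2 s : (portfolio (x, 0) xi s w).2 = \sum_(t < T.+1 | (t <= s)%N) (xi t w).2.
  rewrite /portfolio /= add0r.
  exact: (big_morph (fun y : R * R => y.2) (fun y z => erefl) erefl).
under [RHS]eq_bigr do rewrite p1 p2.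
rewrite [X in _ + X = _](_ : _ =
  \sum_(s < T.+1) \sum_(t < T.+1 | (t <= s)%N)
     (X s * (xi t w).1 + X s * q s * (xi t w).2)); last first.
  rewrite [RHS](exchange_big_dep xpredT)//=; apply: eq_bigr => t _.
  by rewrite !mulr_sumr -big_split /=; apply: eq_bigr => s _; ring.
have {1}-> : x = \sum_(s < T.+1) X s * x by rewrite -mulr_suml X1 mul1r.
rewrite -big_split /=; apply: eq_bigr => s _.
by rewrite big_split /= -!mulr_sumr; ring.
Qed.

Theorem hedging_price_ge_expectation (x c : R)
    (theta : process T Omega (R * R)%type)
    (X chi : process T Omega R) (Q : probability Omega R) :
  L0_adapted P F setT theta ->
  (forall t, {ae P, forall w, c <= (theta t w).1 /\ c <= (theta t w).2}) ->
  hedging_set P F (bid_ask_cone mu lambda S2) theta (x, 0) ->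
  randomized_stopping_times P F X ->
  price_systems P F mu lambda S2 X (chi, Q) ->
  ('E_Q[(fun w => \sum_(t < T.+1)
     X t w * ((theta t w).1 + chi t w * (theta t w).2 * S2 t w))%R]
   <= x%:E)%E.
Proof.
move=> atheta thetac [_ [V [xi [axi xiK] VE] VK]] rst ps.
have [aX X1] := rst; have [achi QP _ _] := ps.
case/andP: (mu01) => mu0 mu1; case/andP: (lambda01) => la0 la1.
pose S : process T Omega R := fun t w => Num.max (S2 t w) 0.
pose X' : process T Omega R := fun t w => Num.max (X t w) 0.
pose chi' : process T Omega R := fun t w => Num.max (chi t w) 0.
pose a : process T Omega R := fun t w => (xi t w).1.
pose b : process T Omega R := fun t w => (xi t w).2.
pose Y1 : process T Omega R := fun t w => \sum_(s < T.+1 | (t <= s)%N) X' s w.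
pose Y2 : process T Omega R :=
  fun t w => \sum_(s < T.+1 | (t <= s)%N) X' s w * chi' s w * S s w.
have ba t A := @price_system_bid_ask X chi Q S X' chi' t A rst ps erefl erefl erefl.
have m0 (r : R) : 0 <= Num.max r 0 by rewrite le_max lexx orbT.
have X'_ge0 t w : 0 <= X' t w by exact: m0.
have chi'_ge0 t w : 0 <= chi' t w by exact: m0.
have S_ge0 t w : 0 <= S t w by exact: m0.
have W s (f : Omega -> R) : measurable_wrt (F s) f -> measurable_fun setT f.
  exact: (measurable_wrtW (sF s) (@FM s)).
have wS t : measurable_wrt (F t) (S t).
  by apply: measurable_maxr => //; case: (S2_adapted_pos t).
have wX t : measurable_wrt (F t) (X' t) by apply: measurable_maxr => //; case: (aX t).
have wchi t : measurable_wrt (F t) (chi' t).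
  by apply: measurable_maxr => //; case: (achi t).
have wa t : measurable_wrt (F t) (a t).
  by apply: (measurableT_comp measurable_fst); case: (axi t).
have wb t : measurable_wrt (F t) (b t).
  by apply: (measurableT_comp measurable_snd); case: (axi t).
have mXcS s : measurable_fun setT (fun w => X' s w * chi' s w * S s w).
  by apply: measurable_funM; [apply: measurable_funM|]; apply: (W s).
have mY1 t : measurable_fun setT (Y1 t).
  by apply: measurable_sum_cond => s; exact: (W s).
have mY2 t : measurable_fun setT (Y2 t) by exact: measurable_sum_cond.
have Y1_ge0 t w : 0 <= Y1 t w by apply: sumr_ge0.
have Y2_ge0 t w : 0 <= Y2 t w by apply: sumr_ge0 => s _; rewrite !mulr_ge0.
have aeX : {ae Q, forall w, forall s, 0 <= X s w}.
  by apply: filter_forall => s; apply: (dominated_ae QP); case: (aX s).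
have aechi : {ae Q, forall w, forall s, 1 - mu <= chi s w <= 1 + lambda}.
  by apply: filter_forall => s; apply: (dominated_ae QP); case: (achi s).
have aeS : {ae Q, forall w, forall s, 0 < S2 s w}.
  by apply: filter_forall => s; apply: (dominated_ae QP); case: (S2_adapted_pos s).
have aenice : {ae Q, forall w, [/\ forall s, X' s w = X s w,
    forall s, chi' s w = chi s w, forall s, S s w = S2 s w,
    forall s, 0 <= X s w & forall s, 1 - mu <= chi s w <= 1 + lambda]}.
  apply: filterS3 aeX aechi aeS => w h1 h2 h3; split => // s.
  - by rewrite /X' max_l.
  - by rewrite /chi' max_l//; have /andP[c1 _] := h2 s; apply: le_trans c1; lra.
  - by rewrite /S max_l// ltW.
have aeX1 : {ae Q, forall w, \sum_(t < T.+1) X t w = 1} by exact: dominated_ae X1.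
have Y1_le1 t : {ae Q, forall w, Y1 t w <= 1}.
  apply: filterS2 aenice aeX1 => w [XE _ _ X0 _] <-.
  rewrite /Y1 (eq_bigr _ (fun s _ => XE s)) [leRHS](bigID (fun s : 'I_T.+1 => t <= s)%N)/=.
  by rewrite lerDl sumr_ge0.
have Y1_fin t : (\int[Q]_w (Y1 t w)%:E < +oo)%E.
  apply: (@le_lt_trans _ _ (\int[Q]_w (1 : R)%:E)%E).
    apply: ae_ge0_le_integralr => //.
    by apply: filterS (Y1_le1 t) => w h _.
  by rewrite -[ltLHS]/(\int[Q]_w (cst 1%:E w))%E integral_cst// mul1e
    -ge0_fin_numE// fin_num_measure.
have FT t : F t setT.
  by rewrite -(measurable_g_measurableTypeE (sF t)); exact: measurableT.
(* [Y2] is largest at time 0, where the ask inequality bounds its expectation by that of (1 +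
   lambda) S_0 [Y1 ord0]. There S_0 is bounded because F_0 is trivial, and [Y1 ord0] is at most
   1. *)
have Y2_fin t : (\int[Q]_w (Y2 t w)%:E < +oo)%E.
  apply: (@le_lt_trans _ _ (\int[Q]_w (Y2 ord0 w)%:E)%E).
    apply: ae_ge0_le_integralr => //; apply: aeW => w _.
    rewrite /Y2 [leRHS](bigID (fun s : 'I_T.+1 => t <= s)%N)/= lerDl.
    by apply: sumr_ge0 => s _; rewrite !mulr_ge0.
  apply: le_lt_trans (ba ord0 setT (FT ord0)).2 _.
  have [C SC] := trivial_sigma_algebra_bounded (sF ord0) (@FM ord0) F_0 (S2_adapted_pos ord0).1.
  apply: (@le_lt_trans _ _ (\int[Q]_w (Num.max C 0 * (1 + lambda) : R)%:E)%E).
    apply: ae_ge0_le_integralr => //.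
    - apply: measurable_funM; last exact: (mY1 ord0).
      by apply: measurable_funM => //; exact: (W ord0).
    - move=> w; apply: mulr_ge0; last exact: (Y1_ge0 ord0).
      by apply: mulr_ge0 => //; lra.
    - by move=> w; rewrite mulr_ge0//; lra.
    apply: filterS2 (dominated_ae QP SC) (Y1_le1 ord0) => w h1 h2 _.
    apply: (@le_trans _ _ (S ord0 w * (1 + lambda) * 1)).
      by apply: ler_wpM2l => //; rewrite mulr_ge0//; lra.
    rewrite mulr1; apply: ler_wpM2r; first by lra.
    by rewrite /S ge_max !le_max h1 lexx !orbT.
  rewrite -[ltLHS]/(\int[Q]_w (cst (Num.max C 0 * (1 + lambda))%:E w))%E integral_cst//.
  by rewrite lte_mul_pinfty ?lee_fin//; [rewrite mulr_ge0//; lra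
    |rewrite -ge0_fin_numE// fin_num_measure].
have sf t : {ae Q, forall w, a t w + S t w * (1 - mu) * b t w <= 0 /\
                          a t w + S t w * (1 + lambda) * b t w <= 0}.
  apply: filterS3 (dominated_ae QP (xiK t)) aenice aeS => w Kw [_ _ SE _ _] S0.
  move: Kw => /bid_ask_coneP -[||h1 h2]; [by lra|by rewrite ltW|].
  by rewrite /a /b !SE; move: h1 h2 => /=; rewrite !mulrN => h1 h2; split; lra.
(* Since both components of theta are at least c, the stopped value of theta is at least - |c| sum_s
   X_s (1 + chi_s S_s), which is - G. The wealth dominates that value, so the same G bounds it from
   below. *)
pose G w := `|c| * (Y1 ord0 w + Y2 ord0 w).
have mG : measurable_fun setT G.
  by apply: measurable_funM => //; exact: measurable_funD.
have G_ge0 w : 0 <= G w by rewrite mulr_ge0// addr_ge0.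
pose f w := \sum_(t < T.+1)
     X t w * ((theta t w).1 + chi t w * (theta t w).2 * S2 t w).
pose Wl w := x + \sum_(t < T.+1) (a t w * Y1 t w + b t w * Y2 t w).
have aef : {ae Q, forall w, - G w <= f w /\ f w <= Wl w}.
  have aeth : {ae Q, forall w, forall t, c <= (theta t w).1 /\ c <= (theta t w).2}.
    by apply: filter_forall => t; exact: dominated_ae (thetac t).
  have aeVK : {ae Q, forall w, forall t, bid_ask_cone mu lambda S2 t w (V t w - theta t w)}.
    by apply: filter_forall => t; exact: dominated_ae (VK t).
  have aux : {ae Q, forall w, [/\ forall t, c <= (theta t w).1 /\ c <= (theta t w).2,
      forall t, bid_ask_cone mu lambda S2 t w (V t w - theta t w) &
      forall s, 0 < S2 s w]} by apply: filterS3 aeth aeVK aeS.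
  apply: filterS3 aux aenice aeX1 => w [th VKw S0] [XE cE SE X0 cb] Xs1.
  split.
    rewrite /G /Y1 /Y2 -big_split /= mulr_sumr -sumrN /f.
    rewrite (eq_bigl xpredT)//; apply: ler_sum => t _.
    rewrite XE cE SE; have [th1 th2] := th t.
    have c0 : 0 <= chi t w by have /andP[+ _] := cb t; lra.
    have cS0 : 0 <= chi t w * S2 t w by rewrite mulr_ge0// ltW.
    have nc : - `|c| <= c by rewrite lerNl -normrN ler_norm.
    have e1 : - `|c| <= (theta t w).1 by exact: le_trans th1.
    have e2 : - `|c| * (chi t w * S2 t w) <= (theta t w).2 * (chi t w * S2 t w).
      by apply: ler_wpM2r => //; exact: le_trans th2.
    have := ler_wpM2l (X0 t) (lerD e1 e2); lra.
  have := portfolio_pairing x xi (fun t => chi t w * S2 t w) w Xs1.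
  rewrite /Wl => pp.
  have -> : \sum_(t < T.+1) (a t w * Y1 t w + b t w * Y2 t w) =
    \sum_(t < T.+1)
    ((xi t w).1 * (\sum_(s < T.+1 | (t <= s)%N) X s w)
     + (xi t w).2 * (\sum_(s < T.+1 | (t <= s)%N) X s w * (chi s w * S2 s w))).
    apply: eq_bigr => t _; congr (_ * _ + _ * _).
      by apply: eq_bigr => s _.
    by apply: eq_bigr => s _; rewrite XE cE SE mulrA.
  rewrite pp /f; apply: ler_sum => t _; apply: ler_wpM2l => //.
  have := bid_ask_cone_dual (ltW (S0 t)) (cb t) (VKw t).
  rewrite -VE /=; lra.
have Wb : {ae Q, forall w, 0 <= Wl w + G w}.
  by apply: filterS aef => w [h1 h2]; lra.
have main := expected_terminal_wealth_le Ffiltration wa wb wS (fun t w => m0 (S2 t w))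
  mY1 mY2 Y1_ge0 Y2_ge0 (ltW mu1) _ Y1_fin Y2_fin (fun t A FA => (ba t A FA).1)
  (fun t A FA => (ba t A FA).2) sf mG G_ge0 Wb.
have {main} : (\int[Q]_w (Num.max (Wl w + G w) 0)%:E <= x%:E + \int[Q]_w (G w)%:E)%E.
  by apply: main; lra.
move=> main.
have G_fin : (\int[Q]_w (G w)%:E < +oo)%E.
  rewrite ge0_integralZlr//; [|exact: measurable_funD|by move=> w; rewrite addr_ge0].
  by rewrite ge0_integralDr// lte_mul_pinfty ?lee_fin// lte_add_pinfty.
have iG := ge0_integrabler mG G_ge0 G_fin.
have mf : measurable_fun setT f.
  apply: measurable_sum => t.
  have mth : measurable_fun setT (theta t).
    by apply: (measurable_wrtW (sF t) (@FM t)); case: (atheta t).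
  apply: measurable_funM; first by apply: (W t); case: (aX t).
  apply: measurable_funD; first exact: (measurableT_comp measurable_fst).
  apply: measurable_funM; last by apply: (W t); case: (S2_adapted_pos t).
  apply: measurable_funM; first by apply: (W t); case: (achi t).
  exact: (measurableT_comp measurable_snd).
(* As [f + G] is nonnegative a.s., it equals h, whose integral is controlled by that of the wealth.
   Both h and G are integrable, so the integral of G can be subtracted at the end. *)
pose h w := Num.max (f w + G w) 0.
have mh : measurable_fun setT h by apply: measurable_maxr => //; exact: measurable_funD.
have h_le : (\int[Q]_w (h w)%:E <= x%:E + \int[Q]_w (G w)%:E)%E.
  apply: le_trans main; apply: ae_ge0_le_integralr => //;
    try by move=> w; exact: m0.
  - apply: measurable_maxr => //; apply: measurable_funD => //.
    apply: measurable_funD => //; apply: measurable_sum => t.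
    by apply: measurable_funD; apply: measurable_funM => //; exact: (W t).
  - by apply: filterS aef => w [_ fW] _; rewrite /h ge_max le_max lerD2r fW m0.
have ih : Q.-integrable setT (EFin \o h).
  apply: ge0_integrabler => //; first by move=> w; exact: m0.
  by apply: le_lt_trans h_le _; rewrite lte_add_pinfty// ltry.
rewrite unlock.
rewrite (_ : (\int[Q]_w (f w)%:E)%E = (\int[Q]_w ((h w)%:E - (G w)%:E))%E).
  by rewrite integralB_EFin// leeBlDr// ?integrable_fin_num//.
apply: ae_eq_integral => //; first exact/measurable_EFinP.
  by apply: emeasurable_funB; exact/measurable_EFinP.
apply: filterS aef => w [fG _] _; rewrite -EFinB /h max_l; last by lra.
by rewrite addrK.
Qed.

End EasyInequality.

(** * Realizing dual processes by randomized stopping times *)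

Lemma measurable_fun_invr (d : measure_display) (Omega : measurableType d)
    (R : realType) (f : Omega -> R) :
  measurable_fun setT f -> (forall w, 0 <= f w) ->
  measurable_fun setT (fun w => (f w)^-1).
Proof.
move=> mf f0; under eq_fun do rewrite -powR_inv1//.
by apply: (@measurableT_comp _ _ _ _ _ _ (fun x : R => x `^ (-1))) => //.
Qed.

Section AlmostSureComparison.
Context (d : measure_display) (Omega : measurableType d) (R : realType).
Variables (P : probability Omega R).

Lemma ae_gt0_integral_eq0 (f : Omega -> R) (A : set Omega) :
  measurable A -> measurable_fun setT f -> (forall w, 0 <= f w) ->
  {ae P, forall w, A w -> 0 < f w} -> (\int[P]_(w in A) (f w)%:E = 0)%E ->
  P A = 0%E.
Proof.
move=> mA mf f0 fpos int0.
have : (\int[P]_(w in A) `|(f w)%:E| = 0)%E.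
  by rewrite -int0; apply: eq_integral => w _; rewrite /= ger0_norm.
move/(ae_eq_integral_abs P mA).
have mfA : measurable_fun A (EFin \o f) by exact/measurable_EFinP/measurable_funTS.
move=> /(_ mfA) fA0.
have : {ae P, forall w, ~ A w}.
  apply: filterS2 fpos fA0 => w h1 h2 Aw.
  by have := h1 Aw; have [->] := h2 Aw; rewrite ltxx.
move=> [B [mB PB sB]].
apply: (subset_measure0 mA mB _ PB) => w Aw.
by apply: sB => /= h; exact: h Aw.
Qed.

Variable G : set (set Omega).
Hypothesis sG : sigma_algebra setT G.
Hypothesis GM : G `<=` measurable.

Lemma ge0_eq_integral_weightr (m1 m2 : {measure set Omega -> \bar R})
    (f h g : Omega -> R) (D : set Omega) :
  measurable_fun setT f -> measurable_fun setT h ->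
  (forall w, 0 <= f w) -> (forall w, 0 <= h w) ->
  (forall A, G A -> \int[m1]_(w in A) (f w)%:E = \int[m2]_(w in A) (h w)%:E)%E ->
  G D -> measurable_wrt G g -> (forall w, 0 <= g w) ->
  (\int[m1]_(w in D) (g w * f w)%:E = \int[m2]_(w in D) (g w * h w)%:E)%E.
Proof.
move=> mf mh f0 h0 fh GD wg g0.
under eq_integral do rewrite EFinM.
under [RHS]eq_integral do rewrite EFinM.
by apply: (ge0_eq_integral_weight sG GM) => //; first [exact/measurable_EFinP
  | by move=> w; rewrite lee_fin].
Qed.

(** Test on the set where g < f: there g is integrable because it lies below f, so its integral can
    be subtracted, and f - g is positive with integral zero. *)
Lemma ae_le_of_integrals (f g : Omega -> R) :
  measurable_wrt G f -> measurable_wrt G g ->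
  (forall w, 0 <= f w) -> (forall w, 0 <= g w) ->
  (\int[P]_w (f w)%:E < +oo)%E ->
  (forall A, G A -> \int[P]_(w in A) (f w)%:E <= \int[P]_(w in A) (g w)%:E)%E ->
  {ae P, forall w, f w <= g w}.
Proof.
move=> wf wg f0 g0 ffin fg.
have mf := measurable_wrtW sG GM wf; have mg := measurable_wrtW sG GM wg.
pose A := [set w | g w < f w].
have GA : G A.
  have w01 : measurable_wrt G (fun w => f w - g w) by exact: measurable_funB.
  rewrite (_ : A = (fun w => f w - g w) @^-1` `]0, +oo[%classic); last first.
    by apply/seteqP; split => w /=; rewrite in_itv /= andbT subr_gt0.
  by apply: (measurable_wrt_preimage sG w01); exact: measurable_itv.
have mA := GM GA.
pose h w := Num.max (f w - g w) 0.
have h0 w : 0 <= h w by rewrite le_max lexx orbT.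
have mh : measurable_fun setT h by apply: measurable_maxr => //; exact: measurable_funB.
have gAfin : (\int[P]_(w in A) (g w)%:E)%E \is a fin_num.
  rewrite ge0_fin_numE; last by apply: integral_ge0 => w _; rewrite lee_fin.
  apply: (@le_lt_trans _ _ (\int[P]_(w in A) (f w)%:E)%E).
    by apply: ae_ge0_le_integralr => //; apply: aeW => w; exact: ltW.
  apply: le_lt_trans ffin; apply: ge0_subset_integral => //.
  - exact/measurable_EFinP.
  - by move=> w _; rewrite lee_fin.
have hA0 : (\int[P]_(w in A) (h w)%:E = 0)%E.
  apply/eqP; rewrite eq_le; apply/andP; split; last first.
    by apply: integral_ge0 => w _; rewrite lee_fin.
  rewrite -(leeD2rE _ _ gAfin) add0e -ge0_integralDr//.
  apply: le_trans (fg _ GA).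
  apply: ae_ge0_le_integralr => //; first exact: measurable_funD.
  - by move=> w; rewrite addr_ge0.
  by apply: aeW => w; rewrite /A /h /= => gf; rewrite max_l ?subrK// subr_ge0 ltW.
have PA : P A = 0%E.
  apply: ae_gt0_integral_eq0 mA mh h0 _ hA0.
  by apply: aeW => w; rewrite /A /h /= => gf; rewrite lt_max subr_gt0 gf.
by exists A; split => // w /= /negP; rewrite -ltNge.
Qed.

Lemma ge0_cond_expectation_exists (f : Omega -> R) :
  measurable_fun setT f -> (forall w, 0 <= f w) ->
  (\int[P]_w (f w)%:E < +oo)%E ->
  exists Z : Omega -> R, [/\ measurable_wrt G Z, forall w, 0 <= Z w &
    forall A, G A ->
      (\int[P]_(w in A) (Z w)%:E = \int[P]_(w in A) (f w)%:E)%E].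
Proof.
move=> mf f0 ffin.
have [Z [wZ iZ ZE]] := cond_expectation_exists sG GM (ge0_integrabler mf f0 ffin).
have mZ := measurable_wrtW sG GM wZ.
have Z0 : {ae P, forall w, 0 <= Z w}.
  have cZ : is_cond_expectation P G f (EFin \o Z).
    by split => //; exact/measurable_EFinP.
  have f0' : {ae P, forall w, 0 <= f w} by exact: aeW.
  have := cond_expectation_ge0 sG GM f0' mf cZ.
  by apply: filterS => w /=; rewrite lee_fin.
exists (fun w => Num.max (Z w) 0); split => [||A GA].
- exact: measurable_maxr.
- by move=> w; rewrite le_max lexx orbT.
- rewrite -ZE//; apply: ae_eq_integral; first exact: GM.
  + by apply/measurable_EFinP/measurable_funTS/measurable_maxr.
  + exact/measurable_EFinP/measurable_funTS.
  + by apply: filterS Z0 => w h _; rewrite max_l.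
Qed.

End AlmostSureComparison.

(** * From a dual process to a stopping time, a price and a measure *)

Section DualRealization.
Context (d : measure_display) (Omega : measurableType d) (R : realType).
Variables (P : probability Omega R) (T : nat).
Variable F : 'I_T.+1 -> set (set Omega).
Hypothesis Ffiltration : is_filtration F.
Variables (mu lambda : R) (S2 : process T Omega R).
Hypotheses (mu01 : 0 < mu < 1) (lambda01 : 0 < lambda < 1).
Hypothesis S2_adapted_pos : L0_adapted P F [set r : R | 0 < r] S2.

Let sF t : sigma_algebra setT (F t). Proof. by case: Ffiltration. Qed.
Let FM t : F t `<=` measurable. Proof. by case: Ffiltration. Qed.
Let FF (s t : 'I_T.+1) : (s <= t)%N -> F s `<=` F t.
Proof. by case: Ffiltration => _ _ h /h. Qed.

Let wrtM t (f : Omega -> R) : measurable_wrt (F t) f -> measurable_fun setT f.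
Proof. exact: (measurable_wrtW (sF t) (@FM t)). Qed.

Lemma measurable_wrt_le (s t : 'I_T.+1) (f : Omega -> R) : (s <= t)%N ->
  measurable_wrt (F s) f -> measurable_wrt (F t) f.
Proof.
move=> st wf _ B mB; rewrite setTI; apply: measurable_sigma_subalgebra.
by apply: FF st _ _; exact: (measurable_wrt_preimage (sF s) wf).
Qed.

(** The pointwise condition will place chi between its bounds; the last one is the bid-ask
    inequality for conditional expectations of tail sums, in integral form. [Num.max (S2 t w) 0]
    keeps the integrands nonnegative everywhere. *)
Definition dual_pair (Z1 Z2 : process T Omega R) :=
  [/\ forall t, measurable_wrt (F t) (Z1 t) /\ measurable_wrt (F t) (Z2 t),
      forall t w, 0 <= Z1 t w /\ 0 <= Z2 t w,
      forall t, (\int[P]_w (Z1 t w)%:E < +oo)%E /\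
                (\int[P]_w (Z2 t w)%:E < +oo)%E,
      forall t, {ae P, forall w, S2 t w * (1 - mu) * Z1 t w <= Z2 t w
                       <= S2 t w * (1 + lambda) * Z1 t w} &
      forall t A, F t A ->
        (\int[P]_(w in A) (Num.max (S2 t w) 0 * (1 - mu)
            * \sum_(s < T.+1 | (t <= s)%N) Z1 s w)%:E
         <= \int[P]_(w in A) (\sum_(s < T.+1 | (t <= s)%N) Z2 s w)%:E)%E /\
        (\int[P]_(w in A) (\sum_(s < T.+1 | (t <= s)%N) Z2 s w)%:E
         <= \int[P]_(w in A) (Num.max (S2 t w) 0 * (1 + lambda)
            * \sum_(s < T.+1 | (t <= s)%N) Z1 s w)%:E)%E].

Variables Z1 Z2 : process T Omega R.
Hypothesis dZ : dual_pair Z1 Z2.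
Hypothesis Z1_last : {ae P, forall w, 0 < Z1 ord_max w}.

Let wZ1 t : measurable_wrt (F t) (Z1 t). Proof. by case: dZ => /(_ t)[]. Qed.
Let wZ2 t : measurable_wrt (F t) (Z2 t). Proof. by case: dZ => /(_ t)[]. Qed.
Let mZ1 t : measurable_fun setT (Z1 t). Proof. exact: wrtM. Qed.
Let mZ2 t : measurable_fun setT (Z2 t). Proof. exact: wrtM. Qed.
Let Z1_ge0 t w : 0 <= Z1 t w. Proof. by case: dZ => _ /(_ t w)[]. Qed.
Let Z2_ge0 t w : 0 <= Z2 t w. Proof. by case: dZ => _ /(_ t w)[]. Qed.
Let Z1_fin t : (\int[P]_w (Z1 t w)%:E < +oo)%E.
Proof. by case: dZ => _ _ /(_ t)[]. Qed.
Let Z2_fin t : (\int[P]_w (Z2 t w)%:E < +oo)%E.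
Proof. by case: dZ => _ _ /(_ t)[]. Qed.

Lemma integral_sum_lty (p : pred 'I_T.+1) (f : process T Omega R) :
  (forall t, measurable_fun setT (f t)) -> (forall t w, 0 <= f t w) ->
  (forall t, \int[P]_w (f t w)%:E < +oo)%E ->
  (\int[P]_w (\sum_(s | p s) f s w)%:E < +oo)%E.
Proof.
move=> mf f0 ffin; rewrite ge0_integral_sumr//.
by apply: lte_sum_pinfty => s _; exact: ffin.
Qed.

(** M_t is the part of N_t still to come after t. At T the empty sum is represented by the exact
    constant 0, which later makes the total mass of X exactly 1. For t < T, on the set where M_t
    vanishes the integral of Z1_T vanishes too, so that set is null. *)
Lemma exists_future_expectation : exists M : process T Omega R,
  [/\ forall t, measurable_wrt (F t) (M t), forall t w, 0 <= M t w,
      forall t A, F t A -> (\int[P]_(w in A) (M t w)%:E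
         = \int[P]_(w in A) (\sum_(s < T.+1 | (t < s)%N) Z1 s w)%:E)%E,
      forall w, M ord_max w = 0 &
      forall t : 'I_T.+1, (t < T)%N -> {ae P, forall w, 0 < M t w}].
Proof.
have mS t : measurable_fun setT (fun w => \sum_(s < T.+1 | (t < s)%N) Z1 s w).
  exact: measurable_sum_cond.
have S0 (t : 'I_T.+1) w : 0 <= \sum_(s < T.+1 | (t < s)%N) Z1 s w by exact: sumr_ge0.
have Sfin (t : 'I_T.+1) : (\int[P]_w (\sum_(s < T.+1 | (t < s)%N) Z1 s w)%:E < +oo)%E.
  exact: integral_sum_lty.
have /choice[M0 M0P] t := ge0_cond_expectation_exists (sF t) (@FM t) (mS t) (S0 t) (Sfin t).
pose M t := if t == ord_max then cst 0 else M0 t.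
exists M; split.
- move=> t; rewrite /M; case: ifP => _; first exact: measurable_cst.
  by have [h _ _] := M0P t; exact: h.
- move=> t w; rewrite /M; case: ifP => _; [exact: lexx|have [_ h _] := M0P t; exact: h].
- move=> t A FA; rewrite /M; case: eqP => [->|_]; last by case: (M0P t) => _ _; apply.
  apply: eq_integral => w _; rewrite big_pred0// => s.
  by rewrite ltnNge /= -ltnS ltn_ord.
- by move=> w; rewrite /M eqxx.
move=> t tT.
have tmax : t != ord_max by rewrite -val_eqE /= ltn_eqF.
rewrite /M (negbTE tmax); have [wM M_ge0 ME] := M0P t.
pose A := [set w | M0 t w <= 0].
have FA : F t A.
  rewrite (_ : A = M0 t @^-1` `]-oo, 0]%classic); last first.
    by apply/seteqP; split => w /=; rewrite in_itv.
  by apply: (measurable_wrt_preimage (sF t) wM); exact: measurable_itv.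
have mA := FM FA.
have Z0 : (\int[P]_(w in A) (Z1 ord_max w)%:E = 0)%E.
  apply/eqP; rewrite eq_le; apply/andP; split; last first.
    by apply: integral_ge0 => w _; rewrite lee_fin.
  apply: (@le_trans _ _ (\int[P]_(w in A) (\sum_(s < T.+1 | (t < s)%N) Z1 s w)%:E)%E).
    apply: ae_ge0_le_integralr => //; apply: aeW => w _.
    by rewrite (bigD1 ord_max)//= lerDl sumr_ge0.
  rewrite -ME// (_ : (\int[P]_(w in A) (M0 t w)%:E = 0)%E)//.
  rewrite (_ : (0 = \int[P]_(w in A) 0)%E); last by rewrite integral0.
  apply: eq_integral => w; rewrite inE /A /= => Mw; congr EFin.
  by apply/eqP; rewrite eq_le Mw M_ge0.
have PA : P A = 0%E.
  apply: ae_gt0_integral_eq0 mA (mZ1 _) (Z1_ge0 _) _ Z0.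
  by apply: filterS Z1_last => w h _.
by exists A; split => // w /= /negP; rewrite -leNgt.
Qed.

Hypothesis Z1_normalized :
  (\int[P]_w (\sum_(t < T.+1) Z1 t w)%:E = 1)%E.

Let m0 (r : R) : 0 <= Num.max r 0. Proof. by rewrite le_max lexx orbT. Qed.

(* The multiplicative decomposition of the Azema supermartingale
   N_t = E[Z_t + ... + Z_T | F_t]: N_t = D_t * Xp_t with D a martingale, the
   density process of Q, and Xp_t = 1 - X_0 - ... - X_{t-1}. *)
Lemma exists_randomized_stopping : exists (X Xp : process T Omega R)
    (N : process T Omega R) (Q : probability Omega R),
  [/\ forall t, measurable_wrt (F t) (X t) /\ measurable_wrt (F t) (Xp t),
      (forall t w, 0 <= X t w) /\ (forall t w, 0 <= Xp t w),
      (forall (t : 'I_T.+1) w, \sum_(s < T.+1 | (t <= s)%N) X s w = Xp t w) /\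
      (forall w, Xp ord0 w = 1),
      Q `<< P /\ P `<< Q &
      [/\ forall t, measurable_wrt (F t) (N t),
          forall t w, 0 <= N t w,
          {ae P, forall w, forall t, 0 < N t w /\ 0 < Xp t w},
          forall t A, F t A -> (\int[P]_(w in A) (N t w)%:E
            = \int[P]_(w in A) (\sum_(s < T.+1 | (t <= s)%N) Z1 s w)%:E)%E &
          forall t (g : Omega -> R) A, measurable_wrt (F t) g ->
            (forall w, 0 <= g w) -> F t A ->
            (\int[Q]_(w in A) (g w * X t w)%:E
              = \int[P]_(w in A) (g w * Z1 t w)%:E)%E /\
            (\int[Q]_(w in A) (g w)%:E
              = \int[P]_(w in A) (g w * (N t w / Xp t w))%:E)%E]].
Proof.
have [M [wM M_ge0 ME M_max M_pos]] := exists_future_expectation.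
have mM t : measurable_fun setT (M t) by exact: wrtM.
pose N t w := Z1 t w + M t w.
have wN t : measurable_wrt (F t) (N t).
  by apply: measurable_funD; [exact: wZ1|exact: wM].
have mN t : measurable_fun setT (N t) by exact: wrtM.
have N_ge0 t w : 0 <= N t w by rewrite addr_ge0.
have NE t A : F t A -> (\int[P]_(w in A) (N t w)%:E
    = \int[P]_(w in A) (\sum_(s < T.+1 | (t <= s)%N) Z1 s w)%:E)%E.
  move=> FA; have mA := FM FA.
  rewrite ge0_integralDr// ME// -ge0_integralDr//; first last.
  - by move=> w; exact: sumr_ge0.
  - exact: measurable_sum_cond.
  apply: eq_integral => w _; congr EFin.
  rewrite [RHS](bigD1 t)//=; congr (_ + _); apply: eq_bigl => s.
  by rewrite ltn_neqAle andbC eq_sym.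
(* X+ is defined by X+_{t+1} = X+_t M_t / N_t, an F_t-measurable quantity. Where N_t = 0 the inverse
   is 0, so the ratio lies in [0, 1] everywhere. *)
pose ratio t w := M t w / N t w.
have ratio_ge0 t w : 0 <= ratio t w by rewrite divr_ge0.
have ratio_le1 t w : ratio t w <= 1.
  rewrite /ratio; have [->|N0] := eqVneq (N t w) 0; first by rewrite invr0 mulr0.
  have N_gt0 : 0 < N t w by rewrite lt0r N0 N_ge0.
  by rewrite ler_pdivrMr// mul1r /N lerDr.
have wratio t : measurable_wrt (F t) (ratio t).
  apply: measurable_funM; first exact: wM.
  exact: (measurable_fun_invr (wN t) (N_ge0 t)).
(* Indexed by natural numbers because the value at T + 1, past the last date, is needed. *)
pose xp : nat -> Omega -> R := fix xp k w :=
  if k is k'.+1 then xp k' w * ratio (inord k') w else 1.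
have xp_ge0 k w : 0 <= xp k w by elim: k => //= k IH; rewrite mulr_ge0.
have xpS (t : 'I_T.+1) w : xp t.+1 w = xp t w * ratio t w by rewrite /= inord_val.
have wxp k (t : 'I_T.+1) : (k <= t.+1)%N -> measurable_wrt (F t) (xp k).
  elim: k => [_|k IH kt]; first exact: measurable_cst.
  apply: measurable_funM; first by apply: IH; exact: ltnW.
  apply: (@measurable_wrt_le (inord k)) => //.
  by rewrite inordK// (leq_trans kt).
pose X (t : 'I_T.+1) w := xp t w - xp t.+1 w.
pose Xp (t : 'I_T.+1) w := xp t w.
have wX t : measurable_wrt (F t) (X t).
  by apply: measurable_funB; apply: wxp.
have wXp t : measurable_wrt (F t) (Xp t) by apply: wxp.
have X_ge0 t w : 0 <= X t w.
  by rewrite /X xpS subr_ge0 ler_piMr.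
(* M_T = 0 kills the last factor; hence the X_s with s >= t telescope to X+_t with no remainder. *)
have xpT w : xp T.+1 w = 0.
  by rewrite -[T]/(val (@ord_max T)) xpS /ratio M_max mul0r mulr0.
have XpE (t : 'I_T.+1) w : \sum_(s < T.+1 | (t <= s)%N) X s w = Xp t w.
  rewrite -(big_geq_mkord _ _ xpredT (fun k => xp k w - xp k.+1 w)).
  have -> : \sum_(t <= i < T.+1) (xp i w - xp i.+1 w) =
      - \sum_(t <= i < T.+1) (xp i.+1 w - xp i w).
    by rewrite -sumrN; apply: eq_bigr => i _; rewrite opprB.
  by rewrite (telescope_sumr (fun k => xp k w)) 1?ltnW// xpT sub0r opprK.
have ae_pos : {ae P, forall w, forall t, 0 < N t w /\ 0 < Xp t w}.
  have aeM : {ae P, forall w, forall t : 'I_T.+1, (t < T)%N -> 0 < M t w}.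
    apply: filter_forall => t; have [tT|tT] := boolP (t < T)%N.
      by apply: filterS (M_pos t tT).
    by apply: aeW.
  apply: filterS2 Z1_last aeM => w ZT Mw.
  have Npos t : 0 < N t w.
    have [tT|] := ltnP t T; first by rewrite ltr_pwDr// Mw.
    move=> tT; have -> : t = ord_max.
      by apply/val_inj/eqP; rewrite eqn_leq tT -ltnS ltn_ord.
    by rewrite ltr_pwDl.
  move=> t; split => //; rewrite /Xp.
  have : (t <= T)%N by rewrite -ltnS.
  elim: (nat_of_ord t) => //= k IH kT; rewrite mulr_gt0 ?IH// 1?ltnW//.
  by rewrite divr_gt0// Mw// inordK// ltnW.
pose D t w := N t w / Xp t w.
have D_ge0 t w : 0 <= D t w by apply: divr_ge0; [exact: N_ge0|exact: xp_ge0].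
have wD t : measurable_wrt (F t) (D t).
  by apply: measurable_funM; [exact: wN|exact: (measurable_fun_invr (wXp t) (xp_ge0 _))].
have mD t : measurable_fun setT (D t) by exact: wrtM.
(* Write u = t + 1. Since X+_u is F_t-measurable, g D_u is the F_t-measurable h = g / X+_u times
   N_u. Integrating, N_u may be replaced by M_t, and M_t / X+_u = N_t / X+_t = D_t by the recursion
   for X+. *)
have martingale n (t : 'I_T.+1) (g : Omega -> R) : (t + n = T)%N ->
    measurable_wrt (F t) g -> (forall w, 0 <= g w) ->
    (\int[P]_w (g w * D ord_max w)%:E = \int[P]_w (g w * D t w)%:E)%E.
  elim: n t g => [|n IH] t g tn wg g0.
    by have -> : t = ord_max by apply/val_inj => /=; move: tn; rewrite addn0.
  have tT : (t.+1 <= T)%N by move: (leq_addr n t.+1); rewrite addSnnS tn.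
  pose u : 'I_T.+1 := inord t.+1.
  have uE : u = t.+1 :> nat by rewrite inordK.
  have tu : (t <= u)%N by rewrite uE.
  rewrite (IH u)//; [|by rewrite uE addSnnS|exact: measurable_wrt_le wg].
  pose h w := g w / xp t.+1 w.
  have h0 w : 0 <= h w by rewrite divr_ge0.
  have wxpt : measurable_wrt (F t) (xp t.+1) by exact: wxp.
  have wh : measurable_wrt (F t) h.
    by apply: measurable_funM => //; exact: (measurable_fun_invr wxpt (xp_ge0 _)).
  have mS (p : pred 'I_T.+1) : measurable_fun setT (fun w => \sum_(s | p s) Z1 s w).
    exact: measurable_sum_cond.
  have S0 (p : pred 'I_T.+1) w : 0 <= \sum_(s | p s) Z1 s w by exact: sumr_ge0.
  have FT s : F s setT.
    by rewrite -(measurable_g_measurableTypeE (sF s)); exact: measurableT.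
  transitivity (\int[P]_w (h w * N u w)%:E)%E.
    by apply: eq_integral => w _; rewrite /h /D /Xp uE; congr EFin; ring.
  rewrite (ge0_eq_integral_weightr (sF u) (@FM u) (mN u) (mS (fun s => u <= s)%N)
    (N_ge0 u) (S0 _) (NE u) (FT u) (measurable_wrt_le tu wh) h0).
  transitivity (\int[P]_w (h w * M t w)%:E)%E.
    apply/esym/(ge0_eq_integral_weightr (sF t) (@FM t)) => // A FA.
    rewrite ME//; apply: eq_integral => w _; congr EFin.
    by apply: eq_bigl => s; rewrite uE.
  apply: ae_eq_integral => //.
  - by apply/measurable_EFinP/measurable_funM => //; exact: wrtM wh.
  - by apply/measurable_EFinP/measurable_funM => //; exact: wrtM wg.
  apply: filterS2 ae_pos (M_pos t tT) => w pos Mpos _; congr EFin.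
  have [Nt Xt] := pos t; move: Xt; rewrite /Xp => Xt.
  rewrite /h /D /Xp xpS /ratio; field.
  by rewrite !gt_eqF.
have D1 : (\int[P]_w (D ord_max w)%:E = 1)%E.
  have FT0 : F ord0 setT.
    by rewrite -(measurable_g_measurableTypeE (sF ord0)); exact: measurableT.
  transitivity (\int[P]_w (1 * D ord_max w)%:E)%E.
    by apply: eq_integral => w _; rewrite mul1r.
  rewrite (martingale T ord0 (cst 1))//.
  transitivity (\int[P]_w (N ord0 w)%:E)%E.
    by apply: eq_integral => w _; rewrite /D /Xp /= invr1 mul1r mulr1.
  rewrite (NE ord0 setT FT0) -[RHS]Z1_normalized.
  by apply: eq_integral => w _.
have [Q QE] := density_probability (mD ord_max) (D_ge0 ord_max) D1.
exists X, Xp, N, Q; split.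
- by move=> t; split; [exact: wX|exact: wXp].
- by split => t w; [exact: X_ge0|exact: xp_ge0].
- by split.
- split; apply/null_content_dominatesP => A mA.
  + by move=> PA; rewrite QE//; apply: null_set_integral => //; apply/measurable_EFinP/measurable_funTS.
  + move=> Q0.
    have QA : (\int[P]_(w in A) (D ord_max w)%:E = 0)%E.
      by rewrite -(QE _ mA); exact: Q0.
    apply: ae_gt0_integral_eq0 mA (mD ord_max) (D_ge0 _) _ QA.
    by apply: filterS ae_pos => w pos _; have [? ?] := pos ord_max; rewrite divr_gt0.
split => //.
move=> t g A wg g0 FA.
have mA := FM FA.
have mg : measurable_fun setT g by exact: wrtM wg.
have mX : measurable_fun setT (X t) by exact: wrtM (wX t).
(* Q has density D_T; on F_t-measurable integrands the martingale property reduces it to D_t. *)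
have QP (h : Omega -> R) : measurable_wrt (F t) h -> (forall w, 0 <= h w) ->
   (\int[Q]_(w in A) (h w)%:E = \int[P]_(w in A) (h w * D t w)%:E)%E.
  move=> wh h0; have mh : measurable_fun setT h by exact: wrtM wh.
  have sM : sigma_algebra setT (measurable : set (set Omega)).
    by split; [exact: measurable0|move=> B mB; rewrite setTD; exact: measurableC
      |exact: bigcupT_measurable].
  transitivity (\int[Q]_(w in A) (h w * 1)%:E)%E.
    by apply: eq_integral => w _; rewrite mulr1.
  have whM : measurable_wrt (measurable : set (set Omega)) h.
    move=> _ B mB; rewrite setTI; apply: sub_sigma_algebra.
    by rewrite -[X in measurable X]setTI; exact: mh.
  have oneD B : measurable B ->
      (\int[Q]_(w in B) 1%:E = \int[P]_(w in B) (D ord_max w)%:E)%E.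
    move=> mB; rewrite -[LHS]/(\int[Q]_(w in B) (cst 1%:E w))%E.
    by rewrite integral_cst// mul1e; exact: QE.
  rewrite (ge0_eq_integral_weightr sM (@subset_refl _ _) (f := fun=> 1)
    (measurable_cst _) (mD ord_max) (fun=> ler01) (D_ge0 ord_max) oneD mA whM h0).
  pose hA w := h w * \1_A w.
  have whA : measurable_wrt (F t) hA.
    apply: measurable_funM => //; apply: measurable_indic.
    exact: measurable_sigma_subalgebra.
  have hA0 w : 0 <= hA w by rewrite mulr_ge0.
  have restr (k : Omega -> R) : (\int[P]_(w in A) (h w * k w)%:E
      = \int[P]_w (hA w * k w)%:E)%E.
    rewrite integral_mkcond; apply: eq_integral => w _.
    by rewrite patchE /hA indicE; case: ifP => _; rewrite ?mulr1 ?mulr0 ?mul0r.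
  by rewrite !restr (martingale (T - t)%N t hA)// subnKC// -ltnS.
split; last exact: QP.
rewrite QP; last 2 first.
- by apply: measurable_funM => //; exact: wX.
- by move=> w; apply: mulr_ge0; [exact: g0|exact: X_ge0].
apply: ae_eq_integral => //.
- by apply/measurable_EFinP/measurable_funTS/measurable_funM => //; exact: measurable_funM.
- by apply/measurable_EFinP/measurable_funTS/measurable_funM.
(* X_t D_t = X+_t (1 - M_t / N_t) N_t / X+_t = N_t - M_t = Z1_t. *)
apply: filterS ae_pos => w pos _; congr EFin.
have [Nt Xt] := pos t; rewrite /X xpS /D /ratio; move: Nt Xt; rewrite /Xp /N => Nt Xt.
by field; rewrite !gt_eqF.
Qed.

Theorem dual_pair_realization (theta : process T Omega (R * R)%type) :
  L0_adapted P F setT theta ->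
  (forall t, P.-integrable setT (fun w => (Z1 t w * (theta t w).1)%:E) /\
             P.-integrable setT (fun w => (Z2 t w * (theta t w).2)%:E)) ->
  exists (X chi : process T Omega R) (Q : probability Omega R),
    [/\ randomized_stopping_times P F X,
        price_systems P F mu lambda S2 X (chi, Q) &
        ('E_Q[(fun w => \sum_(t < T.+1)
          X t w * ((theta t w).1 + chi t w * (theta t w).2 * S2 t w))%R] =
         \int[P]_w (\sum_(t < T.+1)
          (Z1 t w * (theta t w).1 + Z2 t w * (theta t w).2))%:E)%E].
Proof.
move=> atheta itheta.
have [X [Xp [N [Q [wXXp [X_ge0 Xp_ge0] [XpE Xp0] [QP PQ] [wN N_ge0 ae_pos NE QZ]]]]]]
  := exists_randomized_stopping.
have wX t : measurable_wrt (F t) (X t) := (wXXp t).1.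
have wXp t : measurable_wrt (F t) (Xp t) := (wXXp t).2.
have [_ _ _ cone bidask] := dZ.
case/andP: (mu01) => mu0 mu1; case/andP: (lambda01) => la0 la1.
have FT t : F t setT.
  by rewrite -(measurable_g_measurableTypeE (sF t)); exact: measurableT.
pose S t w := Num.max (S2 t w) 0.
have S_ge0 t w : 0 <= S t w by exact: m0.
have wS t : measurable_wrt (F t) (S t).
  by apply: measurable_maxr => //; case: (S2_adapted_pos t).
(* Clipping makes the bounds hold everywhere. It changes nothing where Z1_t > 0, up to a null set;
   where Z1_t = 0 the cone condition forces Z2_t = 0, so [chi * S * Z1 = Z2] holds for any value of
   chi. *)
pose chi t w := Num.max (1 - mu) (Num.min (1 + lambda) (Z2 t w / (Z1 t w * S t w))).
have chi_bounds t w : 1 - mu <= chi t w <= 1 + lambda.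
  by rewrite /chi le_max lexx ge_max ge_min lexx /=; lra.
have chi_ge0 t w : 0 <= chi t w by have /andP[+ _] := chi_bounds t w; lra.
have wchi t : measurable_wrt (F t) (chi t).
  have wZS : measurable_wrt (F t) (fun w => Z1 t w * S t w).
    by apply: measurable_funM; [exact: wZ1|exact: wS].
  apply: measurable_maxr => //; apply: measurable_minr => //.
  apply: measurable_funM; first exact: wZ2.
  by apply: (measurable_fun_invr wZS) => w; rewrite mulr_ge0.
have aeS : {ae P, forall w, forall t, 0 < S2 t w}.
  by apply: filter_forall => t; case: (S2_adapted_pos t).
have aecone : {ae P, forall w, forall t, S2 t w * (1 - mu) * Z1 t w <= Z2 t w
                       <= S2 t w * (1 + lambda) * Z1 t w}.
  by apply: filter_forall => t; exact: cone.
have aechi : {ae P, forall w, forall t, S t w = S2 t w /\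
    chi t w * S t w * Z1 t w = Z2 t w}.
  apply: filterS2 aeS aecone => w S0 Cw t.
  have SE : S t w = S2 t w by rewrite /S max_l// ltW.
  split => //; have /andP[c1 c2] := Cw t; have s0 := S0 t.
  have [Z0|Zn0] := eqVneq (Z1 t w) 0.
    rewrite Z0 mulr0; apply/eqP; rewrite eq_le Z2_ge0 /=.
    by move: c2; rewrite Z0 mulr0.
  have Zp : 0 < Z1 t w by rewrite lt0r Zn0 Z1_ge0.
  have ZS : 0 < Z1 t w * S2 t w by rewrite mulr_gt0.
  rewrite /chi SE min_r; last first.
    by rewrite ler_pdivrMr//; apply: le_trans c2 _; rewrite le_eqVlt; apply/orP; left; apply/eqP; ring.
  rewrite max_r; last first.
    by rewrite ler_pdivlMr//; apply: le_trans c1; rewrite le_eqVlt; apply/orP; left; apply/eqP; ring.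
  by field; rewrite Zn0 gt_eqF.
exists X, chi, Q; split.
- split; first by move=> t; split; [exact: wX|apply: aeW => w; exact: X_ge0].
  apply: aeW => w; rewrite -(Xp0 w) -XpE.
  by apply: eq_bigl => s.
- split => //.
    by move=> t; split; [exact: wchi|apply: aeW => w; exact: chi_bounds].
  move=> t.
  have mS2 : measurable_fun setT (fun w => \sum_(s < T.+1 | (t <= s)%N) Z2 s w).
    exact: measurable_sum_cond.
  have S20 w : 0 <= \sum_(s < T.+1 | (t <= s)%N) Z2 s w by exact: sumr_ge0.
  have S2fin : (\int[P]_w (\sum_(s < T.+1 | (t <= s)%N) Z2 s w)%:E < +oo)%E.
    exact: integral_sum_lty.
  have [N2 [wN2 N2_ge0 N2E]] := ge0_cond_expectation_exists (sF t) (@FM t) mS2 S20 S2fin.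
  (* Bayes' rule: the conditional expectation under Q is N2_t / D_t, and 1 / D_t = X+_t / N_t. *)
  pose Y w := N2 w * (Xp t w / N t w).
  have Y_ge0 w : 0 <= Y w by rewrite mulr_ge0// divr_ge0.
  have wY : measurable_wrt (F t) Y.
    apply: measurable_funM => //; apply: measurable_funM; first exact: wXp.
    exact: (measurable_fun_invr (wN t) (N_ge0 t)).
  exists (EFin \o Y), (EFin \o Xp t); split.
  + split; first exact/measurable_EFinP.
    move=> A FA; have mA := FM FA.
    rewrite (QZ t Y A wY Y_ge0 FA).2.
    transitivity (\int[P]_(w in A) (N2 w)%:E)%E.
      apply: ae_eq_integral => //.
      * apply/measurable_EFinP/measurable_funTS.
        apply: measurable_funM; first exact: wrtM wY.
        apply: measurable_funM; first exact: wrtM.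
        by apply: measurable_fun_invr => //; exact: wrtM.
      * by apply/measurable_EFinP/measurable_funTS; exact: wrtM wN2.
      * apply: filterS ae_pos => w pos _; congr EFin.
        by have [? ?] := pos t; rewrite /Y; field; rewrite !gt_eqF.
    rewrite N2E// ge0_integral_sumr//.
    transitivity (\int[Q]_(w in A)
       (\sum_(s < T.+1 | (t <= s)%N) chi s w * S s w * X s w)%:E)%E.
      rewrite ge0_integral_sumr//.
      * apply: eq_bigr => s ts.
        rewrite (QZ s (fun w => chi s w * S s w) A _ _ (FF ts FA)).1//.
        - apply: ae_eq_integral => //.
          + exact/measurable_EFinP/measurable_funTS.
          + apply/measurable_EFinP/measurable_funTS/measurable_funM => //.
            by apply: measurable_funM; exact: wrtM.
          + by apply: filterS aechi => w h _; have [_ ->] := h s.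
        - by apply: measurable_funM; [exact: wchi|exact: wS].
        - by move=> w; rewrite mulr_ge0.
      * move=> s; apply: measurable_funM; last exact: wrtM.
        by apply: measurable_funM; exact: wrtM.
      * by move=> s w; rewrite !mulr_ge0.
    apply: ae_eq_integral => //.
    * apply/measurable_EFinP/measurable_funTS/measurable_sum_cond => s.
      apply: measurable_funM; last exact: wrtM.
      by apply: measurable_funM; exact: wrtM.
    * apply/measurable_EFinP/measurable_funTS/measurable_sum_cond => s.
      apply: measurable_funM; last by apply: (@wrtM s); case: (S2_adapted_pos s).
      by apply: measurable_funM; exact: wrtM.
    * apply: filterS (dominated_ae QP aechi) => w h _; congr EFin.
      by apply: eq_bigr => s _; have [-> _] := h s; ring.
  + split; first by apply/measurable_EFinP; exact: wXp.
    by move=> A FA; apply: eq_integral => w _; rewrite XpE.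
  (* The bounds are first obtained for N2_t against N_t, where every integral is under P, and then
     multiplied by X+_t / N_t. *)
  + have weight c : 0 <= c -> forall A, F t A ->
       (\int[P]_(w in A) (S t w * c * N t w)%:E =
        \int[P]_(w in A) (S t w * c * \sum_(s < T.+1 | (t <= s)%N) Z1 s w)%:E)%E.
      move=> c0 A FA; apply: (ge0_eq_integral_weightr (sF t) (@FM t)) => //.
      * exact: wrtM.
      * exact: measurable_sum_cond.
      * by move=> w; exact: sumr_ge0.
      * by move=> B FB; exact: NE.
      * by apply: measurable_funM => //; exact: wS.
      * by move=> w; rewrite mulr_ge0.
    have wSN c : measurable_wrt (F t) (fun w => S t w * c * N t w).
      apply: measurable_funM; last exact: wN.
      by apply: measurable_funM => //; exact: wS.
    have N2fin : (\int[P]_w (N2 w)%:E < +oo)%E by rewrite (N2E _ (FT t)).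
    have wle c : 0 <= c -> forall w, 0 <= S t w * c * N t w.
      by move=> c0 w; rewrite !mulr_ge0.
    have low : {ae P, forall w, S t w * (1 - mu) * N t w <= N2 w}.
      have lowA A : F t A -> (\int[P]_(w in A) (S t w * (1 - mu) * N t w)%:E
          <= \int[P]_(w in A) (N2 w)%:E)%E.
        move=> FA; rewrite weight//; last by lra.
        by rewrite N2E//; case: (bidask t A FA).
      apply: (ae_le_of_integrals (sF t) (@FM t)) => //.
      * by apply: wle; lra.
      * exact: le_lt_trans (lowA _ (FT t)) N2fin.
    have high : {ae P, forall w, N2 w <= S t w * (1 + lambda) * N t w}.
      apply: (ae_le_of_integrals (sF t) (@FM t)) => //.
      * by apply: wle; lra.
      * move=> A FA; rewrite weight//; last by lra.
        by rewrite N2E//; case: (bidask t A FA).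
    apply: filterS3 (filterI low high) ae_pos aechi => w [lo hi] pos h.
    have [SE _] := h t; have [Nt Xt] := pos t.
    have r0 : 0 <= Xp t w / N t w by rewrite divr_ge0.
    have rE k : S t w * k * N t w * (Xp t w / N t w) = S t w * k * Xp t w.
      by field; rewrite gt_eqF.
    rewrite /= -!EFinM !lee_fin /Y -SE; split.
      by rewrite -rE; apply: ler_wpM2r.
    by rewrite [leRHS]mulrC -rE; apply: ler_wpM2r.
(* The transfer from Q to P is known for nonnegative weights, while theta is signed. Integrability
   of Z1_t h lets h be split into positive and negative parts. *)
have EQ t (h : Omega -> R) : measurable_wrt (F t) h ->
    P.-integrable setT (fun w => (Z1 t w * h w)%:E) ->
    Q.-integrable setT (fun w => (X t w * h w)%:E) /\
    (\int[Q]_w (X t w * h w)%:E = \int[P]_w (Z1 t w * h w)%:E)%E.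
  move=> wh ih; have mh := wrtM wh; have mX : measurable_fun setT (X t) := wrtM (wX t).
  pose hp w := Num.max (h w) 0; pose hm w := Num.max (- h w) 0.
  have hp0 w : 0 <= hp w by exact: m0.
  have hm0 w : 0 <= hm w by exact: m0.
  have hE w : h w = hp w - hm w.
    by rewrite /hp /hm; case: (leP (h w) 0) => ?; case: (leP (- h w) 0) => ?; lra.
  have hN w : `|h w| = hp w + hm w.
    rewrite /hp /hm; have [h0|/ltW h0] := leP 0 (h w).
      have nh : - h w <= 0 by rewrite oppr_le0.
      by rewrite ger0_norm// ?(max_l h0) ?(max_r nh) addr0.
    have nh : 0 <= - h w by rewrite oppr_ge0.
    by rewrite ler0_norm// ?(max_r h0) ?(max_l nh) add0r.
  have hp_le w : hp w <= `|h w| by rewrite hN lerDl.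
  have hm_le w : hm w <= `|h w| by rewrite hN lerDr.
  have whp : measurable_wrt (F t) hp by exact: measurable_maxr.
  have whm : measurable_wrt (F t) hm.
    by apply: measurable_maxr => //; exact: measurable_funN.
  have part (k : Omega -> R) : measurable_wrt (F t) k -> (forall w, 0 <= k w) ->
      (forall w, k w <= `|h w|) ->
      [/\ P.-integrable setT (EFin \o (fun w => Z1 t w * k w)),
      Q.-integrable setT (EFin \o (fun w => X t w * k w)) &
      (\int[Q]_w (X t w * k w)%:E = \int[P]_w (Z1 t w * k w)%:E)%E].
    move=> wk k0 kh; have mk := wrtM wk.
    have iP : P.-integrable setT (EFin \o (fun w => Z1 t w * k w)).
      apply: le_integrable ih => //.
      - by apply/measurable_EFinP; exact: measurable_funM.
      - move=> w _ /=; rewrite lee_fin !normrM; apply: ler_wpM2l => //.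
        by rewrite (ger0_norm (k0 w)).
    have eQP : (\int[Q]_w (X t w * k w)%:E = \int[P]_w (Z1 t w * k w)%:E)%E.
      under eq_integral do rewrite mulrC.
      under [RHS]eq_integral do rewrite mulrC.
      exact: (QZ t k setT wk k0 (FT t)).1.
    split => //; apply: ge0_integrabler.
    - exact: measurable_funM.
    - by move=> w; rewrite mulr_ge0.
    - by rewrite eQP; exact: integrable_lty.
  have [pP pQ pE] := part hp whp hp0 hp_le.
  have [nP nQ nE] := part hm whm hm0 hm_le.
  have XE : (fun w => (X t w * h w)%:E) =
      ((EFin \o (fun w => (X t w * hp w)%R)) \- (EFin \o (fun w => (X t w * hm w)%R)))%E.
    by apply/funext => w /=; rewrite hE mulrBr EFinB.
  have ZE : (fun w => (Z1 t w * h w)%:E) =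
      ((EFin \o (fun w => (Z1 t w * hp w)%R)) \- (EFin \o (fun w => (Z1 t w * hm w)%R)))%E.
    by apply/funext => w /=; rewrite hE mulrBr EFinB.
  rewrite XE ZE; split; first exact: integrableB.
  by rewrite !integralB//= pE nE.
have wth1 t : measurable_wrt (F t) (fun w => (theta t w).1).
  by apply: (measurableT_comp measurable_fst); case: (atheta t).
have wth2 t : measurable_wrt (F t) (fun w => (theta t w).2).
  by apply: (measurableT_comp measurable_snd); case: (atheta t).
pose h t w := (theta t w).1 + chi t w * S t w * (theta t w).2.
have wh t : measurable_wrt (F t) (h t).
  apply: measurable_funD; first exact: wth1.
  apply: measurable_funM; last exact: wth2.
  by apply: measurable_funM; [exact: wchi|exact: wS].
have Zh t : {ae P, forall w, Z1 t w * h t w =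
    Z1 t w * (theta t w).1 + Z2 t w * (theta t w).2}.
  by apply: filterS aechi => w cw; rewrite /h; have [_ <-] := cw t; ring.
have mZth t : measurable_fun setT (fun w => Z1 t w * (theta t w).1 + Z2 t w * (theta t w).2).
  apply: measurable_funD; apply: measurable_funM; [exact: mZ1|exact: wrtM (wth1 t)
    |exact: mZ2|exact: wrtM (wth2 t)].
have mZh t : measurable_fun setT (fun w => Z1 t w * h t w).
  by apply: measurable_funM; [exact: mZ1|exact: wrtM (wh t)].
have iZth t : P.-integrable setT
    (fun w => (Z1 t w * (theta t w).1 + Z2 t w * (theta t w).2)%:E).
  by have [i1 i2] := itheta t; exact: (integrableD measurableT i1 i2).
have iZh t : P.-integrable setT (fun w => (Z1 t w * h t w)%:E).
  apply/integrableP; split; first exact/measurable_EFinP.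
  have /integrableP[_] := iZth t; congr (_ < _)%E.
  apply: ae_eq_integral => //.
  - by apply: measurableT_comp => //; exact/measurable_EFinP.
  - by apply: measurableT_comp => //; exact/measurable_EFinP.
  - by apply: filterS (Zh t) => w -> _.
rewrite unlock.
transitivity (\int[Q]_w (\sum_(t < T.+1) (X t w * h t w)%:E))%E.
  apply: ae_eq_integral => //.
  - apply/measurable_EFinP/measurable_sum => t.
    apply: measurable_funM; first exact: wrtM.
    apply: measurable_funD; first exact: wrtM (wth1 t).
    apply: measurable_funM; last by apply: (@wrtM t); case: (S2_adapted_pos t).
    by apply: measurable_funM; [exact: wrtM|exact: wrtM (wth2 t)].
  - apply: emeasurable_sum => t; apply/measurable_EFinP.
    by apply: measurable_funM; [exact: wrtM|exact: wrtM (wh t)].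
  - apply: filterS (dominated_ae QP aechi) => w cw _.
    rewrite sumEFin; congr EFin; apply: eq_bigr => t _.
    by have [SE _] := cw t; rewrite /h SE; ring.
rewrite integral_sum//; last first.
  by move=> t; have [iq _] := EQ t _ (wh t) (iZh t); exact: iq.
transitivity (\int[P]_w (\sum_(t < T.+1)
   (Z1 t w * (theta t w).1 + Z2 t w * (theta t w).2)%:E))%E; last first.
  by apply: eq_integral => w _; rewrite sumEFin.
rewrite integral_sum//; apply: eq_bigr => t _.
have [_ ->] := EQ t _ (wh t) (iZh t).
apply: ae_eq_integral => //; [exact/measurable_EFinP|exact/measurable_EFinP|].
by apply: filterS (Zh t) => w -> _.
Qed.

End DualRealization.

(** * Superhedgeable processes *)

(** Dominated convergence for the indicators of the exceedance sets. This brings the closedness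
    hypothesis to the a.s. limits produced by the projection argument. *)
Lemma ae_cvg0_in_measure (d : measure_display) (Omega : measurableType d)
    (R : realType) (P : probability Omega R) (g : nat -> Omega -> R) (e : R) :
  (forall n, measurable_fun setT (g n)) ->
  {ae P, forall w, g n w @[n --> \oo] --> 0} -> 0 < e ->
  P [set w | e < g n w] @[n --> \oo] --> 0%E.
Proof.
move=> mg g0 e0.
pose A n := [set w | e < g n w].
have mA n : measurable (A n).
  rewrite (_ : A n = g n @^-1` `]e, +oo[%classic); last first.
    by apply/seteqP; split => w /=; rewrite in_itv /= andbT.
  by rewrite -[X in measurable X]setTI; apply: mg => //; exact: measurable_itv.
have [|||||_ _] := @dominated_convergence _ _ _ P setT measurableT
    (fun n w => (\1_(A n) w)%:E) (cst 0%E) (cst 1%E).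
- by move=> n; apply/measurable_EFinP; exact: measurable_indic.
- exact: measurable_cst.
- apply: filterS g0 => w gw _; apply: cvg_near_cst.
  have := gw; move/cvgr0Pnorm_lt => /(_ e e0).
  apply: filterS => n gn; rewrite indicE memNset// /A /= => eg.
  by move: gn; rewrite ltNge => /negP; apply; rewrite (le_trans (ltW eg))// ler_norm.
- exact: finite_measure_integrable_cst.
- by apply: aeW => w n _; rewrite /= lee_fin ger0_norm// indicE; case: (_ \in _).
rewrite integral0 => cv0; rewrite (_ : (fun n => P [set w | e < g n w]) =
  [sequence (\int[P]_w (\1_(A n) w)%:E)%E]_n)//.
by apply/funext => n /=; rewrite integral_indic// setIT.
Qed.

Lemma measurable_enorm (d : measure_display) (Omega : measurableType d)
    (R : realType) (f : Omega -> (R * R)%type) :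
  measurable_fun setT (fun w => (f w).1) ->
  measurable_fun setT (fun w => (f w).2) ->
  measurable_fun setT (fun w => enorm (f w)).
Proof.
move=> m1 m2; apply: (@measurableT_comp _ _ _ _ _ _ (@Num.sqrt R)).
  by apply: continuous_measurable_fun; exact: sqrt_continuous.
by apply: measurable_funD; exact: measurable_funX.
Qed.

Lemma enorm_le (R : realType) (x : R * R) : enorm x <= `|x.1| + `|x.2|.
Proof.
rewrite -(ger0_norm (addr_ge0 (normr_ge0 x.1) (normr_ge0 x.2))) -sqrtr_sqr.
apply: ler_wsqrtr; rewrite sqrrD !real_normK ?num_real// addrAC lerDl.
by rewrite mulrn_wge0// mulr_ge0.
Qed.

Section SuperhedgeableSets.
Context (d : measure_display) (Omega : measurableType d) (R : realType).
Variables (P : probability Omega R) (T : nat).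
Variable F : 'I_T.+1 -> set (set Omega).
Hypothesis Ffiltration : is_filtration F.
Variables (mu lambda : R) (S2 : process T Omega R).
Hypotheses (mu01 : 0 < mu < 1) (lambda01 : 0 < lambda < 1).
Hypothesis S2_adapted_pos : L0_adapted P F [set r : R | 0 < r] S2.

Let sF t : sigma_algebra setT (F t). Proof. by case: Ffiltration. Qed.
Let FM t : F t `<=` measurable. Proof. by case: Ffiltration. Qed.

Local Notation K := (bid_ask_cone mu lambda S2).
Local Notation As := (superhedgeable P F K (0, 0)).

Let ml : - mu <= lambda.
Proof. by case/andP: mu01; case/andP: lambda01; lra. Qed.

Lemma bid_ask_coneD t w (y z : R * R) : 0 <= S2 t w ->
  K t w y -> K t w z -> K t w (y + z).
Proof.
move=> S0 /(bid_ask_coneP _ ml S0)[y1 y2] /(bid_ask_coneP _ ml S0)[z1 z2].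
by apply/(bid_ask_coneP _ ml S0); rewrite /= !mulrDr; split; lra.
Qed.

Lemma bid_ask_coneZ t w c (y : R * R) : 0 <= S2 t w -> 0 <= c ->
  K t w y -> K t w (c * y.1, c * y.2).
Proof.
move=> S0 c0 /(bid_ask_coneP _ ml S0)[y1 y2].
apply/(bid_ask_coneP _ ml S0); rewrite /=.
have := mulr_ge0 c0 y1; have := mulr_ge0 c0 y2; rewrite !mulrDr.
by split; lra.
Qed.

Let aeS t : {ae P, forall w, 0 <= S2 t w}.
Proof. by have [_] := S2_adapted_pos t; apply: filterS => w /ltW. Qed.

Lemma L0_adapted_pair (v1 v2 : process T Omega R) :
  (forall t, measurable_wrt (F t) (v1 t)) ->
  (forall t, measurable_wrt (F t) (v2 t)) ->
  L0_adapted P F setT (fun t w => (v1 t w, v2 t w)).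
Proof.
move=> m1 m2 t; split; last exact: aeW.
by apply: measurable_fun_pair; [exact: m1|exact: m2].
Qed.

Lemma L0_adapted_fst (v : process T Omega (R * R)%type) t :
  L0_adapted P F setT v -> measurable_wrt (F t) (fun w => (v t w).1).
Proof. by move=> /(_ t)[mv _]; exact: (measurableT_comp measurable_fst). Qed.

Lemma L0_adapted_snd (v : process T Omega (R * R)%type) t :
  L0_adapted P F setT v -> measurable_wrt (F t) (fun w => (v t w).2).
Proof. by move=> /(_ t)[mv _]; exact: (measurableT_comp measurable_snd). Qed.

Lemma portfolioD (x y : R * R) (xi eta : process T Omega (R * R)%type) t w :
  portfolio (x + y) (fun t w => xi t w + eta t w) t w =
  portfolio x xi t w + portfolio y eta t w.
Proof. by rewrite /portfolio big_split /= addrACA. Qed.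

Lemma superhedgeableD (u v : process T Omega (R * R)%type) :
  As u -> As v -> As (fun t w => u t w + v t w).
Proof.
move=> [au [_ [xi [axi xiK] <-] uK]] [av [_ [eta [aeta etaK] <-] vK]].
split.
  apply: L0_adapted_pair => t; apply: measurable_funD.
  - exact: L0_adapted_fst au.
  - exact: L0_adapted_fst av.
  - exact: L0_adapted_snd au.
  - exact: L0_adapted_snd av.
exists (portfolio (0, 0) (fun t w => xi t w + eta t w)).
  exists (fun t w => xi t w + eta t w) => //; split.
    apply: L0_adapted_pair => t; apply: measurable_funD.
    - exact: L0_adapted_fst axi.
    - exact: L0_adapted_fst aeta.
    - exact: L0_adapted_snd axi.
    - exact: L0_adapted_snd aeta.
  move=> t; apply: filterS3 (aeS t) (xiK t) (etaK t) => w S0 k1 k2.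
  by rewrite opprD; exact: bid_ask_coneD.
move=> t; apply: filterS3 (aeS t) (uK t) (vK t) => w S0 k1 k2.
have := portfolioD 0 0 xi eta t w; rewrite addr0 => e.
rewrite -[portfolio (0, 0) _ t w]/(portfolio 0 _ t w) e opprD addrACA.
exact: bid_ask_coneD.
Qed.

Lemma superhedgeableZ c (u : process T Omega (R * R)%type) : 0 <= c ->
  As u -> As (fun t w => (c * (u t w).1, c * (u t w).2)).
Proof.
move=> c0 [au [_ [xi [axi xiK] <-] uK]].
split.
  apply: L0_adapted_pair => t; apply: measurable_funM => //.
  - exact: L0_adapted_fst au.
  - exact: L0_adapted_snd au.
exists (portfolio (0, 0) (fun t w => (c * (xi t w).1, c * (xi t w).2))).
  exists (fun t w => (c * (xi t w).1, c * (xi t w).2)) => //; split.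
    apply: L0_adapted_pair => t; apply: measurable_funM => //.
    - exact: L0_adapted_fst axi.
    - exact: L0_adapted_snd axi.
  move=> t; apply: filterS2 (aeS t) (xiK t) => w S0 k1.
  have := bid_ask_coneZ S0 c0 k1.
  by congr (K t w _); rewrite /= !mulrN.
move=> t; apply: filterS2 (aeS t) (uK t) => w S0 k1.
have := bid_ask_coneZ S0 c0 k1; congr (K t w _).
have p1 (xi' : process T Omega (R * R)%type) :
    (portfolio (0, 0) xi' t w).1 = \sum_(s < T.+1 | (s <= t)%N) (xi' s w).1.
  rewrite /portfolio /= add0r.
  exact: (big_morph (fun y : R * R => y.1) (fun y z => erefl) erefl).
have p2 (xi' : process T Omega (R * R)%type) :
    (portfolio (0, 0) xi' t w).2 = \sum_(s < T.+1 | (s <= t)%N) (xi' s w).2.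
  rewrite /portfolio /= add0r.
  exact: (big_morph (fun y : R * R => y.2) (fun y z => erefl) erefl).
apply/pair_equal_spec; split.
  rewrite -[LHS]/(c * ((portfolio (0, 0) xi t w).1 - (u t w).1)).
  rewrite -[RHS]/((portfolio (0, 0) _ t w).1 - c * (u t w).1).
  by rewrite !p1 mulrBr mulr_sumr.
rewrite -[LHS]/(c * ((portfolio (0, 0) xi t w).2 - (u t w).2)).
rewrite -[RHS]/((portfolio (0, 0) _ t w).2 - c * (u t w).2).
by rewrite !p2 mulrBr mulr_sumr.
Qed.

(** The zero strategy is the hedge. These are the test claims consumed at a single date. *)
Lemma superhedgeable_consumption (v : process T Omega (R * R)%type) :
  L0_adapted P F setT v -> (forall t, {ae P, forall w, K t w (- v t w)}) ->
  As v.
Proof.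
move=> av vK; split => //.
have p0 t w : portfolio (0, 0) (fun (t : 'I_T.+1) (w : Omega) => (0, 0) : R * R) t w = (0, 0).
  by rewrite /portfolio big1// addr0.
exists (portfolio (0, 0) (fun t w => (0, 0))).
  exists (fun t w => (0, 0)) => //; split.
    by apply: L0_adapted_pair => t; exact: measurable_cst.
  move=> t; apply: filterS (aeS t) => w S0.
  by apply/(bid_ask_coneP _ ml S0); rewrite /= oppr0 !mulr0 addr0.
by move=> t; apply: filterS (vK t) => w k1; rewrite p0 add0r.
Qed.

Lemma superhedgeable_portfolio (xi : process T Omega (R * R)%type) :
  admissible P F K xi -> As (portfolio (0, 0) xi).
Proof.
move=> [axi xiK]; split.
  have -> : portfolio (0, 0) xi = (fun t w =>
    (\sum_(s < T.+1 | (s <= t)%N) (xi s w).1, \sum_(s < T.+1 | (s <= t)%N) (xi s w).2)).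
    apply/funext => t; apply/funext => w; rewrite /portfolio.
    have -> : ((0, 0) : R * R) = 0 by [].
    rewrite add0r [LHS]surjective_pairing; congr pair.
      exact: (big_morph (fun y : R * R => y.1) (fun y z => erefl) erefl).
    exact: (big_morph (fun y : R * R => y.2) (fun y z => erefl) erefl).
  apply: L0_adapted_pair => t; under eq_fun do rewrite big_mkcond /=;
    apply: measurable_sum => s; case: (boolP (s <= t)%N) => // st.
  - by apply: (measurable_wrt_le Ffiltration st); exact: L0_adapted_fst axi.
  - by apply: (measurable_wrt_le Ffiltration st); exact: L0_adapted_snd axi.
exists (portfolio (0, 0) xi); first by exists xi.
move=> t; apply: filterS (aeS t) => w S0.
by apply/(bid_ask_coneP _ ml S0); rewrite /= !subrr !mulr0 addr0.
Qed.

(* Liquidating the surplus V_T - v_T at the terminal date turns a superhedge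
   of v into an exact terminal payoff. *)
Lemma terminal_attainable_superhedgeable (v : process T Omega (R * R)%type) :
  As v -> terminal_attainable P F K (0, 0) (v ord_max).
Proof.
move=> [av [_ [xi [axi xiK] <-] vK]].
pose V := portfolio (0, 0) xi.
have aV : L0_adapted P F setT V.
  by case: (@superhedgeable_portfolio xi (conj axi xiK)).
pose eta : process T Omega (R * R)%type := fun t w =>
  if t == ord_max then xi t w - (V t w - v t w) else xi t w.
exists (portfolio (0, 0) eta).
  exists eta => //; split.
    have -> : eta = fun t w => ((eta t w).1, (eta t w).2).
      by apply/funext => t; apply/funext => w; case: (eta t w).
    apply: L0_adapted_pair => t; rewrite /eta; case: (t == ord_max).
    - apply: measurable_funB; first exact: L0_adapted_fst axi.
      by apply: measurable_funB; [exact: L0_adapted_fst aV|exact: L0_adapted_fst av].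
    - exact: L0_adapted_fst axi.
    - apply: measurable_funB; first exact: L0_adapted_snd axi.
      by apply: measurable_funB; [exact: L0_adapted_snd aV|exact: L0_adapted_snd av].
    - exact: L0_adapted_snd axi.
  move=> t; rewrite /eta; case: eqP => [_|_]; last exact: xiK.
  apply: filterS3 (aeS t) (xiK t) (vK t) => w S0 k1 k2.
  by rewrite opprB addrC; exact: bid_ask_coneD.
apply/funext => w; rewrite /portfolio (bigD1 ord_max)//= /eta eqxx.
rewrite (eq_bigr (fun s => xi s w)); last by move=> s /andP[_ /negbTE ->].
rewrite /V /portfolio (bigD1 ord_max)//=.
move: (\sum_(_ < _ | _) _) (xi _ _) (v _ _) => z x y.
by rewrite [LHS]surjective_pairing [RHS]surjective_pairing; congr pair => /=; ring.
Qed.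

Hypothesis As_closed : closed_in_measure P F As.
Variable m : process T Omega R.
Hypothesis wm : forall t, measurable_wrt (F t) (m t).
Hypothesis m_ge1 : forall t w, 1 <= m t w.

Let m_gt0 t w : 0 < m t w. Proof. exact: lt_le_trans (m_ge1 t w). Qed.

Let wrtM t (f : Omega -> R) : measurable_wrt (F t) f -> measurable_fun setT f.
Proof. exact: (measurable_wrtW (sF t) (@FM t)). Qed.

(* Dividing by the weight m makes the claim to be separated square integrable. *)
Let unscale (u : 'I_T.+1 * bool -> Omega -> R) : process T Omega (R * R)%type :=
  fun t w => (m t w * u (t, false) w, m t w * u (t, true) w).

Let G (i : 'I_T.+1 * bool) := F i.1.

Let B := [set u | family_adapted G u /\ As (unscale u)].

(** The weight m is finite at every point, so multiplying by it preserves a.s. convergence, which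
    gives convergence in measure. *)
Let B_closed (u_ : nat -> 'I_T.+1 * bool -> Omega -> R) u :
  (forall n, B (u_ n)) -> family_adapted G u ->
  {ae P, forall w, forall i, u_ n i w @[n --> \oo] --> u i w} -> B u.
Proof.
move=> Bu au cu; split => //.
have wu t b : measurable_wrt (F t) (u (t, b)) := au (t, b).
have wun n t b : measurable_wrt (F t) (u_ n (t, b)) := (Bu n).1 (t, b).
have aun : L0_adapted P F setT (unscale u).
  by apply: L0_adapted_pair => t; apply: measurable_funM; [exact: wm|exact: wu|exact: wm|exact: wu].
apply: (As_closed (v := fun n => unscale (u_ n))) => //.
  by move=> n; case: (Bu n).
move=> e e0; apply: ae_cvg0_in_measure => //.
  move=> n; apply: measurable_sum => t.
  have mw : measurable_fun setT (m t) by apply: (wrtM (t := t)); exact: wm.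
  by apply: measurable_enorm; apply: measurable_funB; apply: measurable_funM => //;
    apply: (wrtM (t := t)); [exact: wun|exact: wu|exact: wun|exact: wu].
apply: filterS cu => w cw.
have c1 : (\sum_(t < T.+1) (m t w * `|u_ n (t, false) w - u (t, false) w|
    + m t w * `|u_ n (t, true) w - u (t, true) w|)) @[n --> \oo] -->
    \sum_(t < T.+1) (m t w * 0 + m t w * 0).
  have cc i : `|u_ n i w - u i w| @[n --> \oo] --> (0 : R).
    apply/norm_cvg0P; rewrite -(subrr (u i w)).
    by apply: cvgB; [exact: cw|exact: cvg_cst].
  apply: cvg_big => [|t _]; first exact: add_continuous.
  by apply: cvgD; apply: cvgM; [exact: cvg_cst|exact: cc|exact: cvg_cst|exact: cc].
have s0 : \sum_(t < T.+1) (m t w * 0 + m t w * 0) = 0 :> R.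
  by rewrite big1// => t _; rewrite mulr0 addr0.
rewrite s0 in c1.
apply: (@squeeze_cvgr _ _ _ _ (cst 0) _ _ _ _ _ c1).
  apply: nearW => n; apply/andP; split.
    by apply: sumr_ge0 => t _; exact: sqrtr_ge0.
  apply: ler_sum => t _; apply: le_trans (enorm_le _) _.
  by rewrite /unscale /= -!mulrBr !normrM !(gtr0_norm (m_gt0 t w)).
exact: cvg_cst.
Qed.

(** The index [bool] selects the asset. A process bounded by a multiple of m becomes bounded after
    division by m, hence square integrable; the separating family, divided by m once more, is the
    pair Z1, Z2. *)
Lemma superhedgeable_separation (q : process T Omega (R * R)%type) (C : R) :
  L0_adapted P F setT q ->
  (forall t w, `|(q t w).1| <= C * m t w /\ `|(q t w).2| <= C * m t w) ->
  ~ As q ->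
  exists Z1 Z2 : process T Omega R,
    [/\ forall t, measurable_wrt (F t) (Z1 t) /\ measurable_wrt (F t) (Z2 t),
        forall t, P.-integrable setT (fun w => (m t w * Z1 t w)%:E) /\
                  P.-integrable setT (fun w => (m t w * Z2 t w)%:E),
        forall v : process T Omega (R * R)%type, As v ->
          (exists D, forall t w, `|(v t w).1| <= D * m t w
                              /\ `|(v t w).2| <= D * m t w) ->
          (\int[P]_w (\sum_(t < T.+1)
             (Z1 t w * (v t w).1 + Z2 t w * (v t w).2))%:E <= 0)%E &
        (0 < \int[P]_w (\sum_(t < T.+1)
             (Z1 t w * (q t w).1 + Z2 t w * (q t w).2))%:E)%E].
Proof.
move=> aq qC nAs.
pose scale (v : process T Omega (R * R)%type) : 'I_T.+1 * bool -> Omega -> R :=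
  fun i w => (if i.2 then (v i.1 w).2 else (v i.1 w).1) / m i.1 w.
have sGG i : sigma_algebra setT (G i) by exact: sF.
have GMM i : G i `<=` measurable by exact: FM.
have unscaleK (v : process T Omega (R * R)%type) : unscale (scale v) = v.
  apply/funext => t; apply/funext => w; rewrite /unscale /scale /=.
  by rewrite ![m t w * _]mulrC !divfK ?gt_eqF// -surjective_pairing.
have wscale (v : process T Omega (R * R)%type) : L0_adapted P F setT v -> family_adapted G (scale v).
  move=> av [t b]; rewrite /scale /G /=; apply: measurable_funM.
    by case: b; [exact: L0_adapted_snd av|exact: L0_adapted_fst av].
  by apply: (measurable_fun_invr (@wm t)) => w; exact: ltW.
have scale_bound (v : process T Omega (R * R)%type) (D : R) : L0_adapted P F setT v ->
   (forall t w, `|(v t w).1| <= D * m t w /\ `|(v t w).2| <= D * m t w) ->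
   (\int[P]_w (dotp (scale v) (scale v) w)%:E < +oo)%E.
  move=> av vD.
  apply: (@le_lt_trans _ _ (\int[P]_w (cst (\sum_(i : 'I_T.+1 * bool) D ^+ 2)%:E w))%E).
    apply: ge0_le_integral => //.
    - by move=> w _; rewrite lee_fin dotp_ge0.
    - apply/measurable_EFinP; exact: (measurable_dotp sGG GMM (wscale v av) (wscale v av)).
    - move=> w _; rewrite lee_fin; apply: ler_sum => -[t b] _; rewrite -expr2.
      rewrite -real_normK ?num_real//; apply: lerXn2r; rewrite ?nnegrE//.
        have := (vD t w).1 => h; have := le_trans (normr_ge0 _) h.
        by rewrite pmulr_lge0.
      rewrite /scale normrM normfV (gtr0_norm (m_gt0 _ _)) ler_pdivrMr//.
      by case: b => /=; [exact: (vD t w).2|exact: (vD t w).1].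
  by rewrite integral_cst// lte_mul_pinfty ?lee_fin ?sumr_ge0// -?ge0_fin_numE// ?fin_num_measure// => *; exact: sqr_ge0.
have wz : family_adapted G (scale q) by exact: wscale.
have BA u : B u -> family_adapted G u by case.
have B00 : B (fun _ _ => 0).
  split; first by move=> i; exact: measurable_cst.
  have -> : unscale (fun _ _ => 0) = fun t w => (0, 0).
    by apply/funext => t; apply/funext => w; rewrite /unscale mulr0.
  apply: superhedgeable_consumption.
    by apply: L0_adapted_pair => t; exact: measurable_cst.
  move=> t; apply: filterS (aeS t) => w S0.
  by apply/(bid_ask_coneP _ ml S0); rewrite /= oppr0 !mulr0 addr0.
have BDD u v : B u -> B v -> B (fun i w => u i w + v i w).
  move=> [au Au] [av Av]; split; first exact: family_adaptedD.
  have := superhedgeableD Au Av; congr As; apply/funext => t; apply/funext => w.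
  by rewrite /unscale -[LHS]/(_ + _, _ + _) !mulrDr.
have BZZ c u : 0 <= c -> B u -> B (fun i w => c * u i w).
  move=> c0 [au Au]; split; first exact: family_adaptedZ.
  have := superhedgeableZ c0 Au; congr As; apply/funext => t; apply/funext => w.
  by rewrite /unscale /= !(mulrCA c).
have nB : ~ B (scale q) by move=> [_]; rewrite unscaleK.
have [Z [aZ NZ ZB Zq]] := L2_separation sGG GMM BA B00 BDD BZZ B_closed wz
  (scale_bound q C aq qC) nB.
pose Z1 t w := Z (t, false) w / m t w.
pose Z2 t w := Z (t, true) w / m t w.
have dotE v w : dotp Z (scale v) w =
    \sum_(t < T.+1) (Z1 t w * (v t w).1 + Z2 t w * (v t w).2).
  transitivity (\sum_(t < T.+1) \sum_(b : bool) Z (t, b) w * scale v (t, b) w).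
    rewrite (pair_bigA _ (fun t b => Z (t, b) w * scale v (t, b) w)).
    by apply: eq_bigr => -[t b] _.
  apply: eq_bigr => t _; rewrite big_bool /= /scale /Z1 /Z2 /= addrC.
  by congr (_ + _); rewrite mulrA mulrAC.
exists Z1, Z2; split.
- have wV t : measurable_wrt (F t) (fun w => (m t w)^-1).
    by apply: (measurable_fun_invr (@wm t)) => w; exact: ltW.
  by move=> t; split; apply: measurable_funM;
    [exact: (aZ (t, false))|exact: wV|exact: (aZ (t, true))|exact: wV].
- have one : (\int[P]_w (dotp (scale (fun t w => (m t w, m t w)))
      (scale (fun t w => (m t w, m t w))) w)%:E < +oo)%E.
    apply: (scale_bound _ 1).
      by apply: L0_adapted_pair => t; exact: wm.
    by move=> t w /=; rewrite gtr0_norm// mul1r.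
  (* Each component satisfies |Z_i| <= 1 + Z_i^2, which is integrable. *)
  have int1 i : P.-integrable setT (EFin \o Z i).
    have mZi : measurable_fun setT (Z i) by exact: (wrtM (t := i.1) (aZ i)).
    have iZZ := integrable_dotp sGG GMM aZ aZ NZ NZ.
    have i1 : P.-integrable setT (EFin \o (fun w => 1 + dotp Z Z w)).
      rewrite (_ : _ \o _ = cst 1%E \+ (EFin \o dotp Z Z))//.
      by apply: integrableD => //; exact: finite_measure_integrable_cst.
    apply: le_integrable i1 => //; first exact/measurable_EFinP.
    move=> w _; rewrite lee_fin [leRHS]ger0_norm; last by rewrite addr_ge0// dotp_ge0.
    have := sqr_le_dotp Z i w; rewrite -(real_normK (num_real _)).
    move: (normr_ge0 (Z i w)); move: `|Z i w| (dotp _ _ _) => x y x0 xy.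
    nra.
  move=> t; split.
  + apply: eq_integrable (int1 (t, false)) => // w _.
    by rewrite /Z1 /= mulrCA divff ?mulr1// gt_eqF.
  + apply: eq_integrable (int1 (t, true)) => // w _.
    by rewrite /Z2 /= mulrCA divff ?mulr1// gt_eqF.
- move=> v Av [D vD]; have av : L0_adapted P F setT v by case: Av.
  under eq_integral do rewrite -dotE.
  apply: ZB; last exact: scale_bound av vD.
  by split; [exact: wscale|rewrite unscaleK].
- by under eq_integral do rewrite -dotE.
Qed.

End SuperhedgeableSets.

(** * The polar cone *)

Section DualCone.
Context (d : measure_display) (Omega : measurableType d) (R : realType).
Variables (P : probability Omega R) (T : nat).
Variable F : 'I_T.+1 -> set (set Omega).
Hypothesis Ffiltration : is_filtration F.
Variables (mu lambda : R) (S2 : process T Omega R).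
Hypotheses (mu01 : 0 < mu < 1) (lambda01 : 0 < lambda < 1).
Hypothesis S2_adapted_pos : L0_adapted P F [set r : R | 0 < r] S2.
Variable m : process T Omega R.
Hypothesis wm : forall t, measurable_wrt (F t) (m t).
Hypothesis m_ge1 : forall t w, 1 <= m t w.

Let sF t : sigma_algebra setT (F t). Proof. by case: Ffiltration. Qed.
Let FM t : F t `<=` measurable. Proof. by case: Ffiltration. Qed.

Local Notation K := (bid_ask_cone mu lambda S2).
Local Notation As := (superhedgeable P F K (0, 0)).

Let ml : - mu <= lambda.
Proof. by case/andP: mu01; case/andP: lambda01; lra. Qed.

Let m_gt0 t w : 0 < m t w. Proof. exact: lt_le_trans (m_ge1 t w). Qed.

Let wrtM t (f : Omega -> R) : measurable_wrt (F t) f -> measurable_fun setT f.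
Proof. exact: (measurable_wrtW (sF t) (@FM t)). Qed.

Let S t w := Num.max (S2 t w) 0.

Let S_ge0 t w : 0 <= S t w. Proof. by rewrite le_max lexx orbT. Qed.

Let wS t : measurable_wrt (F t) (S t).
Proof. by apply: measurable_maxr => //; case: (S2_adapted_pos t). Qed.

Let aeS t : {ae P, forall w, 0 < S2 t w /\ S t w = S2 t w}.
Proof.
have [_] := S2_adapted_pos t; apply: filterS => w S0; split => //.
by rewrite /S max_l// ltW.
Qed.

(* A position taken at time t is either consumed at t (b = true) or held
   until T (b = false). *)
Definition holding_dates (b : bool) (t s : 'I_T.+1) :=
  if b then s == t else (t <= s)%N.

(** The polar cone of the hedgeable claims in usable form. Finiteness against m makes the pairing
    with claims of size m integrable; [b = false] carries the condition on tail sums and [b = true]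
    the one on the current values. *)
Definition dual_process (Z1 Z2 : process T Omega R) :=
  [/\ forall t, measurable_wrt (F t) (Z1 t) /\ measurable_wrt (F t) (Z2 t),
      forall t w, 0 <= Z1 t w /\ 0 <= Z2 t w,
      forall t, (\int[P]_w (m t w * Z1 t w)%:E < +oo)%E /\
                (\int[P]_w (m t w * Z2 t w)%:E < +oo)%E &
      forall b t A, F t A ->
        (\int[P]_(w in A) (Num.max (S2 t w) 0 * (1 - mu)
            * \sum_(s < T.+1 | holding_dates b t s) Z1 s w)%:E
         <= \int[P]_(w in A) (\sum_(s < T.+1 | holding_dates b t s) Z2 s w)%:E)%E /\
        (\int[P]_(w in A) (\sum_(s < T.+1 | holding_dates b t s) Z2 s w)%:E
         <= \int[P]_(w in A) (Num.max (S2 t w) 0 * (1 + lambda)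
            * \sum_(s < T.+1 | holding_dates b t s) Z1 s w)%:E)%E].

Lemma dual_process_fin Z1 Z2 t : dual_process Z1 Z2 ->
  (\int[P]_w (Z1 t w)%:E < +oo)%E /\ (\int[P]_w (Z2 t w)%:E < +oo)%E.
Proof.
move=> [wZ Z0 Zfin _].
have le (Z : Omega -> R) : measurable_wrt (F t) Z -> (forall w, 0 <= Z w) ->
    (\int[P]_w (Z w)%:E <= \int[P]_w (m t w * Z w)%:E)%E.
  move=> /wrtM mZ Zge0.
  have mm : measurable_fun setT (m t) by apply: (wrtM (t := t)); exact: wm.
  apply: ae_ge0_le_integralr => //; first exact: measurable_funM.
    by move=> w; rewrite mulr_ge0// ltW.
  by apply: aeW => w _; rewrite ler_peMl.
have [Z1f Z2f] := Zfin t; have [wZ1 wZ2] := wZ t.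
split; [apply: le_lt_trans Z1f|apply: le_lt_trans Z2f]; apply: le => //;
  by move=> w; have [] := Z0 t w.
Qed.

(** For [b = true] all integrands are F_t-measurable, so the integral inequalities turn into
    pointwise ones. *)
Lemma dual_process_pair Z1 Z2 : dual_process Z1 Z2 ->
  dual_pair P F mu lambda S2 Z1 Z2.
Proof.
move=> dZ; have fin t := dual_process_fin t dZ; case: (dZ) => wZ Z0 _ ba.
have sum1 (t : 'I_T.+1) (Z : process T Omega R) w :
    \sum_(s < T.+1 | holding_dates true t s) Z s w = Z t w.
  by rewrite /holding_dates big_pred1_eq.
split => //; last by move=> t A FA; exact: (ba false t A FA).
move=> t; have [wZ1 wZ2] := wZ t.
case/andP: mu01 => mu0 mu1; case/andP: lambda01 => la0 la1.
have wSc c : measurable_wrt (F t) (fun w => S t w * c * Z1 t w).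
  apply: measurable_funM => //; apply: measurable_funM => //; exact: wS.
have Sc0 c : 0 <= c -> forall w, 0 <= S t w * c * Z1 t w.
  by move=> c0 w; rewrite !mulr_ge0//; have [] := Z0 t w.
have FT : F t setT.
  by rewrite -(measurable_g_measurableTypeE (sF t)); exact: measurableT.
have baE A : F t A ->
   (\int[P]_(w in A) (S t w * (1 - mu) * Z1 t w)%:E <=
     \int[P]_(w in A) (Z2 t w)%:E)%E /\
   (\int[P]_(w in A) (Z2 t w)%:E <=
     \int[P]_(w in A) (S t w * (1 + lambda) * Z1 t w)%:E)%E.
  move=> FA; have := ba true t A FA.
  under eq_integral do rewrite sum1.
  under [X in _ /\ (X <= _)%E]eq_integral do rewrite sum1.
  under [X in (_ <= X)%E /\ _]eq_integral do rewrite sum1.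
  by under [X in _ /\ (_ <= X)%E]eq_integral do rewrite sum1.
have low : {ae P, forall w, S t w * (1 - mu) * Z1 t w <= Z2 t w}.
  apply: (ae_le_of_integrals (sF t) (@FM t)) => //.
  - by apply: Sc0; lra.
  - by move=> w; have [] := Z0 t w.
  - exact: le_lt_trans (baE _ FT).1 (fin t).2.
  - by move=> A FA; have [] := baE A FA.
have high : {ae P, forall w, Z2 t w <= S t w * (1 + lambda) * Z1 t w}.
  apply: (ae_le_of_integrals (sF t) (@FM t)) => //.
  - by move=> w; have [] := Z0 t w.
  - by apply: Sc0; lra.
  - exact: (fin t).2.
  - by move=> A FA; have [] := baE A FA.
by apply: filterS3 low high (aeS t) => w l h [_ <-]; rewrite l h.
Qed.

Lemma ae_le0_of_integrals t (f : Omega -> R) : measurable_wrt (F t) f ->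
  (forall A, F t A -> \int[P]_(w in A) (f w)%:E <= 0)%E ->
  {ae P, forall w, f w <= 0}.
Proof.
move=> wf fle; have mf := wrtM wf.
pose A := [set w | 0 < f w].
have FA : F t A.
  rewrite (_ : A = f @^-1` `]0, +oo[%classic); last first.
    by apply/seteqP; split => w /=; rewrite in_itv /= andbT.
  by apply: (measurable_wrt_preimage (sF t) wf); exact: measurable_itv.
have mA := FM FA.
have A0 : (\int[P]_(w in A) (Num.max (f w) 0)%:E = 0)%E.
  apply/eqP; rewrite eq_le; apply/andP; split; last first.
    by apply: integral_ge0 => w _; rewrite lee_fin le_max lexx orbT.
  apply: le_trans (fle A FA); rewrite le_eqVlt; apply/orP; left; apply/eqP.
  by apply: eq_integral => w; rewrite inE /A /= => f0; rewrite max_l// ltW.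
have PA : P A = 0%E.
  apply: ae_gt0_integral_eq0 mA _ _ _ A0.
  - exact: measurable_maxr.
  - by move=> w; rewrite le_max lexx orbT.
  - by apply: aeW => w; rewrite /A /= lt_max => ->.
by exists A; split => // w /= /negP; rewrite -ltNge.
Qed.

Section Polar.
Variables Z1 Z2 : process T Omega R.
Hypothesis wZ : forall t, measurable_wrt (F t) (Z1 t) /\ measurable_wrt (F t) (Z2 t).
Hypothesis iZ : forall t, P.-integrable setT (fun w => (m t w * Z1 t w)%:E) /\
                  P.-integrable setT (fun w => (m t w * Z2 t w)%:E).
Hypothesis Zpolar : forall v : process T Omega (R * R)%type, As v ->
  (exists D, forall t w, `|(v t w).1| <= D * m t w /\ `|(v t w).2| <= D * m t w) ->
  (\int[P]_w (\sum_(t < T.+1)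
     (Z1 t w * (v t w).1 + Z2 t w * (v t w).2))%:E <= 0)%E.

(* The test strategies exchange a bounded amount at t on A, and either consume the
   result at t or hold it until T, so no integrability of S2 is needed. *)
Lemma polar_test b t A (k1 k2 : Omega -> R) : F t A ->
  measurable_wrt (F t) k1 -> measurable_wrt (F t) k2 ->
  (forall w, `|k1 w| <= 2 /\ `|k2 w| <= 2) ->
  {ae P, forall w, K t w (- (k1 w, k2 w))} ->
  (\int[P]_(w in A) (k1 w * (\sum_(s < T.+1 | holding_dates b t s) Z1 s w)
     + k2 w * (\sum_(s < T.+1 | holding_dates b t s) Z2 s w))%:E <= 0)%E.
Proof.
move=> FA wk1 wk2 kb Kk.
pose h1 w := k1 w * \1_A w; pose h2 w := k2 w * \1_A w.
have wA : measurable_wrt (F t) (\1_A : Omega -> R).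
  by apply: measurable_indic; exact: measurable_sigma_subalgebra.
have wh1 : measurable_wrt (F t) h1 by exact: measurable_funM.
have wh2 : measurable_wrt (F t) h2 by exact: measurable_funM.
have Kh : {ae P, forall w, K t w (- (h1 w, h2 w))}.
  apply: filterS2 (aeS t) Kk => w [/ltW S0 _] Kw.
  have A0 : 0 <= \1_A w :> R by rewrite indicE.
  have := bid_ask_coneZ mu01 lambda01 S0 A0 Kw; congr (K t w _).
  by apply/pair_equal_spec; rewrite /h1 /h2 /= !mulrN ![\1_A w * _]mulrC.
have K0 s : {ae P, forall w, K s w (- ((0, 0) : R * R))}.
  apply: filterS (aeS s) => w [/ltW S0 _].
  by apply/(bid_ask_coneP _ ml S0); rewrite /= oppr0 !mulr0 addr0.
pose v : process T Omega (R * R)%type :=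
  fun s w => if holding_dates b t s then (h1 w, h2 w) else (0, 0).
have Av : As v.
  rewrite /v /holding_dates {v}; case: b.
    apply: superhedgeable_consumption => //.
      have -> : (fun (s : 'I_T.+1) w => if s == t then (h1 w, h2 w) else (0, 0)) =
         (fun s w => (if s == t then h1 w else 0, if s == t then h2 w else 0)).
        by apply/funext => s; apply/funext => w; case: (s == t).
      by apply: L0_adapted_pair => s; case: (eqVneq s t) => [->|_] //; exact: measurable_cst.
    by move=> s; case: eqP => [->|_]; [exact: Kh|exact: K0].
  pose xi : process T Omega (R * R)%type := fun s w => if s == t then (h1 w, h2 w) else (0, 0).
  have := @superhedgeable_portfolio _ _ _ P T F Ffiltration mu lambda S2 mu01 lambda01
    S2_adapted_pos xi.
  have -> : portfolio (0, 0) xi = fun s w => if (t <= s)%N then (h1 w, h2 w) else (0, 0).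
    apply/funext => s; apply/funext => w; rewrite /portfolio.
    rewrite -[((0, 0) : R * R)]/(0 : R * R) add0r; have [ts|ts] := boolP (t <= s)%N.
      by rewrite (bigD1 t)//= /xi eqxx big1 ?addr0// => r /andP[_ /negbTE ->].
    by rewrite big1// => r rs; rewrite /xi; case: eqP rs ts => [->->|].
  apply; split.
    have -> : xi =
         (fun s w => (if s == t then h1 w else 0, if s == t then h2 w else 0)).
      by apply/funext => s; apply/funext => w; rewrite /xi; case: (s == t).
    by apply: L0_adapted_pair => s; case: (eqVneq s t) => [->|_] //; exact: measurable_cst.
  by move=> s; rewrite /xi; case: eqP => [->|_]; [exact: Kh|exact: K0].
have vb : exists D, forall t w, `|(v t w).1| <= D * m t w /\ `|(v t w).2| <= D * m t w.
  exists 2 => s w; have ms : 2 <= 2 * m s w by rewrite ler_peMr.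
  have ind (k : R) : `|k| <= 2 -> `|k * \1_A w| <= 2 * m s w.
    move=> k2'; apply: le_trans ms; rewrite normrM indicE.
    by case: (_ \in _); rewrite ?normr1 ?mulr1// normr0 mulr0.
  have [k1b k2b] := kb w; rewrite /v; case: ifP => _ /=; first by split; exact: ind.
  by rewrite normr0 mulr_ge0// ltW.
have := Zpolar Av vb; congr (_ <= _)%E.
rewrite [RHS]integral_mkcond; apply: eq_integral => w _.
rewrite patchE; have [wA'|wA'] := boolP (w \in A); last first.
  rewrite big1// => s _; rewrite /v /h1 /h2 indicE (negbTE wA') !mulr0.
  by case: ifP; rewrite /= !mulr0 addr0.
congr EFin; rewrite !mulr_sumr -big_split /= [RHS]big_mkcond /=; apply: eq_bigr => s _.
rewrite /v /h1 /h2 indicE wA' !mulr1; case: ifP => _ /=; last by rewrite !mulr0 addr0.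
by rewrite mulrC [Z2 s w * _]mulrC.
Qed.

(** The factor 1 / (1 + S_t) makes both integrals finite, so that they can be separated. It is
    F_t-measurable, and the weight 1 + S_t cancels it afterwards, when both sides may be
    infinite. *)
Lemma descale_integral_le t (c1 c2 p q : Omega -> R) :
  measurable_wrt (F t) c1 -> measurable_wrt (F t) c2 ->
  measurable_fun setT p -> measurable_fun setT q ->
  (forall w, 0 <= c1 w) -> (forall w, 0 <= c2 w) ->
  (forall w, 0 <= p w) -> (forall w, 0 <= q w) ->
  (forall w, (1 + S t w)^-1 * c1 w <= 2) ->
  (forall w, (1 + S t w)^-1 * c2 w <= 2) ->
  (\int[P]_w (p w)%:E < +oo)%E -> (\int[P]_w (q w)%:E < +oo)%E ->
  (forall A, F t A -> \int[P]_(w in A) ((1 + S t w)^-1 * c1 w * p w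
     - (1 + S t w)^-1 * c2 w * q w)%:E <= 0)%E ->
  forall A, F t A ->
    (\int[P]_(w in A) (c1 w * p w)%:E <= \int[P]_(w in A) (c2 w * q w)%:E)%E.
Proof.
move=> wc1 wc2 mp mq c10 c20 p0 q0 b1 b2 pfin qfin test.
pose be w := (1 + S t w)^-1.
have S1 w : 0 < 1 + S t w by rewrite ltr_pwDl.
have be0 w : 0 <= be w by rewrite invr_ge0 ltW.
have w1S : measurable_wrt (F t) (fun w => 1 + S t w).
  by apply: measurable_funD => //; exact: wS.
have wbe : measurable_wrt (F t) be.
  by apply: (measurable_fun_invr w1S) => w; exact: ltW.
have mu' : measurable_fun setT (fun w => be w * c1 w * p w).
  by apply: measurable_funM => //; apply: (wrtM (t := t)); exact: measurable_funM.
have mv' : measurable_fun setT (fun w => be w * c2 w * q w).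
  by apply: measurable_funM => //; apply: (wrtM (t := t)); exact: measurable_funM.
have u0 w : 0 <= be w * c1 w * p w by rewrite !mulr_ge0.
have v0 w : 0 <= be w * c2 w * q w by rewrite !mulr_ge0.
have fin2 (c f : Omega -> R) : measurable_fun setT (fun w => be w * c w * f w) ->
    measurable_fun setT f -> (forall w, 0 <= f w) -> (forall w, 0 <= be w * c w * f w) ->
    (forall w, be w * c w <= 2) ->
    (\int[P]_w (f w)%:E < +oo)%E -> P.-integrable setT (EFin \o (fun w => be w * c w * f w)).
  move=> mcf mf f0 cf0 c2' ffin; apply: ge0_integrabler => //.
  apply: (@le_lt_trans _ _ (\int[P]_w (2 * f w)%:E)%E).
    apply: ae_ge0_le_integralr => //; first exact: measurable_funM.
      by move=> w; rewrite mulr_ge0.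
    by apply: aeW => w _; apply: ler_wpM2r.
  by rewrite ge0_integralZlr// lte_mul_pinfty ?lee_fin.
have iu := fin2 c1 p mu' mp p0 u0 b1 pfin.
have iv := fin2 c2 q mv' mq q0 v0 b2 qfin.
have uv A : F t A -> (\int[P]_(w in A) (be w * c1 w * p w)%:E
    <= \int[P]_(w in A) (be w * c2 w * q w)%:E)%E.
  move=> FA; have mA := FM FA.
  have iuA := integrableS measurableT mA (@subsetT _ A) iu.
  have ivA := integrableS measurableT mA (@subsetT _ A) iv.
  have := test A FA; under eq_integral do rewrite EFinB.
  by rewrite integralB_EFin// sube_le0.
move=> A FA.
have := @ge0_le_integral_weight _ _ _ _ (sF t) (@FM t) P P
  (fun w => (be w * c1 w * p w)%:E) (fun w => (be w * c2 w * q w)%:E) A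
  (fun w => (1 + S t w)%:E).
have expand (c f : Omega -> R) : (\int[P]_(w in A) ((1 + S t w)%:E * (be w * c w * f w)%:E)
    = \int[P]_(w in A) (c w * f w)%:E)%E.
  apply: eq_integral => w _; rewrite -EFinM; congr EFin.
  by rewrite /be; field; rewrite gt_eqF.
rewrite !expand; apply => //.
- exact/measurable_EFinP.
- exact/measurable_EFinP.
- exact/measurable_EFinP.
- by move=> w; rewrite lee_fin ltW.
Qed.

(** Selling 1 / (1 + S_t) units of stock at the bid price, or buying as many at the ask price, is a
    strategy bounded by 2. The polar inequality on these two trades gives the bid and ask
    inequalities. *)
Lemma polar_dual_process : exists Z1' Z2' : process T Omega R,
  dual_process Z1' Z2' /\
  forall t, {ae P, forall w, Z1' t w = Z1 t w /\ Z2' t w = Z2 t w}.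
Proof.
case/andP: (mu01) => mu0 mu1; case/andP: (lambda01) => la0 la1.
have wZ1 t : measurable_wrt (F t) (Z1 t) := (wZ t).1.
have wZ2 t : measurable_wrt (F t) (Z2 t) := (wZ t).2.
(* Both be and be S are at most 1, while 1 - mu and 1 + lambda are below 2: hence the bound 2 on the
   test strategies. *)
pose be t w := (1 + S t w)^-1.
have S1 t w : 0 < 1 + S t w by rewrite ltr_pwDl.
have be_gt0 t w : 0 < be t w by rewrite invr_gt0.
have be_le1 t w : be t w <= 1 by rewrite invf_le1// lerDl.
have beS_le1 t w : be t w * S t w <= 1.
  by rewrite mulrC ler_pdivrMr// mul1r lerDr.
have beS_ge0 t w : 0 <= be t w * S t w by rewrite mulr_ge0// ltW.
have wbe t : measurable_wrt (F t) (be t).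
  have w1S : measurable_wrt (F t) (fun w => 1 + S t w).
    by apply: measurable_funD => //; exact: wS.
  by apply: (measurable_fun_invr w1S) => w; exact: ltW.
have wbeS t c : measurable_wrt (F t) (fun w => be t w * (S t w * c)).
  by apply: measurable_funM; [exact: wbe|apply: measurable_funM => //; exact: wS].
have bidb t w : 0 <= be t w * (S t w * (1 - mu)) <= 2.
  rewrite mulrA; apply/andP; split; first by rewrite mulr_ge0//; lra.
  by have := beS_le1 t w; have := beS_ge0 t w; move: (be t w * S t w) => x; nra.
have askb t w : 0 <= be t w * (S t w * (1 + lambda)) <= 2.
  rewrite mulrA; apply/andP; split; first by rewrite mulr_ge0//; lra.
  by have := beS_le1 t w; have := beS_ge0 t w; move: (be t w * S t w) => x; nra.
have bid_test b t A : F t A ->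
  (\int[P]_(w in A) (be t w * (S t w * (1 - mu)) * (\sum_(s < T.+1 | holding_dates b t s) Z1 s w)
     + (- be t w) * (\sum_(s < T.+1 | holding_dates b t s) Z2 s w))%:E <= 0)%E.
  move=> FA; apply: (@polar_test b t A (fun w => be t w * (S t w * (1 - mu)))
    (fun w => - be t w) FA).
  - exact: wbeS.
  - by apply: measurable_funN; exact: wbe.
  - move=> w; have /andP[b0 b2] := bidb t w; rewrite ger0_norm// b2; split => //.
    by rewrite normrN gtr0_norm// (le_trans (be_le1 t w))// ler1n.
  - apply: filterS (aeS t) => w [/[dup] S0 /ltW S0' SE].
    apply/(bid_ask_coneP _ ml S0'); rewrite /= opprK SE; split.
      by rewrite le_eqVlt; apply/orP; left; apply/eqP; ring.
    rewrite (_ : _ + _ = be t w * (S2 t w * (mu + lambda))); last by ring.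
    by apply: mulr_ge0; [exact: ltW|apply: mulr_ge0 => //; lra].
have ask_test b t A : F t A ->
  (\int[P]_(w in A) ((- (be t w * (S t w * (1 + lambda)))) * (\sum_(s < T.+1 | holding_dates b t s) Z1 s w)
     + be t w * (\sum_(s < T.+1 | holding_dates b t s) Z2 s w))%:E <= 0)%E.
  move=> FA; apply: (@polar_test b t A (fun w => - (be t w * (S t w * (1 + lambda))))
    (be t) FA).
  - by apply: measurable_funN; exact: wbeS.
  - exact: wbe.
  - move=> w; have /andP[b0 b2] := askb t w; rewrite normrN ger0_norm// b2; split => //.
    by rewrite gtr0_norm// (le_trans (be_le1 t w))// ler1n.
  - apply: filterS (aeS t) => w [/[dup] S0 /ltW S0' SE].
    apply/(bid_ask_coneP _ ml S0'); rewrite /= opprK SE; split.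
      rewrite (_ : _ + _ = be t w * (S2 t w * (mu + lambda))); last by ring.
      by apply: mulr_ge0; [exact: ltW|apply: mulr_ge0 => //; lra].
    by rewrite le_eqVlt; apply/orP; left; apply/eqP; ring.
have sum1 (t : 'I_T.+1) (Z : process T Omega R) w :
    \sum_(s < T.+1 | holding_dates true t s) Z s w = Z t w.
  by rewrite /holding_dates big_pred1_eq.
(* Test by throwing away one unit of the first asset at time t. *)
have Z1_ge0 t : {ae P, forall w, 0 <= Z1 t w}.
  have test A : F t A -> (\int[P]_(w in A) (-1 * Z1 t w + 0 * Z2 t w)%:E <= 0)%E.
    move=> FA; have := @polar_test true t A (cst (-1)) (cst 0) FA.
    under eq_integral do rewrite !sum1; apply => //.
    - exact: measurable_cst.
    - exact: measurable_cst.
    - by move=> w; rewrite /= normrN normr1 normr0 ler1n.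
    - apply: filterS (aeS t) => w [/ltW S0 _].
      by apply/(bid_ask_coneP _ ml S0); rewrite /= opprK oppr0 !mulr0 addr0.
  have wf : measurable_wrt (F t) (fun w => -1 * Z1 t w + 0 * Z2 t w).
    by apply: measurable_funD; apply: measurable_funM => //; [exact: wZ1|exact: wZ2].
  by apply: filterS (ae_le0_of_integrals wf test) => w; lra.
(* The bid test consumed at t compares Z2_t with a nonnegative multiple of Z1_t. *)
have Z2_ge0 t : {ae P, forall w, 0 <= Z2 t w}.
  have test A : F t A -> (\int[P]_(w in A) (be t w * (S t w * (1 - mu)) * Z1 t w
     + (- be t w) * Z2 t w)%:E <= 0)%E.
    move=> FA; have := bid_test true t A FA.
    by under eq_integral do rewrite !sum1.
  have wf : measurable_wrt (F t) (fun w => be t w * (S t w * (1 - mu)) * Z1 t w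
     + (- be t w) * Z2 t w).
    apply: measurable_funD; apply: measurable_funM; [exact: wbeS|exact: wZ1| |exact: wZ2].
    by apply: measurable_funN; exact: wbe.
  apply: filterS2 (Z1_ge0 t) (ae_le0_of_integrals wf test) => w z1 le0.
  have /andP[b0 _] := bidb t w.
  have z : 0 <= be t w * Z2 t w by have := mulr_ge0 b0 z1; lra.
  by rewrite -(pmulr_rge0 _ (be_gt0 t w)).
pose Z1' : process T Omega R := fun t w => Num.max (Z1 t w) 0.
pose Z2' : process T Omega R := fun t w => Num.max (Z2 t w) 0.
have aeZ t : {ae P, forall w, Z1' t w = Z1 t w /\ Z2' t w = Z2 t w}.
  by apply: filterS2 (Z1_ge0 t) (Z2_ge0 t) => w z1 z2; rewrite /Z1' /Z2' !max_l.
have wZ1' t : measurable_wrt (F t) (Z1' t) by apply: measurable_maxr => //; exact: wZ1.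
have wZ2' t : measurable_wrt (F t) (Z2' t) by apply: measurable_maxr => //; exact: wZ2.
have Z1'0 t w : 0 <= Z1' t w by rewrite le_max lexx orbT.
have Z2'0 t w : 0 <= Z2' t w by rewrite le_max lexx orbT.
have mZ1' t : measurable_fun setT (Z1' t) by apply: (wrtM (t := t)).
have mZ2' t : measurable_fun setT (Z2' t) by apply: (wrtM (t := t)).
have mm t : measurable_fun setT (m t) by apply: (wrtM (t := t)); exact: wm.
have fin (Z : Omega -> R) t : measurable_fun setT Z ->
    P.-integrable setT (fun w => (m t w * Z w)%:E) ->
    (\int[P]_w (m t w * Num.max (Z w) 0)%:E < +oo)%E.
  move=> mZ /integrableP[_]; apply: le_lt_trans; apply: ge0_le_integral => //.
  - by move=> w _; rewrite lee_fin mulr_ge0 ?le_max ?lexx ?orbT// ltW.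
  - by apply/measurable_EFinP/measurable_funM => //; exact: measurable_maxr.
  - by apply: measurableT_comp => //; apply/measurable_EFinP/measurable_funM.
  - move=> w _; rewrite /= lee_fin normrM gtr0_norm//; apply: ler_wpM2l; first exact: ltW.
    by rewrite ge_max ler_norm normr_ge0.
have mfin t : (\int[P]_w (m t w * Z1' t w)%:E < +oo)%E /\
    (\int[P]_w (m t w * Z2' t w)%:E < +oo)%E.
  by have [i1 i2] := iZ t; split; apply: fin => //; apply: (wrtM (t := t)).
have fin1 (Z : process T Omega R) : (forall t, measurable_fun setT (Z t)) ->
    (forall t w, 0 <= Z t w) -> (forall t, \int[P]_w (m t w * Z t w)%:E < +oo)%E ->
    forall b t, (\int[P]_w (\sum_(s < T.+1 | holding_dates b t s) Z s w)%:E < +oo)%E.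
  move=> mZ Z0 mZfin b t; apply: integral_sum_lty => // s.
  apply: le_lt_trans (mZfin s); apply: ae_ge0_le_integralr => //.
  - exact: measurable_funM.
  - by move=> w; rewrite mulr_ge0// ltW.
  - by apply: aeW => w _; rewrite ler_peMl.
have aeZall : {ae P, forall w, forall t, Z1' t w = Z1 t w /\ Z2' t w = Z2 t w}.
  by apply: filter_forall => t; exact: aeZ.
exists Z1', Z2'; split => //; split => // b t A FA.
have mS1 : measurable_fun setT (fun w => \sum_(s < T.+1 | holding_dates b t s) Z1' s w).
  exact: measurable_sum_cond.
have mS2 : measurable_fun setT (fun w => \sum_(s < T.+1 | holding_dates b t s) Z2' s w).
  exact: measurable_sum_cond.
have S10 w : 0 <= \sum_(s < T.+1 | holding_dates b t s) Z1' s w by exact: sumr_ge0.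
have S20 w : 0 <= \sum_(s < T.+1 | holding_dates b t s) Z2' s w by exact: sumr_ge0.
have S1fin := fin1 Z1' mZ1' Z1'0 (fun t => (mfin t).1) b t.
have S2fin := fin1 Z2' mZ2' Z2'0 (fun t => (mfin t).2) b t.
have wSc c : measurable_wrt (F t) (fun w => S t w * c).
  by apply: measurable_funM => //; exact: wS.
have mZs (Z : process T Omega R) : (forall t, measurable_wrt (F t) (Z t)) ->
    measurable_fun setT (fun w => \sum_(s < T.+1 | holding_dates b t s) Z s w).
  by move=> wZZ; apply: measurable_sum_cond => s; apply: (wrtM (t := s)); exact: wZZ.
have mbe : measurable_fun setT (be t) by apply: (wrtM (t := t)); exact: wbe.
have mbeS c : measurable_fun setT (fun w => be t w * (S t w * c)).
  by apply: (wrtM (t := t)); exact: wbeS.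
have one_meas : measurable_wrt (F t) (cst 1 : Omega -> R) by exact: measurable_cst.
have be2 w : be t w * 1 <= 2 by rewrite mulr1 (le_trans (be_le1 t w))// ler1n.
have c10 : 0 <= 1 - mu by lra.
have c20 : 0 <= 1 + lambda by lra.
have Sc0 c : 0 <= c -> forall w, 0 <= S t w * c by move=> c0 w; rewrite mulr_ge0.
have low := @descale_integral_le t (fun w => S t w * (1 - mu)) (cst 1) _ _
   (wSc _) one_meas mS1 mS2 (Sc0 _ c10) (fun=> ler01) S10 S20
   (fun w => proj2 (andP (bidb t w))) be2 S1fin S2fin _ A FA.
have high := @descale_integral_le t (cst 1) (fun w => S t w * (1 + lambda)) _ _
   one_meas (wSc _) mS2 mS1 (fun=> ler01) (Sc0 _ c20) S20 S10
   be2 (fun w => proj2 (andP (askb t w))) S2fin S1fin _ A FA.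
have eqA B (f g : Omega -> R) : F t B -> measurable_fun setT f -> measurable_fun setT g ->
    {ae P, forall w, f w = g w} ->
    (\int[P]_(w in B) (f w)%:E = \int[P]_(w in B) (g w)%:E)%E.
  move=> FB mf mg fg; apply: ae_eq_integral; first exact: FM FB.
  - exact/measurable_EFinP/measurable_funTS.
  - exact/measurable_EFinP/measurable_funTS.
  - by apply: filterS fg => w -> _.
have sumE : {ae P, forall w,
    \sum_(s < T.+1 | holding_dates b t s) Z1' s w = \sum_(s < T.+1 | holding_dates b t s) Z1 s w /\
    \sum_(s < T.+1 | holding_dates b t s) Z2' s w = \sum_(s < T.+1 | holding_dates b t s) Z2 s w}.
  by apply: filterS aeZall => w e; split; apply: eq_bigr => s _; have [? ?] := e s.
split.
- have : (\int[P]_(w in A) (S t w * (1 - mu) * \sum_(s < T.+1 | holding_dates b t s) Z1' s w)%:E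
     <= \int[P]_(w in A) (cst 1 w * \sum_(s < T.+1 | holding_dates b t s) Z2' s w)%:E)%E.
    apply: low => B FB; apply: le_trans (bid_test b t B FB).
    rewrite le_eqVlt; apply/orP; left; apply/eqP; apply: eqA => //.
    + by apply: measurable_funB; apply: measurable_funM => //; exact: measurable_funM.
    + apply: measurable_funD; apply: measurable_funM => //.
      * exact: mZs wZ1.
      * exact: measurable_funN.
      * exact: mZs wZ2.
    + by apply: filterS sumE => w [-> ->]; rewrite /= mulr1 mulNr.
  by under [X in (_ <= X)%E -> _]eq_integral do rewrite mul1r.
- have : (\int[P]_(w in A) (cst 1 w * \sum_(s < T.+1 | holding_dates b t s) Z2' s w)%:E
     <= \int[P]_(w in A) (S t w * (1 + lambda) * \sum_(s < T.+1 | holding_dates b t s) Z1' s w)%:E)%E.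
    apply: high => B FB; apply: le_trans (ask_test b t B FB).
    rewrite le_eqVlt; apply/orP; left; apply/eqP; apply: eqA => //.
    + by apply: measurable_funB; apply: measurable_funM => //; exact: measurable_funM.
    + apply: measurable_funD; apply: measurable_funM => //.
      * exact: measurable_funN.
      * exact: mZs wZ1.
      * exact: mZs wZ2.
    + by apply: filterS sumE => w [-> ->]; rewrite /= mulr1 mulNr addrC.
  by under [X in (X <= _)%E -> _]eq_integral do rewrite mul1r.
Qed.

End Polar.
End DualCone.

(** * Linear combinations and countable sums of dual processes *)

Section DualProcessSums.
Context (d : measure_display) (Omega : measurableType d) (R : realType).
Variables (P : probability Omega R) (T : nat).
Variable F : 'I_T.+1 -> set (set Omega).
Hypothesis Ffiltration : is_filtration F.
Variables (mu lambda : R) (S2 : process T Omega R).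
Hypotheses (mu01 : 0 < mu < 1) (lambda01 : 0 < lambda < 1).
Hypothesis S2_adapted_pos : L0_adapted P F [set r : R | 0 < r] S2.
Variable m : process T Omega R.
Hypothesis wm : forall t, measurable_wrt (F t) (m t).
Hypothesis m_ge1 : forall t w, 1 <= m t w.

Let sF t : sigma_algebra setT (F t). Proof. by case: Ffiltration. Qed.
Let FM t : F t `<=` measurable. Proof. by case: Ffiltration. Qed.

Let wrtM t (f : Omega -> R) : measurable_wrt (F t) f -> measurable_fun setT f.
Proof. exact: (measurable_wrtW (sF t) (@FM t)). Qed.

Let mm t : measurable_fun setT (m t).
Proof. by apply: (wrtM (t := t)); exact: wm. Qed.

Let m_ge0 t w : 0 <= m t w. Proof. exact: le_trans (m_ge1 t w). Qed.

Let S t w := Num.max (S2 t w) 0.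
Let S_ge0 t w : 0 <= S t w. Proof. by rewrite le_max lexx orbT. Qed.
Let mS t : measurable_fun setT (S t).
Proof.
by apply: measurable_maxr => //; apply: (wrtM (t := t)); case: (S2_adapted_pos t).
Qed.

Let c1 : 0 <= 1 - mu. Proof. by case/andP: mu01; lra. Qed.
Let c2 : 0 <= 1 + lambda. Proof. by case/andP: lambda01; lra. Qed.

Local Notation dual := (dual_process P F mu lambda S2 m).

(** One identity for all integrals in [dual_process]: g is m_t, the constant 1, or S_t times a
    constant, and p selects one date or the holding dates. *)
Let integral_lin (A : set Omega) (p : pred 'I_T.+1) (g : Omega -> R) (a b : R)
    (Z Z' : process T Omega R) :
  measurable A -> measurable_fun setT g -> (forall w, 0 <= g w) ->
  0 <= a -> 0 <= b ->
  (forall t, measurable_fun setT (Z t)) -> (forall t w, 0 <= Z t w) ->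
  (forall t, measurable_fun setT (Z' t)) -> (forall t w, 0 <= Z' t w) ->
  (\int[P]_(w in A) (g w * \sum_(s | p s) (a * Z s w + b * Z' s w))%:E =
   a%:E * \int[P]_(w in A) (g w * \sum_(s | p s) Z s w)%:E
   + b%:E * \int[P]_(w in A) (g w * \sum_(s | p s) Z' s w)%:E)%E.
Proof.
move=> mA mg g0 a0 b0 mZ Z0 mZ' Z'0.
have h (V : process T Omega R) : (forall t, measurable_fun setT (V t)) ->
    (forall t w, 0 <= V t w) ->
    measurable_fun setT (fun w => g w * \sum_(s | p s) V s w) /\
    (forall w, 0 <= g w * \sum_(s | p s) V s w).
  move=> mV V0; split; last by move=> w; rewrite mulr_ge0// sumr_ge0.
  by apply: measurable_funM => //; exact: measurable_sum_cond.
have [h1 h2] := h Z mZ Z0; have [h3 h4] := h Z' mZ' Z'0.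
rewrite -!ge0_integralZlr// -ge0_integralDr//.
- apply: eq_integral => w _; congr EFin.
  by rewrite big_split /= -!mulr_sumr; ring.
- exact: measurable_funM.
- exact: measurable_funM.
- by move=> w; rewrite mulr_ge0.
- by move=> w; rewrite mulr_ge0.
Qed.

Let sum1 (t : 'I_T.+1) (f : 'I_T.+1 -> R) : \sum_(s < T.+1 | s == t) f s = f t.
Proof. by rewrite big_pred1_eq. Qed.

Lemma dual_process_lin (a b : R) Z1 Z2 Z1' Z2' : 0 <= a -> 0 <= b ->
  dual Z1 Z2 -> dual Z1' Z2' ->
  dual (fun t w => a * Z1 t w + b * Z1' t w) (fun t w => a * Z2 t w + b * Z2' t w).
Proof.
move=> a0 b0 [wZ Z0 Zfin Zba] [wZ' Z0' Zfin' Zba'].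
have mZ1 t : measurable_fun setT (Z1 t) by apply: (wrtM (t := t)); exact: (wZ t).1.
have mZ2 t : measurable_fun setT (Z2 t) by apply: (wrtM (t := t)); exact: (wZ t).2.
have mZ1' t : measurable_fun setT (Z1' t) by apply: (wrtM (t := t)); exact: (wZ' t).1.
have mZ2' t : measurable_fun setT (Z2' t) by apply: (wrtM (t := t)); exact: (wZ' t).2.
have Z10 t w : 0 <= Z1 t w := (Z0 t w).1.
have Z20 t w : 0 <= Z2 t w := (Z0 t w).2.
have Z10' t w : 0 <= Z1' t w := (Z0' t w).1.
have Z20' t w : 0 <= Z2' t w := (Z0' t w).2.
split.
- move=> t; have [w1 w2] := wZ t; have [w1' w2'] := wZ' t.
  by split; apply: measurable_funD; exact: measurable_funM.
- by move=> t w; split; rewrite addr_ge0// mulr_ge0.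
- have fin (Z Z' : process T Omega R) t : (forall t, measurable_fun setT (Z t)) ->
      (forall t, measurable_fun setT (Z' t)) ->
      (forall t w, 0 <= Z t w) -> (forall t w, 0 <= Z' t w) ->
      (\int[P]_w (m t w * Z t w)%:E < +oo)%E ->
      (\int[P]_w (m t w * Z' t w)%:E < +oo)%E ->
      (\int[P]_w (m t w * (a * Z t w + b * Z' t w))%:E < +oo)%E.
    move=> mZ mZ' z0 z0' f1 f2.
    have := @integral_lin setT (pred1 t) (m t) a b Z Z' measurableT (mm t) (m_ge0 t) a0 b0
      mZ z0 mZ' z0'.
    under eq_integral do rewrite sum1.
    under [X in _ = (_ * X + _)%E -> _]eq_integral do rewrite sum1.
    under [X in _ = (_ + _ * X)%E -> _]eq_integral do rewrite sum1.
    by move=> ->; rewrite lte_add_pinfty// lte_mul_pinfty// lee_fin.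
  move=> t; have [f1 f2] := Zfin t; have [f1' f2'] := Zfin' t.
  by split; exact: fin.
move=> e t A FA; have mA := FM FA.
have [l1 l2] := Zba e t A FA; have [l1' l2'] := Zba' e t A FA.
have mSc c : measurable_fun setT (fun w => S t w * c) by exact: measurable_funM.
have Sc0 c : 0 <= c -> forall w, 0 <= S t w * c by move=> c0 w; rewrite mulr_ge0.
have one (Z : process T Omega R) : (\int[P]_(w in A) (\sum_(s < T.+1 | holding_dates e t s) Z s w)%:E
    = \int[P]_(w in A) (cst 1 w * \sum_(s < T.+1 | holding_dates e t s) Z s w)%:E)%E.
  by apply: eq_integral => w _; rewrite mul1r.
rewrite !one in l1 l2 l1' l2' *.
rewrite (@integral_lin A _ (cst 1) a b Z2 Z2')//.
rewrite (@integral_lin A _ (fun w => S t w * (1 - mu)) a b Z1 Z1')//; last exact: Sc0.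
rewrite (@integral_lin A _ (fun w => S t w * (1 + lambda)) a b Z1 Z1')//; last exact: Sc0.
by split; apply: leeD; apply: lee_wpmul2l; rewrite ?lee_fin.
Qed.

Section Series.
Variables (Z1 Z2 : nat -> process T Omega R).
Hypothesis dZ : forall n, dual (Z1 n) (Z2 n).
Hypothesis Z1_sum : forall t, (\sum_(n <oo) \int[P]_w (m t w * Z1 n t w)%:E < +oo)%E.
Hypothesis Z2_sum : forall t, (\sum_(n <oo) \int[P]_w (m t w * Z2 n t w)%:E < +oo)%E.

(** [fine] yields a real-valued process: the sum is finite a.s. when the expectations weighted by m
    are summable, and is set to 0 where it is infinite. *)
Definition process_series (Z : nat -> process T Omega R) : process T Omega R :=
  fun t w => fine (\sum_(n <oo) (Z n t w)%:E)%E.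

Let good (Z : nat -> process T Omega R) := [/\
  forall n t, measurable_wrt (F t) (Z n t), forall n t w, 0 <= Z n t w &
  forall t, (\sum_(n <oo) \int[P]_w (m t w * Z n t w)%:E < +oo)%E].

Let good1 : good Z1.
Proof.
split => //; first by move=> n t; case: (dZ n) => /(_ t)[].
by move=> n t w; case: (dZ n) => _ /(_ t w)[].
Qed.

Let good2 : good Z2.
Proof.
split => //; first by move=> n t; case: (dZ n) => /(_ t)[].
by move=> n t w; case: (dZ n) => _ /(_ t w)[].
Qed.

Let series_ge0 Z : good Z -> forall t w, 0 <= process_series Z t w.
Proof.
move=> [_ Z0 _] t w; apply: fine_ge0; apply: nneseries_ge0 => n _ _.
by rewrite lee_fin.
Qed.

Let series_wrt Z : good Z -> forall t, measurable_wrt (F t) (process_series Z t).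
Proof.
move=> [wZ Z0 _] t; apply: measurableT_comp => //.
apply: ge0_emeasurable_sum => [n w _ _|n _]; first by rewrite lee_fin.
by apply/measurable_EFinP; exact: wZ.
Qed.

Lemma process_seriesE Z : good Z -> {ae P, forall w, forall t,
  (process_series Z t w)%:E = (\sum_(n <oo) (Z n t w)%:E)%E}.
Proof.
move=> [wZ Z0 Zsum]; apply: filter_forall => t.
have mZ n : measurable_fun setT (Z n t) by apply: (wrtM (t := t)).
have ms : measurable_fun setT (fun w => (\sum_(n <oo) (Z n t w)%:E)%E).
  apply: ge0_emeasurable_sum => [n w _ _|n _]; first by rewrite lee_fin.
  exact/measurable_EFinP.
have s0 w : (0 <= \sum_(n <oo) (Z n t w)%:E)%E.
  by apply: nneseries_ge0 => n _ _; rewrite lee_fin.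
have : P.-integrable setT (fun w => (\sum_(n <oo) (Z n t w)%:E)%E).
  apply/integrableP; split => //.
  under eq_integral do rewrite gee0_abs//.
  rewrite integral_nneseries//; [|by move=> n; exact/measurable_EFinP|by move=> n w _; rewrite lee_fin].
  apply: le_lt_trans (Zsum t); apply: lee_nneseries => [n _ _|n _].
    by apply: integral_ge0 => w _; rewrite lee_fin.
  apply: ae_ge0_le_integralr => //; first exact: measurable_funM.
    by move=> w; rewrite mulr_ge0.
  by apply: aeW => w _; rewrite ler_peMl.
move/integrable_ae => /(_ measurableT); apply: filterS => w /(_ Logic.I) fw.
by rewrite /process_series fineK.
Qed.

(** Monotone convergence; the counterpart of [integral_lin] for infinite sums. *)
Let integral_series (A : set Omega) (p : pred 'I_T.+1) (g : Omega -> R) Z :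
  good Z -> measurable A -> measurable_fun setT g -> (forall w, 0 <= g w) ->
  (\int[P]_(w in A) (g w * \sum_(s | p s) process_series Z s w)%:E =
   \sum_(n <oo) \int[P]_(w in A) (g w * \sum_(s | p s) Z n s w)%:E)%E.
Proof.
move=> gZ mA mg g0; have [wZ Z0 Zsum] := gZ.
have mZ n t : measurable_fun setT (Z n t) by apply: (wrtM (t := t)).
have mn n : measurable_fun setT (fun w => g w * \sum_(s | p s) Z n s w).
  by apply: measurable_funM => //; exact: measurable_sum_cond.
have n0 n w : 0 <= g w * \sum_(s | p s) Z n s w by rewrite mulr_ge0// sumr_ge0.
rewrite -integral_nneseries//; first last.
- by move=> n w _; rewrite lee_fin.
- by move=> n; exact/measurable_EFinP/measurable_funTS.
apply: ae_eq_integral => //.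
- apply/measurable_EFinP/measurable_funTS/measurable_funM => //.
  apply: measurable_sum_cond => s; apply: (wrtM (t := s)); exact: series_wrt.
- apply: ge0_emeasurable_sum => [n w _ _|n _]; first by rewrite lee_fin.
  exact/measurable_EFinP/measurable_funTS.
apply: filterS (process_seriesE gZ) => w e _.
rewrite EFinM -sumEFin (eq_bigr _ (fun s _ => e s)).
rewrite -nneseries_sum; last by move=> s n _; rewrite lee_fin.
rewrite -nneseriesZl; last by move=> n _; apply: sume_ge0 => s _; rewrite lee_fin.
by apply: eq_eseriesr => n _; rewrite sumEFin -EFinM.
Qed.

Lemma dual_process_series : dual (process_series Z1) (process_series Z2).
Proof.
split.
- by move=> t; split; exact: series_wrt.
- by move=> t w; split; exact: series_ge0.
- have fin Z t : good Z -> (\int[P]_w (m t w * process_series Z t w)%:E < +oo)%E.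
    move=> gZ; have [_ _ Zsum] := gZ.
    have := @integral_series setT (pred1 t) (m t) Z gZ measurableT (mm t) (m_ge0 t).
    under eq_integral do rewrite sum1.
    move=> ->; apply: le_lt_trans (Zsum t).
    rewrite le_eqVlt; apply/orP; left; apply/eqP; apply: eq_eseriesr => n _.
    by apply: eq_integral => w _; rewrite sum1.
  by move=> t; split; exact: fin.
move=> e t A FA; have mA := FM FA.
have mSc c : measurable_fun setT (fun w => S t w * c) by exact: measurable_funM.
have Sc0 c : 0 <= c -> forall w, 0 <= S t w * c by move=> c0 w; rewrite mulr_ge0.
have one (Z : process T Omega R) : (\int[P]_(w in A) (\sum_(s < T.+1 | holding_dates e t s) Z s w)%:E
    = \int[P]_(w in A) (cst 1 w * \sum_(s < T.+1 | holding_dates e t s) Z s w)%:E)%E.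
  by apply: eq_integral => w _; rewrite mul1r.
have nonneg (g : Omega -> R) (Z : nat -> process T Omega R) n : good Z ->
    (forall w, 0 <= g w) ->
    (0 <= \int[P]_(w in A) (g w * \sum_(s < T.+1 | holding_dates e t s) Z n s w)%:E)%E.
  move=> [_ Z0 _] g0; apply: integral_ge0 => w _.
  by rewrite lee_fin mulr_ge0// sumr_ge0.
rewrite one (@integral_series A _ (cst 1) Z2 good2)//.
rewrite (@integral_series A _ (fun w => S t w * (1 - mu)) Z1 good1)//; last exact: Sc0.
rewrite (@integral_series A _ (fun w => S t w * (1 + lambda)) Z1 good1)//; last exact: Sc0.
split; apply: lee_nneseries => n _.
- by move=> _; apply: nonneg => //; exact: Sc0.
- by rewrite -one; case: (dZ n) => _ _ _ /(_ e t A FA)[].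
- by move=> _; exact: nonneg.
- by rewrite -one; case: (dZ n) => _ _ _ /(_ e t A FA)[].
Qed.

Lemma process_series_ge n t : {ae P, forall w, Z1 n t w <= process_series Z1 t w}.
Proof.
apply: filterS (process_seriesE good1) => w e; rewrite -lee_fin e.
have [_ Z0 _] := good1.
apply: le_trans (nneseries_lim_ge n.+1 _); last by move=> k _ _; rewrite lee_fin.
rewrite big_nat_recr//= -[leLHS]add0e leeD2r// sume_ge0// => k _.
by rewrite lee_fin.
Qed.

End Series.
End DualProcessSums.

(** * Strictly positive dual processes *)

Lemma ae_measure_le (d : measure_display) (Omega : measurableType d)
    (R : realType) (P : {measure set Omega -> \bar R}) (A B : set Omega) :
  measurable A -> measurable B -> {ae P, forall w, A w -> B w} ->
  (P A <= P B)%E.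
Proof.
move=> mA mB [N [mN PN sN]].
apply: (@le_trans _ _ (P (B `|` N))).
  apply: le_measure; rewrite ?inE//; first exact: measurableU.
  move=> w Aw; have [Bw|nB] := pselect (B w); [by left|right].
  by apply: sN => /= /(_ Aw).
by rewrite -[leRHS]adde0 -PN; exact: measureU2.
Qed.

Section StrictlyPositiveDual.
Context (d : measure_display) (Omega : measurableType d) (R : realType).
Variables (P : probability Omega R) (T : nat).
Variable F : 'I_T.+1 -> set (set Omega).
Hypothesis Ffiltration : is_filtration F.
Hypothesis F_T : F ord_max = measurable.
Variables (mu lambda : R) (S2 : process T Omega R).
Hypotheses (mu01 : 0 < mu < 1) (lambda01 : 0 < lambda < 1).
Hypothesis S2_adapted_pos : L0_adapted P F [set r : R | 0 < r] S2.
Local Notation K := (bid_ask_cone mu lambda S2).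
Local Notation As := (superhedgeable P F K (0, 0)).
Hypothesis As_closed : closed_in_measure P F As.
Hypothesis no_arbitrage :
  terminal_attainable P F K (0, 0)
    `&` L0 P measurable [set x : R * R | 0 <= x.1 /\ 0 <= x.2]
  `<=` [set v : Omega -> (R * R)%type | {ae P, forall w, v w = (0, 0) :> (R * R)}].

Let sF t : sigma_algebra setT (F t). Proof. by case: Ffiltration. Qed.
Let FM t : F t `<=` measurable. Proof. by case: Ffiltration. Qed.
Let wrtM t (f : Omega -> R) : measurable_wrt (F t) f -> measurable_fun setT f.
Proof. exact: (measurable_wrtW (sF t) (@FM t)). Qed.

Variable m : process T Omega R.
Hypothesis wm : forall t, measurable_wrt (F t) (m t).
Hypothesis m_ge1 : forall t w, 1 <= m t w.

Let mm t : measurable_fun setT (m t).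
Proof. by apply: (wrtM (t := t)); exact: wm. Qed.
Let m_ge0 t w : 0 <= m t w. Proof. exact: le_trans (m_ge1 t w). Qed.

Local Notation dual := (dual_process P F mu lambda S2 m).

Lemma polar_separation (q : process T Omega (R * R)%type) (C : R) :
  L0_adapted P F setT q ->
  (forall t w, `|(q t w).1| <= C * m t w /\ `|(q t w).2| <= C * m t w) ->
  ~ As q ->
  exists Z1 Z2 : process T Omega R, dual Z1 Z2 /\
    (0 < \int[P]_w (\sum_(t < T.+1)
             (Z1 t w * (q t w).1 + Z2 t w * (q t w).2))%:E)%E.
Proof.
move=> aq qC nAs.
have [Z1 [Z2 [wZ iZ Zpolar Zq]]] := superhedgeable_separation Ffiltration
  mu01 lambda01 S2_adapted_pos As_closed wm m_ge1 aq qC nAs.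
have [Z1' [Z2' [dZ' eZ]]] := polar_dual_process Ffiltration mu01 lambda01
  S2_adapted_pos wm m_ge1 wZ iZ Zpolar.
exists Z1', Z2'; split => //.
have aeZ : {ae P, forall w, forall t, Z1' t w = Z1 t w /\ Z2' t w = Z2 t w}.
  by apply: filter_forall.
have [wZ' _ _ _] := dZ'.
have mq (V1 V2 : process T Omega R) :
    (forall t, measurable_wrt (F t) (V1 t) /\ measurable_wrt (F t) (V2 t)) ->
    measurable_fun setT (fun w => \sum_(t < T.+1)
             (V1 t w * (q t w).1 + V2 t w * (q t w).2)).
  move=> wV; apply: measurable_sum => t; have [w1 w2] := wV t.
  apply: (wrtM (t := t)); apply: measurable_funD; apply: measurable_funM => //.
  - exact: L0_adapted_fst aq.
  - exact: L0_adapted_snd aq.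
rewrite (_ : (\int[P]_w _ = \int[P]_w (\sum_(t < T.+1)
             (Z1 t w * (q t w).1 + Z2 t w * (q t w).2))%:E)%E)//.
apply: ae_eq_integral => //.
- by apply/measurable_EFinP; exact: mq.
- by apply/measurable_EFinP; exact: mq.
- apply: filterS aeZ => w e _; congr EFin; apply: eq_bigr => t _.
  by have [-> ->] := e t.
Qed.

(** A superhedge, liquidated at T, would attain exactly the payoff 1_A in the first asset, which is
    an arbitrage. *)
Lemma terminal_claim_not_superhedgeable (A : set Omega) : measurable A ->
  P A != 0%E ->
  ~ As (fun t w => if t == ord_max then (\1_A w, 0) else (0, 0)).
Proof.
move=> mA PA0 Aq; move/eqP : PA0; apply.
have := terminal_attainable_superhedgeable Ffiltration mu01 lambda01 S2_adapted_pos Aq.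
rewrite eqxx => tA.
have mA1 : measurable_wrt (measurable : set (set Omega)) (\1_A : Omega -> R).
  by apply: measurable_indic; apply: sub_sigma_algebra.
have : L0 P measurable [set x : R * R | 0 <= x.1 /\ 0 <= x.2]
    (fun w => (\1_A w, 0) : R * R).
  split; first by apply: measurable_fun_pair => //; exact: measurable_cst.
  by apply: aeW => w /=; rewrite indicE.
move=> lA; have [N [mN PN sN]] := no_arbitrage (conj tA lA).
apply: (subset_measure0 mA mN _ PN) => w Aw; apply: sN => /= -[] /eqP.
by rewrite indicE mem_set// oner_eq0.
Qed.

(** Separating the claim that pays 1_A at T gives a positive expectation of Z1_T 1_A. *)
Lemma exists_dual_charging (A : set Omega) : measurable A -> P A != 0%E ->
  exists Z1 Z2 : process T Omega R, dual Z1 Z2 /\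
    ~ {ae P, forall w, A w -> Z1 ord_max w <= 0}.
Proof.
move=> mA PA0; have nAs := terminal_claim_not_superhedgeable mA PA0.
set q : process T Omega (R * R)%type := fun t w => _ in nAs.
have FA : F ord_max A by rewrite F_T.
have aq : L0_adapted P F setT q.
  have -> : q = fun t w => (if t == ord_max then \1_A w else 0, 0).
    by apply/funext => t; apply/funext => w; rewrite /q; case: eqP.
  apply: L0_adapted_pair => t; last exact: measurable_cst.
  case: (eqVneq t ord_max) => [->|_]; last exact: measurable_cst.
  by apply: measurable_indic; exact: measurable_sigma_subalgebra.
have qC t w : `|(q t w).1| <= 1 * m t w /\ `|(q t w).2| <= 1 * m t w.
  rewrite mul1r /q; case: ifP => _ /=; rewrite normr0 m_ge0 //.
  by split => //; rewrite indicE; case: (_ \in _); rewrite ?normr1 ?normr0.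
have [Z1 [Z2 [dZ Zq]]] := polar_separation aq qC nAs.
exists Z1, Z2; split => // ZA.
move: Zq; rewrite (_ : (\int[P]_w _ = 0)%E) ?ltxx//.
have [wZ Z0 _ _] := dZ.
transitivity (\int[P]_w (cst 0%E w))%E; last by rewrite integral0.
apply: ae_eq_integral => //.
- apply/measurable_EFinP/measurable_sum => t; apply: (wrtM (t := t)).
  have [w1 w2] := wZ t.
  apply: measurable_funD; apply: measurable_funM => //.
  + exact: L0_adapted_fst aq.
  + exact: L0_adapted_snd aq.
- apply: filterS ZA => w ZA _; congr EFin; apply: big1 => t _.
  rewrite /q; case: eqP => [->|_] /=; last by rewrite !mulr0 addr0.
  rewrite mulr0 addr0 indicE; have [|_] := boolP (w \in A); last by rewrite mulr0.
  rewrite inE mulr1 => /ZA z; apply/eqP; rewrite eq_le z /=.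
  by have [] := Z0 ord_max w.
Qed.

(* Exhaustion (Kreps-Yan): a countable combination whose terminal support has
   maximal probability must charge every non-null event. *)
Lemma exists_strictly_positive_dual : exists Z1 Z2 : process T Omega R,
  dual Z1 Z2 /\ {ae P, forall w, 0 < Z1 ord_max w}.
Proof.
pose supp (Z : process T Omega R) := [set w | 0 < Z ord_max w].
have msupp Z1 Z2 : dual Z1 Z2 -> measurable (supp Z1).
  move=> [wZ _ _ _]; have mZ : measurable_fun setT (Z1 ord_max).
    by apply: (wrtM (t := ord_max)); have [] := wZ ord_max.
  rewrite (_ : supp Z1 = Z1 ord_max @^-1` `]0, +oo[%classic); last first.
    by apply/seteqP; split => w /=; rewrite in_itv /= andbT.
  by rewrite -[X in measurable X]setTI; apply: mZ => //; exact: measurable_itv.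
pose masses := [set P (supp Z.1) | Z in [set Z : process T Omega R * process T Omega R | dual Z.1 Z.2]].
pose al := ereal_sup masses.
have mass_le Z1 Z2 : dual Z1 Z2 -> (P (supp Z1) <= al)%E.
  by move=> dZ; apply: ereal_sup_ubound; exists (Z1, Z2).
have PT : P setT != 0%E.
  by have -> : P setT = 1%E := probability_setT P; rewrite onee_neq0.
(* Some dual process exists, so the supremum is taken over a nonempty set and is nonnegative. *)
have [V1 [V2 [dV _]]] := exists_dual_charging measurableT PT.
have al_fin : al \is a fin_num.
  rewrite ge0_fin_numE; last exact: le_trans (mass_le _ _ dV).
  apply: (@le_lt_trans _ _ 1%E); last by rewrite ltry.
  apply: ge_ereal_sup => _ [[Z1 Z2] /= dZ <-]; apply: probability_le1.
  exact: msupp dZ.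
have ex n : exists Z : process T Omega R * process T Omega R,
    dual Z.1 Z.2 /\ (al - (n.+1%:R^-1)%:E <= P (supp Z.1))%E.
  have e0 : 0 < n.+1%:R^-1 :> R by rewrite invr_gt0.
  have [_ [Z dZ <-] lt] := ub_ereal_sup_adherent e0 al_fin.
  by exists Z; split => //; exact: ltW.
have [Z ZP] := choice ex.
pose tot n := fine (\sum_(t < T.+1) (\int[P]_w (m t w * (Z n).1 t w)%:E
   + \int[P]_w (m t w * (Z n).2 t w)%:E))%E.
have int_ge0 n t : (0 <= \int[P]_w (m t w * (Z n).1 t w)%:E)%E /\
    (0 <= \int[P]_w (m t w * (Z n).2 t w)%:E)%E.
  have [[_ Z0 _ _] _] := ZP n.
  by split; apply: integral_ge0 => w _; have [? ?] := Z0 t w; rewrite lee_fin mulr_ge0.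
have tot_ge0 n : 0 <= tot n.
  by apply: fine_ge0; apply: sume_ge0 => t _; have [? ?] := int_ge0 n t; exact: adde_ge0.
have tot_fin n : (\sum_(t < T.+1) (\int[P]_w (m t w * (Z n).1 t w)%:E
   + \int[P]_w (m t w * (Z n).2 t w)%:E))%E \is a fin_num.
  have [[_ _ Zfin _] _] := ZP n.
  apply/sum_fin_numP => t _ _; have [f1 f2] := Zfin t; have [g1 g2] := int_ge0 n t.
  by rewrite fin_numD !ge0_fin_numE// f1 f2.
(* This factor brings every weighted integral of the n-th process below 2^-n, so the series is
   summable. *)
pose c n := 2^-1 ^+ n / (1 + tot n).
have tot1 n : 0 < 1 + tot n by rewrite ltr_pwDl.
have c_gt0 n : 0 < c n by rewrite divr_gt0// exprn_gt0.
(* Scaling is written as a linear combination with second coefficient 0, the form covered by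
   [dual_process_lin]. *)
pose Z1 n : process T Omega R := fun t w => c n * (Z n).1 t w + 0 * (Z n).1 t w.
pose Z2 n : process T Omega R := fun t w => c n * (Z n).2 t w + 0 * (Z n).2 t w.
have dZ n : dual (Z1 n) (Z2 n).
  have [dZn _] := ZP n.
  exact: (dual_process_lin Ffiltration mu01 lambda01 S2_adapted_pos wm m_ge1
    (ltW (c_gt0 n)) (lexx 0) dZn dZn).
have bound n (U : process T Omega R) t : measurable_fun setT (U t) -> (forall w, 0 <= U t w) ->
    (\int[P]_w (m t w * U t w)%:E <= (tot n)%:E)%E ->
    (\int[P]_w (m t w * (c n * U t w + 0 * U t w))%:E <= (1 * 2^-1 ^+ n)%:E)%E.
  move=> mU U0 Ule.
  rewrite (_ : (\int[P]_w _ = \int[P]_w (c n * (m t w * U t w))%:E)%E); last first.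
    by apply: eq_integral => w _; congr EFin; ring.
  rewrite ge0_integralZlr//; [|exact: ltW|exact: measurable_funM|by move=> w; rewrite mulr_ge0].
  apply: (@le_trans _ _ ((c n)%:E * (tot n)%:E)%E).
    by apply: lee_wpmul2l => //; rewrite lee_fin ltW.
  rewrite -EFinM lee_fin mul1r /c mulrAC ler_pdivrMr//.
  by apply: ler_wpM2l; [rewrite exprn_ge0|rewrite lerDr].
have part n t : (\int[P]_w (m t w * (Z n).1 t w)%:E <= (tot n)%:E)%E /\
    (\int[P]_w (m t w * (Z n).2 t w)%:E <= (tot n)%:E)%E.
  rewrite /tot fineK// (bigD1 t)//=; have [g1 g2] := int_ge0 n t.
  have g : (0 <= \sum_(i < T.+1 | i != t) (\int[P]_w (m i w * (Z n).1 i w)%:E +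
     \int[P]_w (m i w * (Z n).2 i w)%:E))%E.
    by apply: sume_ge0 => s _; have [? ?] := int_ge0 n s; exact: adde_ge0.
  split; first by rewrite -addeA leeDl// adde_ge0.
  by rewrite [X in (_ <= X + _)%E]addeC -addeA leeDl// adde_ge0.
have Zsum (b : bool) t : (\sum_(n <oo) \int[P]_w (m t w * (if b then Z1 n else Z2 n) t w)%:E < +oo)%E.
  apply: le_lt_trans (geometric_half_series_lty 1); apply: lee_nneseries => [n _ _|n _].
    have [_ Z0 _ _] := dZ n; apply: integral_ge0 => w _; have [? ?] := Z0 t w.
    by rewrite lee_fin mulr_ge0//; case: b.
  have [[wZ Z0 _ _] _] := ZP n; have [w1 w2] := wZ t.
  case: b; apply: bound; try exact: (wrtM (t := t)).
  - by move=> w; have [] := Z0 t w.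
  - by have [] := part n t.
  - by move=> w; have [] := Z0 t w.
  - by have [] := part n t.
have dZs := dual_process_series Ffiltration mu01 lambda01 S2_adapted_pos wm m_ge1
  dZ (Zsum true) (Zsum false).
set Y1 := process_series Z1 in dZs; set Y2 := process_series Z2 in dZs.
have Y1_mass n : (P (supp (Z n).1) <= P (supp Y1))%E.
  apply: ae_measure_le; [by have [dZn _] := ZP n; exact: msupp dZn|exact: msupp dZs|].
  apply: filterS (process_series_ge Ffiltration wm m_ge1 dZ (Zsum true) n ord_max) => w.
  rewrite /supp /= /Z1 mul0r addr0 => le Zw; apply: lt_le_trans le.
  by rewrite mulr_gt0.
have mY : measurable (supp Y1) := msupp _ _ dZs.
have al_le : (al <= P (supp Y1))%E.
  have fY : P (supp Y1) \is a fin_num by rewrite fin_num_measure.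
  have h n : (al - (n.+1%:R^-1)%:E <= P (supp Y1))%E.
    by apply: le_trans (Y1_mass n); have [] := ZP n.
  move: h; rewrite -(fineK al_fin) -(fineK fY) => h; rewrite lee_fin leNgt.
  apply/negP => /ltr_add_invr[k]; rewrite ltNge; apply/negP; rewrite negbK.
  by have := h k; rewrite -EFinB lee_fin lerBlDr.
exists Y1, Y2; split => //.
pose A0 := ~` supp Y1.
have mA0 : measurable A0 by apply: measurableC.
have [PA0|PA0] := eqVneq (P A0) 0%E.
  by exists A0; split => // w /=.
exfalso.
(* If the support of Y1 missed a non-null set A0, adding a dual process that charges A0 would
   enlarge the support by B. Maximality makes B null, contradicting that A0 is charged. *)
have [U1 [U2 [dU nU]]] := exists_dual_charging mA0 PA0.
have dW := dual_process_lin Ffiltration mu01 lambda01 S2_adapted_pos wm m_ge1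
  ler01 ler01 dZs dU.
set W1 := (fun t w => 1 * Y1 t w + 1 * U1 t w) in dW.
pose B := A0 `&` supp U1.
have mB : measurable B by apply: measurableI => //; exact: msupp dU.
have W_mass : (P (supp Y1) + P B <= P (supp W1))%E.
  rewrite -measureU//; last first.
    by apply/seteqP; split => w // [? []].
  apply: le_measure; rewrite ?inE; [exact: measurableU|exact: msupp dW|].
  have [_ Y0 _ _] := dZs; have [_ U0 _ _] := dU.
  have Y0w w : 0 <= Y1 ord_max w := (Y0 ord_max w).1.
  have U0w w : 0 <= U1 ord_max w := (U0 ord_max w).1.
  move=> w [Yw|[_ Uw]]; rewrite /supp /= /W1 !mul1r.
    by rewrite ltr_pwDl.
  by rewrite ltr_wpDl.
have PB : P B = 0%E.
  apply/eqP; rewrite eq_le measure_ge0 andbT.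
  have := le_trans W_mass (le_trans (mass_le _ _ dW) al_le).
  by rewrite -[leRHS]adde0 leeD2lE// fin_num_measure.
apply: nU; exists B; split => // w /= nle; split.
  by apply: contrapT => nA; apply: nle => /nA.
by rewrite /supp /= ltNge; apply/negP => le; apply: nle.
Qed.

End StrictlyPositiveDual.

Lemma integral_linearr (d : measure_display) (Omega : measurableType d)
    (R : realType) (P : {measure set Omega -> \bar R}) (a b : R) (f g : Omega -> R) :
  P.-integrable setT (EFin \o f) -> P.-integrable setT (EFin \o g) ->
  (\int[P]_w (a * f w + b * g w)%:E =
   a%:E * \int[P]_w (f w)%:E + b%:E * \int[P]_w (g w)%:E)%E.
Proof.
move=> iF iG; under eq_integral do rewrite EFinD !EFinM.
by rewrite integralD//; [rewrite !integralZl|exact: integrableZl|exact: integrableZl].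
Qed.

Section Pairing.
Context (d : measure_display) (Omega : measurableType d) (R : realType).
Variables (P : probability Omega R) (T : nat).
Variable F : 'I_T.+1 -> set (set Omega).
Hypothesis Ffiltration : is_filtration F.
Variables (mu lambda : R) (S2 m : process T Omega R).
Hypothesis wm : forall t, measurable_wrt (F t) (m t).
Hypothesis m_ge1 : forall t w, 1 <= m t w.

Let wrtM t (f : Omega -> R) : measurable_wrt (F t) f -> measurable_fun setT f.
Proof. by case: Ffiltration => sF FM _; exact: measurable_wrtW. Qed.

Local Notation dual := (dual_process P F mu lambda S2 m).

Lemma dual_process_integrable (Z1 Z2 : process T Omega R) t (g : Omega -> R) (C : R) :
  dual Z1 Z2 -> measurable_wrt (F t) g -> (forall w, `|g w| <= C * m t w) ->
  P.-integrable setT (fun w => (Z1 t w * g w)%:E) /\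
  P.-integrable setT (fun w => (Z2 t w * g w)%:E).
Proof.
move=> [wZ Z0 Zfin _] /wrtM mg gC.
have mm : measurable_fun setT (m t) by apply: (wrtM (t := t)); exact: wm.
have m0 w : 0 <= m t w by exact: le_trans (m_ge1 t w).
have key (Z : Omega -> R) : measurable_wrt (F t) Z -> (forall w, 0 <= Z w) ->
    (\int[P]_w (m t w * Z w)%:E < +oo)%E ->
    P.-integrable setT (fun w => (Z w * g w)%:E).
  move=> /wrtM mZ Z_ge0 fin.
  have iZ : P.-integrable setT (EFin \o (fun w => m t w * Z w)).
    by apply: ge0_integrabler => // [|w]; [exact: measurable_funM|exact: mulr_ge0].
  apply: le_integrable (integrableZl measurableT C iZ) => //.
    by apply/measurable_EFinP; exact: measurable_funM.
  move=> w _; rewrite -EFinM /= lee_fin normrM (ger0_norm (Z_ge0 w)).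
  apply: le_trans (ler_norm _).
  by rewrite mulrA [leRHS]mulrC; apply: ler_wpM2l => //; exact: gC.
have [w1 w2] := wZ t; have [f1 f2] := Zfin t.
by split; apply: key => // w; have [] := Z0 t w.
Qed.

Lemma dual_pairing_integrable (Z1 Z2 : process T Omega R)
    (q : process T Omega (R * R)%type) (C : R) :
  dual Z1 Z2 -> L0_adapted P F setT q ->
  (forall t w, `|(q t w).1| <= C * m t w /\ `|(q t w).2| <= C * m t w) ->
  P.-integrable setT (EFin \o (fun w => \sum_(t < T.+1)
     (Z1 t w * (q t w).1 + Z2 t w * (q t w).2))).
Proof.
move=> dZ aq qC.
have -> : EFin \o (fun w => \sum_(t < T.+1)
     (Z1 t w * (q t w).1 + Z2 t w * (q t w).2)) =
   (fun w => \sum_(t < T.+1) ((Z1 t w * (q t w).1)%:E + (Z2 t w * (q t w).2)%:E))%E.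
  by apply/funext => w; rewrite /= sumEFin.
apply: integrable_sum => // t _; apply: integrableD => //.
- have [] // := dual_process_integrable dZ (L0_adapted_fst aq)
    (fun w => (qC t w).1).
- have [] // := dual_process_integrable dZ (L0_adapted_snd aq)
    (fun w => (qC t w).2).
Qed.

End Pairing.

(** * A dual value at least x when x does not hedge *)

Section HardInequality.
Context (d : measure_display) (Omega : measurableType d) (R : realType).
Variables (P : probability Omega R) (T : nat).
Variable F : 'I_T.+1 -> set (set Omega).
Hypothesis Ffiltration : is_filtration F.
Hypothesis F_T : F ord_max = measurable.
Variables (mu lambda : R) (S2 : process T Omega R).
Hypotheses (mu01 : 0 < mu < 1) (lambda01 : 0 < lambda < 1).
Hypothesis S2_adapted_pos : L0_adapted P F [set r : R | 0 < r] S2.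
Local Notation K := (bid_ask_cone mu lambda S2).
Local Notation As := (superhedgeable P F K (0, 0)).
Hypothesis As_closed : closed_in_measure P F As.
Hypothesis no_arbitrage :
  terminal_attainable P F K (0, 0)
    `&` L0 P measurable [set x : R * R | 0 <= x.1 /\ 0 <= x.2]
  `<=` [set v : Omega -> (R * R)%type | {ae P, forall w, v w = (0, 0) :> (R * R)}].

(** Initial cash shifts the whole portfolio process, so hedging theta from (x, 0) amounts to hedging
    theta - (x, 0) from nothing. It reduces the problem to the cone of claims hedged at zero
    cost. *)
Lemma hedging_set_translation (x : R) (theta q : process T Omega (R * R)%type) :
  L0_adapted P F setT theta -> (forall t w, q t w = theta t w - (x, 0)) ->
  As q -> hedging_set P F K theta (x, 0).
Proof.
move=> atheta qE [_ [_ [xi axi <-] VK]]; split => //.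
exists (portfolio (x, 0) xi); first by exists xi.
move=> t; apply: filterS (VK t) => w; rewrite qE; congr (K t w _).
by rewrite /portfolio -[(0, 0)]/(0 : R * R) add0r opprB addrCA addrA.
Qed.

Lemma unhedged_le_expectation (x : R) (theta : process T Omega (R * R)%type) :
  L0_adapted P F setT theta -> ~ hedging_set P F K theta (x, 0) ->
  exists (X chi : process T Omega R) (Q : probability Omega R),
    [/\ randomized_stopping_times P F X,
        price_systems P F mu lambda S2 X (chi, Q) &
        (x%:E <= 'E_Q[(fun w => \sum_(t < T.+1)
          X t w * ((theta t w).1 + chi t w * (theta t w).2 * S2 t w))%R])%E].
Proof.
move=> atheta nh.
pose m : process T Omega R := fun t w => 1 + `|(theta t w).1| + `|(theta t w).2|.
have w1 t : measurable_wrt (F t) (fun w => (theta t w).1) := L0_adapted_fst atheta.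
have w2 t : measurable_wrt (F t) (fun w => (theta t w).2) := L0_adapted_snd atheta.
have wm t : measurable_wrt (F t) (m t).
  apply: measurable_funD; first apply: measurable_funD; first exact: measurable_cst.
    by apply: measurableT_comp => //; exact: w1.
  by apply: measurableT_comp => //; exact: w2.
have m_ge1 t w : 1 <= m t w by rewrite /m -addrA lerDl addr_ge0.
have th1 t w : `|(theta t w).1| <= m t w.
  by rewrite /m addrAC lerDr addr_ge0.
have th2 t w : `|(theta t w).2| <= m t w by rewrite /m lerDr addr_ge0.
pose q : process T Omega (R * R)%type := fun t w => ((theta t w).1 - x, (theta t w).2).
have aq : L0_adapted P F setT q.
  by apply: L0_adapted_pair => t //; apply: measurable_funB => //; exact: w1.
have qC t w : `|(q t w).1| <= (1 + `|x|) * m t w /\ `|(q t w).2| <= (1 + `|x|) * m t w.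
  have xm : `|x| <= `|x| * m t w by rewrite ler_peMr.
  rewrite mulrDl mul1r; split; last by rewrite /= (le_trans (th2 t w))// lerDl (le_trans _ xm).
  by apply: le_trans (ler_normB _ _) _; rewrite lerD.
have nAs : ~ As q.
  move=> Aq; apply: nh; apply: hedging_set_translation Aq => // t w.
  by rewrite /q; case: (theta t w) => a b /=; rewrite -[RHS]/(a - x, b - 0) subr0.
(* Pairing with one unit of cash at every date yields E[sum Z1], the quantity to normalize. As theta
   = q + x [one2], the final value is E[Z q] + x. *)
pose one2 : process T Omega (R * R)%type := fun _ _ => (1, 0).
have aone : L0_adapted P F setT one2 by apply: L0_adapted_pair => t; exact: measurable_cst.
have oneC t w : `|(one2 t w).1| <= 1 * m t w /\ `|(one2 t w).2| <= 1 * m t w.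
  by rewrite mul1r /one2 /= normr1 normr0 m_ge1 (le_trans _ (m_ge1 t w)).
pose pairing (Z1 Z2 : process T Omega R) (v : process T Omega (R * R)%type) w :=
  \sum_(t < T.+1) (Z1 t w * (v t w).1 + Z2 t w * (v t w).2).
have [Y1 [Y2 [dY Yq]]] := polar_separation Ffiltration mu01 lambda01
  S2_adapted_pos As_closed wm m_ge1 aq qC nAs.
have [U1 [U2 [dU U_gt0]]] := exists_strictly_positive_dual Ffiltration F_T mu01
  lambda01 S2_adapted_pos As_closed no_arbitrage wm m_ge1.
have iq (Z1 Z2 : process T Omega R) : dual_process P F mu lambda S2 m Z1 Z2 ->
    P.-integrable setT (EFin \o pairing Z1 Z2 q).
  by move=> dZ; exact: dual_pairing_integrable dZ aq qC.
have i1 (Z1 Z2 : process T Omega R) : dual_process P F mu lambda S2 m Z1 Z2 ->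
    P.-integrable setT (EFin \o pairing Z1 Z2 one2).
  by move=> dZ; exact: dual_pairing_integrable dZ aone oneC.
have pairing_lin a b (Z1 Z2 Z1' Z2' : process T Omega R) v w :
    pairing (fun t w => a * Z1 t w + b * Z1' t w) (fun t w => a * Z2 t w + b * Z2' t w) v w
    = a * pairing Z1 Z2 v w + b * pairing Z1' Z2' v w.
  by rewrite /pairing !mulr_sumr -big_split /=; apply: eq_bigr => t _; ring.
have [a Ya] : exists a, (\int[P]_w (pairing Y1 Y2 q w)%:E = a%:E)%E.
  by exists (fine (\int[P]_w (pairing Y1 Y2 q w)%:E)%E); rewrite fineK// integrable_fin_num//; exact: iq.
have [b Ub] : exists b, (\int[P]_w (pairing U1 U2 q w)%:E = b%:E)%E.
  by exists (fine (\int[P]_w (pairing U1 U2 q w)%:E)%E); rewrite fineK// integrable_fin_num//; exact: iq.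
have a_gt0 : 0 < a by move: Yq; rewrite -lte_fin -Ya.
(* Chosen so that e |b| < a: the perturbed pairing a + e b stays positive whatever the sign of b. *)
pose e := a / (2 * (`|b| + 1)).
have e_gt0 : 0 < e by rewrite divr_gt0// mulr_gt0.
pose W1 : process T Omega R := fun t w => 1 * Y1 t w + e * U1 t w.
pose W2 : process T Omega R := fun t w => 1 * Y2 t w + e * U2 t w.
have dW : dual_process P F mu lambda S2 m W1 W2.
  exact: (dual_process_lin Ffiltration mu01 lambda01 S2_adapted_pos wm m_ge1
    ler01 (ltW e_gt0) dY dU).
have Wq : (\int[P]_w (pairing W1 W2 q w)%:E = (a + e * b)%:E)%E.
  under eq_integral do rewrite pairing_lin.
  by rewrite integral_linearr; [rewrite Ya Ub mul1e|exact: iq|exact: iq].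
have aeb : 0 < a + e * b.
  have : e * `|b| < a.
    rewrite /e mulrAC ltr_pdivrMr ?mulr_gt0// ltr_pM2l//; have := normr_ge0 b; lra.
  have := ler_norm (- b); rewrite normrN => nb.
  have : e * - b <= e * `|b| by rewrite ler_pM2l.
  by lra.
have [k Wk] : exists k, (\int[P]_w (pairing W1 W2 one2 w)%:E = k%:E)%E.
  by exists (fine (\int[P]_w (pairing W1 W2 one2 w)%:E)%E); rewrite fineK// integrable_fin_num//; exact: i1.
have one2E Z1 Z2 w : pairing Z1 Z2 one2 w = \sum_(t < T.+1) Z1 t w.
  by apply: eq_bigr => t _; rewrite /= mulr1 mulr0 addr0.
have [wW W0 _ _] := dW.
have W_gt0 : {ae P, forall w, 0 < W1 ord_max w}.
  have [_ Y0 _ _] := dY.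
  apply: filterS U_gt0 => w Uw; rewrite /W1 mul1r ltr_wpDl ?mulr_gt0//.
  by have [] := Y0 ord_max w.
(* The pairing with [one2] is at least W1_T, which is positive a.s., so its integral cannot
   vanish. *)
have k_gt0 : 0 < k.
  have W10 t w : 0 <= W1 t w by have [] := W0 t w.
  have sW0 w : 0 <= pairing W1 W2 one2 w by rewrite one2E sumr_ge0.
  have : 0 <= k by rewrite -lee_fin -Wk; apply: integral_ge0 => w _; rewrite lee_fin.
  rewrite le_eqVlt => /orP[/eqP k0|//]; exfalso.
  have : P setT = 0%E.
    apply: (@ae_gt0_integral_eq0 _ _ _ P (pairing W1 W2 one2)) => //.
    - by apply/measurable_EFinP; exact: (measurable_int P (i1 _ _ dW)).
    - apply: filterS W_gt0 => w Ww _; rewrite one2E (bigD1 ord_max)//=.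
      by rewrite ltr_pwDl// sumr_ge0.
    - by rewrite Wk -k0.
  by have -> : P setT = 1%E := probability_setT P; move/eqP; rewrite onee_eq0.
have ki : 0 <= k^-1 by rewrite invr_ge0 ltW.
pose Z1 : process T Omega R := fun t w => k^-1 * W1 t w + 0 * W1 t w.
pose Z2 : process T Omega R := fun t w => k^-1 * W2 t w + 0 * W2 t w.
have dZ : dual_process P F mu lambda S2 m Z1 Z2.
  exact: (dual_process_lin Ffiltration mu01 lambda01 S2_adapted_pos wm m_ge1
    ki (lexx 0) dW dW).
have Zone : (\int[P]_w (pairing Z1 Z2 one2 w)%:E = 1)%E.
  under eq_integral do rewrite pairing_lin.
  rewrite integral_linearr; [|exact: i1|exact: i1].
  by rewrite Wk mul0e adde0 -EFinM mulVf// gt_eqF.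
have Zq : (0 <= \int[P]_w (pairing Z1 Z2 q w)%:E)%E.
  under eq_integral do rewrite pairing_lin.
  rewrite integral_linearr; [|exact: iq|exact: iq].
  by rewrite Wq mul0e adde0 -EFinM lee_fin mulr_ge0// ltW.
have Z_gt0 : {ae P, forall w, 0 < Z1 ord_max w}.
  by apply: filterS W_gt0 => w Ww; rewrite /Z1 mul0r addr0 mulr_gt0// invr_gt0.
have sZ : (\int[P]_w (\sum_(t < T.+1) Z1 t w)%:E = 1%:E)%E.
  by rewrite -Zone; apply: eq_integral => w _; rewrite one2E.
have iZ t : P.-integrable setT (fun w => (Z1 t w * (theta t w).1)%:E) /\
    P.-integrable setT (fun w => (Z2 t w * (theta t w).2)%:E).
  split.
  - have [] // := dual_process_integrable (C := 1) Ffiltration wm m_ge1 dZ (w1 t).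
    by move=> w; rewrite mul1r.
  - have [] // := dual_process_integrable (C := 1) Ffiltration wm m_ge1 dZ (w2 t).
    by move=> w; rewrite mul1r.
have [X [chi [Q [rX pQ EQ]]]] := dual_pair_realization Ffiltration mu01 lambda01
  S2_adapted_pos
  (dual_process_pair Ffiltration mu01 lambda01 S2_adapted_pos wm m_ge1 dZ)
  Z_gt0 sZ atheta iZ.
exists X, chi, Q; split => //; rewrite EQ.
rewrite (_ : (\int[P]_w _)%E = (\int[P]_w (1 * pairing Z1 Z2 q w + x * pairing Z1 Z2 one2 w)%:E)%E).
  rewrite integral_linearr; [|exact: iq|exact: i1].
  by rewrite Zone mul1e mule1 leeDr.
apply: eq_integral => w _; congr EFin.
by rewrite mul1r mulr_sumr -big_split /=; apply: eq_bigr => t _; rewrite /=; ring.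
Qed.

End HardInequality.

Theorem mainTheorem4 (R : realType) (d : measure_display)
  (Omega : measurableType d) (P : probability Omega R)
  (Pcomplete : measure_is_complete P)
  (T : nat) (T_ge1 : (1 <= T)%N)
  (F : 'I_T.+1 -> set (set Omega))
  (Ffiltration : is_filtration F)
  (F_T : F ord_max = measurable)
  (F_0 : forall A, F ord0 A -> P A = 0%E \/ P A = 1%E)
  (mu lambda : R)
  (mu01 : 0 < mu < 1) (lambda01 : 0 < lambda < 1)
  (S2 : process T Omega R)
  (S2_adapted_pos : L0_adapted P F [set r : R | 0 < r] S2)
  (K : 'I_T.+1 -> Omega -> set (R * R)%type)
  (K_def : K = bid_ask_cone mu lambda S2)
  (As_closed : closed_in_measure P F (superhedgeable P F K (0, 0)))
  (no_arbitrage :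
     terminal_attainable P F K (0, 0)
       `&` L0 P measurable [set x : R * R | 0 <= x.1 /\ 0 <= x.2]
     = [set v : Omega -> (R * R)%type | L0 P measurable setT v /\ {ae P, forall w, v w = (0, 0) :> (R * R)}])
  (theta : process T Omega (R * R)%type)
  (theta_adapted : L0_adapted P F setT theta)
  (theta_bounded_below : exists c : R, forall t,
     {ae P, forall w, c <= (theta t w).1 /\ c <= (theta t w).2}) :
  ereal_inf [set x1%:E | x1 in [set x1 : R | hedging_set P F K theta (x1, 0)]]
  = ereal_sup
      [set ereal_sup
         [set ('E_(cQ.2)[(fun w => \sum_(t < T.+1)
            X t w * ((theta t w).1 + cQ.1 t w * (theta t w).2 * S2 t w))%R])%E
          | cQ in price_systems P F mu lambda S2 X]
       | X in randomized_stopping_times P F].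
Proof.
subst K; apply/eqP; rewrite eq_le; apply/andP; split; last first.
  have [c thetac] := theta_bounded_below.
  apply: ge_ereal_sup => _ [X rX <-]; apply: ge_ereal_sup => _ [[chi Q] pQ <-].
  apply: le_ereal_inf_tmp => _ [x hx <-].
  exact: (hedging_price_ge_expectation Ffiltration F_0 mu01 lambda01
    S2_adapted_pos theta_adapted thetac hx rX pQ).
set s := ereal_sup _; set h := ereal_inf _.
(* Every real r above the supremum hedges theta, for otherwise some dual pair would have value at
   least r. Stating this for real r covers infinite suprema too. *)
have inf_le (r : R) : (s < r%:E)%E -> (h <= r%:E)%E.
  move=> sr.
  have [hr|nr] := pselect (hedging_set P F (bid_ask_cone mu lambda S2) theta (r, 0)).
    by apply: ereal_inf_lbound; exists r.
  have NA : terminal_attainable P F (bid_ask_cone mu lambda S2) (0, 0)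
      `&` L0 P measurable [set x : R * R | 0 <= x.1 /\ 0 <= x.2]
      `<=` [set v : Omega -> (R * R)%type | {ae P, forall w, v w = (0, 0) :> (R * R)}].
    by rewrite no_arbitrage => v [].
  have [X [chi [Q [rX pQ rE]]]] := unhedged_le_expectation Ffiltration F_T
    mu01 lambda01 S2_adapted_pos As_closed NA theta_adapted nr.
  exfalso; move: sr; rewrite ltNge => /negP; apply; apply: le_trans rE _.
  apply: le_trans (ereal_sup_ubound _); last by exists X.
  by apply: ereal_sup_ubound; exists (chi, Q).
(* If the supremum is -oo, every real bounds the infimum from above, so the infimum is -oo; in the
   finite case r is taken as s + e with e > 0 arbitrary. *)
case: s inf_le => [s| |] inf_le; last 2 first.
- by rewrite leey.
- by rewrite leeNy_eq; apply/eqP/eq_ninfty => r; apply: inf_le; rewrite ltNyr.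
apply/lee_addgt0Pr => e e0; rewrite -EFinD; apply: inf_le.
by rewrite lte_fin ltrDl.
Qed.
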